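(* Let $n\ge1$ and $e\ge2$ be integers, $l=2$, and let $\mathbf{s}=(s_1,s_2)\in\mathbb{Z}^2$ with $s_1>s_2$. For $N\ge0$ let $\mathsf{m}_e(N):=((q+1)^r,q^{e-1-r})$ with $N=q(e-1)+r$, $q\ge0$, $0\le r\le e-2$ (the image of the partition $(N)$ under the Mullineux involution in type $A$). Then: 1. $((n),\emptyset)_{\theta_{\mathbf{s}}}=((n),\emptyset)$. 2. If $j\in\{0,\dots,e-1\}$ satisfies $j\equiv s_1-s_2\pmod e$, then $$(\emptyset,(n))_{\theta_{\mathbf{s}}}=\begin{cases}(\emptyset,(n))&\text{if }n\le j,\\((n-j),(j))&\text{otherwise.}\end{cases}$$ 3. $((1^n),\emptyset)_{\theta_{\mathbf{s}}}=(\mathsf{m}_e(n),\emptyset)$. 4. If $j\in\{0,\dots,e-1\}$ satisfies $j\equiv s_2-s_1\pmod e$, then $$(\emptyset,(1^n))_{\theta_{\mathbf{s}}}=\begin{cases}(\emptyset,(1^n))&\text{if }n\le j,\\(\mathsf{m}_e(n-j),(1^j))&\text{otherwise.}\end{cases}$$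
   Context: **Hecke algebra of type $B_n$.** Let $A=\mathbb{C}[q^{\pm1},Q_1,Q_2]$ with $q,Q_1,Q_2$ indeterminates (this $q$ is unrelated to the quotient $q$ of the claim), and $K=\mathrm{Frac}(A)$. $\mathcal{H}$ is the associative $A$-algebra generated by $T_0,\dots,T_{n-1}$ with relations $(T_0-Q_1)(T_0-Q_2)=0$, $(T_i-q)(T_i+1)=0$ ($1\le i\le n-1$), $(T_0T_1)^2=(T_1T_0)^2$, $T_iT_{i+1}T_i=T_{i+1}T_iT_{i+1}$ ($1\le i\le n-2$), $T_iT_j=T_jT_i$ ($j\ge i+2$). A $2$-partition $\boldsymbol{\lambda}=(\lambda^1,\lambda^2)\vdash_2 n$ is a pair of partitions of total size $n$ (partitions are extended by infinitely many zero parts; exponents denote repeated parts; $(0)=(1^0)=\emptyset$). The algebra $K\mathcal{H}$ is split semisimple with simple modules $KV^{\boldsymbol{\lambda}}$, $\boldsymbol{\lambda}\vdash_2 n$; $KV^{\boldsymbol{\lambda}}$ is characterized by having a basis indexed by standard $\boldsymbol{\lambda}$-tableaux $\mathfrak{t}$ on which, for $1\le i\le n$, $L_i=q^{1-i}T_{i-1}\cdots T_1T_0T_1\cdots T_{i-1}$ acts by the scalar $Q_cq^{b-a}$, where $(a,b,c)$ (row $a$, column $b$, component $c$) is the node containing $i$ in $\mathfrak{t}$. $V^{\boldsymbol{\lambda}}$ denotes an $\mathcal{H}$-module, free of finite rank over $A$, with $K\otimes_AV^{\boldsymbol{\lambda}}\simeq KV^{\boldsymbol{\lambda}}$. The one dimensional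 ones are: $((n),\emptyset)$ and $(\emptyset,(n))$, with $T_i\mapsto q$ for $i\ge1$ and $T_0\mapsto Q_1$, resp. $Q_2$; $((1^n),\emptyset)$ and $(\emptyset,(1^n))$, with $T_i\mapsto-1$ for $i\ge1$ and $T_0\mapsto Q_1$, resp. $Q_2$. **Specialization.** Let $\eta\in\mathbb{C}$ be a primitive $e$-th root of $1$; $\theta_{\mathbf{s}}:A\to\mathbb{C}$ sends $q\mapsto\eta$, $Q_j\mapsto\eta^{s_j}$. $\mathbb{C}_{\theta_{\mathbf{s}}}\mathcal{H}$ and $\mathbb{C}_{\theta_{\mathbf{s}}}V^{\boldsymbol{\lambda}}$ are the specializations; $[\mathbb{C}_{\theta_{\mathbf{s}}}V^{\boldsymbol{\lambda}}:M]$ is the composition multiplicity of a simple module $M$ (independent of the choice of $V^{\boldsymbol{\lambda}}$). **Labels of simple modules.** Choose rationals $v_1<v_2<v_1+e$ and put $m_j=s_j-v_j$. For $\boldsymbol{\lambda}\vdash_2 n$ let $\kappa_1(\boldsymbol{\lambda})\ge\kappa_2(\boldsymbol{\lambda})\ge\cdots$ be the elements of the multiset $\{\lambda^c_a-a+m_c\mid c\in\{1,2\},\ a\ge1\}$ in weakly decreasing order. Write $\boldsymbol{\mu}\ll\boldsymbol{\lambda}$ if $\boldsymbol{\mu}=\boldsymbol{\lambda}$, or if $\kappa(\boldsymbol{\mu})\ne\kappa(\boldsymbol{\lambda})$ and $\sum_{i\le t}\kappa_i(\boldsymbol{\mu})\le\sum_{i\le t}\kappa_i(\boldsymbol{\lambda})$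 for all $t\ge1$. It is known that for each simple $\mathbb{C}_{\theta_{\mathbf{s}}}\mathcal{H}$-module $M$ there is a unique $\boldsymbol{\lambda}_M\vdash_2 n$ with $[\mathbb{C}_{\theta_{\mathbf{s}}}V^{\boldsymbol{\lambda}_M}:M]=1$ and such that $[\mathbb{C}_{\theta_{\mathbf{s}}}V^{\boldsymbol{\mu}}:M]\ne0$ implies $\boldsymbol{\mu}\ll\boldsymbol{\lambda}_M$; moreover $M\mapsto\boldsymbol{\lambda}_M$ is injective and does not depend on the choice of the $v_j$. If $V^{\boldsymbol{\lambda}}$ is one dimensional, $\boldsymbol{\lambda}_{\theta_{\mathbf{s}}}:=\boldsymbol{\lambda}_M$ for the simple module $M=\mathbb{C}_{\theta_{\mathbf{s}}}V^{\boldsymbol{\lambda}}$. *)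

(* Defs.v *)
From HB Require Import structures.
From mathcomp Require Import all_boot all_order all_algebra.
From mathcomp Require Import boolp reals complex.

Set Implicit Arguments.
Unset Strict Implicit.
Unset Printing Implicit Defensive.

Import Order.TTheory GRing.Theory Num.Theory.
Local Open Scope ring_scope.

(* Component c of a pair: c = false is component 1, c = true is component 2. *)
Definition component (X : Type) (x : X * X) (c : bool) : X := if c then x.2 else x.1.

(* A partition is the sequence of its nonzero parts, so that nth 0 extends it
   by zero parts and equality of partitions is Leibniz equality. *)
Definition is_part (p : seq nat) : bool := sorted geq p && (0%N \notin p).

Definition mkpart (p : seq nat) : seq nat := [seq x <- p | 0 < x]%N.

Notation bipart := (seq nat * seq nat)%type.

Definition is_bipart (n : nat) (la : bipart) : bool :=
  [&& is_part la.1, is_part la.2 & (sumn la.1 + sumn la.2 == n)%N].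

(* Nodes (row, column, component), rows and columns being counted from 0. *)
Definition node : Type := (nat * nat * bool)%type.

Definition in_diagram (la : bipart) (x : node) : bool :=
  (x.1.2 < nth 0 (component la x.2) x.1.1)%N.

(* A tableau is given by the inverse of its filling: t k is the node that
   contains k.+1. *)
Definition standard n (la : bipart) (t : {ffun 'I_n -> node}) : Prop :=
  [/\ injective t,
      forall x : node, in_diagram la x <-> exists k, t k = x,
      forall (k k' : 'I_n) a b c,
        t k = (a, b, c) -> t k' = (a, b.+1, c) -> (k < k')%N
    & forall (k k' : 'I_n) a b c,
        t k = (a, b, c) -> t k' = (a.+1, b, c) -> (k < k')%N].

(* The Euclidean division is N = q (e - 1) + r. *)
Definition mull_row (e N : nat) : seq nat :=
  let q := (N %/ e.-1)%N in let r := (N %% e.-1)%N in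
  mkpart (nseq r q.+1 ++ nseq (e.-1 - r) q).

Section Dominance.

Variable m : rat * rat.

(* lambda^c_a - a + m_c, for the row a.+1 *)
Definition beta (la : bipart) (c : bool) (a : nat) : rat :=
  (nth 0%N (component la c) a)%:R - a.+1%:R + component m c.

(* kappa la i is the (i+1)-st largest element of the multiset of all beta la c a.
   As beta la c strictly decreases, the i+1 largest elements can be taken in the
   first i+1 rows of the two components. *)
Definition kappa (la : bipart) (i : nat) : rat :=
  nth 0 (sort >=%R [seq beta la c a | c <- [:: false; true], a <- iota 0 i.+1]) i.

Definition bip_le (mu la : bipart) : Prop :=
  mu = la \/
  (~ kappa mu =1 kappa la /\
   forall t, (0 < t)%N -> \sum_(i < t) kappa mu i <= \sum_(i < t) kappa la i).

End Dominance.

(* The rows are the vectors: T_i acts on 'rV[R]_d by v |-> v *m T i, so that a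
   word in the T_i acts through the product of the matrices in reverse order.
   The set of defining relations is stable under reversal of words, hence the
   families below are exactly the modules, with underlying space R^d, over the
   algebra presented by these generators and relations. *)
Definition hecke_module (n : nat) (R : comNzRingType) (q : R) (Q : R * R)
    (d : nat) (T : 'I_n -> 'M[R]_d) : Prop :=
  [/\ forall i : 'I_n, i = 0%N :> nat ->
        (T i - (Q.1)%:M) *m (T i - (Q.2)%:M) = 0,
      forall i : 'I_n, (0 < i)%N -> (T i - q%:M) *m (T i + 1%:M) = 0,
      forall i j : 'I_n, i = 0%N :> nat -> j = 1%N :> nat ->
        T i *m T j *m T i *m T j = T j *m T i *m T j *m T i,
      forall i j : 'I_n, (0 < i)%N -> j = i.+1 :> nat ->
        T i *m T j *m T i = T j *m T i *m T j
    & forall i j : 'I_n, (i.+2 <= j)%N -> T i *m T j = T j *m T i].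

Section ModulesOverField.

Variables (n : nat) (F : fieldType).

Section OneModule.

Variables (d : nat) (T : 'I_n -> 'M[F]_d).

(* L_{k+1} = q^{-k} T_k ... T_1 T_0 T_1 ... T_k *)
Definition jucys_murphy (q : F) (k : 'I_n) : 'M[F]_d :=
  q ^- k *: \big[mulmx/1%:M]_(j <- rev [seq j : 'I_n <- enum 'I_n | (0 < j <= k)%N]
                              ++ [seq j : 'I_n <- enum 'I_n | (j <= k)%N]) T j.

Definition submodule (U : 'M[F]_d) : Prop := forall i, stablemx U (T i).

Definition simple_module : Prop :=
  (0 < d)%N /\ forall U, submodule U -> (U == 0 :> 'M[F]_d)%MS \/ row_full U.

(* Us_0 < Us_1 < ... is a maximal chain of submodules above 0. *)
Definition composition_series (Us : seq 'M[F]_d) : Prop :=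
  let U i := nth 0 (0 :: Us) i in
  [/\ row_full (last 0 Us),
      forall i, (i <= size Us)%N -> submodule (U i),
      forall i, (i < size Us)%N -> (U i < U i.+1)%MS
    & forall i W, (i < size Us)%N -> submodule W ->
        (U i <= W)%MS -> (W <= U i.+1)%MS ->
        (W == U i)%MS \/ (W == U i.+1)%MS].

(* The matrix f induces an isomorphism from the quotient module W / U onto S. *)
Definition subquotient_iso (U W : 'M[F]_d) (m : nat) (S : 'I_n -> 'M[F]_m) : Prop :=
  exists f : 'M[F]_(d, m),
    [/\ row_full (W *m f), (U == W :&: kermx f)%MS
      & forall i, W *m T i *m f = W *m f *m S i].

Definition comp_mult (m : nat) (S : 'I_n -> 'M[F]_m) (k : nat) : Prop :=
  exists2 Us, composition_series Us &
    k = count (fun i => `[< subquotient_iso (nth 0 (0 :: Us) i)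
                                            (nth 0 (0 :: Us) i.+1) S >])
              (iota 0 (size Us)).

(* T is the simple module KV^la: B is the matrix of basis vectors, and t is the
   bijection from its rows to the standard la-tableaux. *)
Definition is_KV (q : F) (Q : F * F) (la : bipart) : Prop :=
  [/\ hecke_module q Q T, simple_module
    & exists (t : 'I_d -> {ffun 'I_n -> node}) (B : 'M[F]_d),
      [/\ injective t, forall u, standard la u <-> exists r, t r = u,
          B \in unitmx
        & forall (r : 'I_d) (k : 'I_n),
            let: (a, b, c) := t r k in
            row r B *m jucys_murphy q k
            = (component Q c * q ^ (b%:Z - a%:Z)) *: row r B]].

End OneModule.

End ModulesOverField.

(* K = C(q, Q_1, Q_2), as the fraction field of C[q][Q_1][Q_2]. *)
Section Generic.

Variable C : fieldType.

Notation pol := {poly {poly {poly C}}}.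
Definition genK : Type := {fraction pol}.
HB.instance Definition _ := GRing.Field.on genK.

Definition fracK (p : pol) : genK := FracField.tofrac p.

Definition qP : pol := ('X%:P)%:P.
Definition Q1P : pol := 'X%:P.
Definition Q2P : pol := 'X.

(* (k, p) represents p / q^k. *)
Definition laurent_repr (x : genK) : pred (nat * pol) :=
  fun kp => x == fracK kp.2 / fracK qP ^+ kp.1.

Definition laurent : {pred genK} := fun x => `[< exists kp, laurent_repr x kp >].

Lemma laurentP (x : genK) : reflect (exists kp, laurent_repr x kp) (x \in laurent).
Proof. exact: asboolP. Qed.

Lemma fracK_q_neq0 : fracK qP != 0.
Proof. by rewrite /fracK tofrac_eq0 !polyC_eq0 polyX_eq0. Qed.

Lemma laurent_subring : subring_closed laurent.
Proof.
have qn0 k : fracK qP ^+ k != 0 by rewrite expf_neq0 // fracK_q_neq0.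
split=> [|_ _ /laurentP[[k p] /eqP->] /laurentP[[l r] /eqP->]
         |_ _ /laurentP[[k p] /eqP->] /laurentP[[l r] /eqP->]] /=;
  apply/laurentP.
- by exists (0%N, 1); rewrite /laurent_repr /= expr0 divr1 /fracK tofrac1.
- exists ((k + l)%N, p * qP ^+ l - r * qP ^+ k); rewrite /laurent_repr /=.
  rewrite -mulNr addf_div // exprD /fracK tofracB !tofracM !tofracXn mulNr.
  by rewrite eqxx.
- exists ((k + l)%N, p * r); rewrite /laurent_repr /=.
  by rewrite mulf_div exprD /fracK tofracM.
Qed.

HB.instance Definition _ :=
  GRing.isSubringClosed.Build genK laurent laurent_subring.

(* A = C[q^{+-1}, Q_1, Q_2], as a subring of K *)
Definition genA : Type := {x : genK | x \in laurent}.
HB.instance Definition _ := SubChoice.on genA.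
HB.instance Definition _ := [SubChoice_isSubComNzRing of genA by <:].

Lemma fracK_laurent (p : pol) : fracK p \in laurent.
Proof. by apply/laurentP; exists (0%N, p); rewrite /laurent_repr expr0 divr1. Qed.

Definition polA (p : pol) : genA := Sub (fracK p) (fracK_laurent p).

Definition qA : genA := polA qP.
Definition QA : genA * genA := (polA Q1P, polA Q2P).
Definition qK : genK := val qA.
Definition QK : genK * genK := (val QA.1, val QA.2).

Section Specialization.

Variables (x x1 x2 : C).

Definition eval_pol (p : pol) : C := p.[(x2%:P)%:P].[x1%:P].[x].

(* The specialization q |-> x, Q_j |-> x_j; it is meaningful for x != 0. *)
Definition theta (y : genA) : C :=
  let kp := xchoose (laurentP _ (valP y)) in eval_pol kp.2 / x ^+ kp.1.

Lemma thetaE (y : genA) k p : x != 0 ->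
  val y = fracK p / fracK qP ^+ k -> theta y = eval_pol p / x ^+ k.
Proof.
move=> x0; rewrite /theta; move: (xchooseP (laurentP _ (valP y))).
case: xchoose => l r /eqP /= -> /eqP.
rewrite eqr_div ?expf_neq0 ?fracK_q_neq0 //.
rewrite /fracK -!tofracXn -!tofracM tofrac_eq => /eqP/(congr1 eval_pol).
rewrite /eval_pol !hornerM !horner_exp /qP !hornerC hornerX => E.
by apply/eqP; rewrite eqr_div ?expf_neq0 ?E.
Qed.

Lemma eval_pol_zmod : zmod_morphism eval_pol.
Proof. by move=> p r; rewrite /eval_pol !hornerD !hornerN. Qed.

Lemma theta_morphism : x != 0 -> zmod_morphism theta /\ monoid_morphism theta.
Proof.
move=> x0; have qn0 k : fracK qP ^+ k != 0 by rewrite expf_neq0 // fracK_q_neq0.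
have xn0 k : x ^+ k != 0 by rewrite expf_neq0.
split=> [y z|]; last split=> [|y z].
- have /laurentP[[k p] /eqP Ey] := valP y; have /laurentP[[l r] /eqP Ez] := valP z.
  rewrite (thetaE x0 Ey) (thetaE x0 Ez).
  rewrite (@thetaE _ (k + l)%N (p * qP ^+ l - r * qP ^+ k)) //.
    rewrite -[in RHS]mulNr addf_div // exprD eval_pol_zmod /eval_pol.
    by rewrite !hornerM !horner_exp /qP !hornerC hornerX mulNr.
  rewrite rmorphB /= Ey Ez -mulNr addf_div // exprD /fracK.
  by rewrite tofracB !tofracM !tofracXn mulNr.
- rewrite (@thetaE _ 0%N 1) //; first by rewrite /eval_pol !hornerC expr0 divr1.
  by rewrite rmorph1 expr0 divr1 /fracK tofrac1.
- have /laurentP[[k p] /eqP Ey] := valP y; have /laurentP[[l r] /eqP Ez] := valP z.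
  rewrite (thetaE x0 Ey) (thetaE x0 Ez) (@thetaE _ (k + l)%N (p * r)) //.
    by rewrite /eval_pol !hornerM exprD mulf_div.
  by rewrite rmorphM /= Ey Ez mulf_div exprD /fracK tofracM.
Qed.

Lemma theta_pol (p : pol) : x != 0 -> theta (polA p) = eval_pol p.
Proof. by move=> x0; rewrite (@thetaE _ 0%N p) // expr0 divr1. Qed.

Lemma theta_gen : x != 0 ->
  [/\ theta qA = x, theta QA.1 = x1 & theta QA.2 = x2].
Proof.
move=> x0; rewrite !theta_pol // /eval_pol /qP /Q1P /Q2P.
by rewrite !(hornerC, hornerX).
Qed.

End Specialization.

Section Labels.

Variable n : nat.

(* T is an H-module V^la, free of rank d over A, with K (x) V^la = KV^la. *)
Definition is_V (la : bipart) (d : nat) (T : 'I_n -> 'M[genA]_d) : Prop :=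
  hecke_module qA QA T /\ is_KV (fun i => map_mx val (T i)) qK QK la.

Variables (eta : C) (s : int * int).

(* C (x) T for the specialization theta_s *)
Definition specialize d (T : 'I_n -> 'M[genA]_d) : 'I_n -> 'M[C]_d :=
  fun i => map_mx (theta eta (eta ^ s.1) (eta ^ s.2)) (T i).

(* [C (x) V^la : M] = k *)
Definition decomp_number (la : bipart) m (M : 'I_n -> 'M[C]_m) (k : nat) : Prop :=
  exists d (T : 'I_n -> 'M[genA]_d), is_V la T /\ comp_mult (specialize T) M k.

Variable v : rat * rat.

Definition charge : rat * rat := (s.1%:~R - v.1, s.2%:~R - v.2).

(* lambda_M = la. Such a la is unique: two of them are comparable both ways for
   bip_le, so they have the same kappa, and bip_le then forces equality. *)
Definition is_label m (M : 'I_n -> 'M[C]_m) (la : bipart) : Prop :=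
  [/\ is_bipart n la, decomp_number la M 1
    & forall mu k, is_bipart n mu -> decomp_number mu M k -> k <> 0%N ->
        bip_le charge mu la].

(* V^la is one dimensional and la_{theta_s} = mu. *)
Definition theta_label (la mu : bipart) : Prop :=
  exists2 T : 'I_n -> 'M[genA]_1, is_V la T & is_label (specialize T) mu.

End Labels.

End Generic.

(* Main.v *)
Require Import Defs.
From HB Require Import structures.
From mathcomp Require Import all_boot all_order all_algebra.
From mathcomp Require Import boolp reals complex.
From mathcomp Require Import zify ring lra.

Set Implicit Arguments.
Unset Strict Implicit.
Unset Printing Implicit Defensive.

Import Order.TTheory GRing.Theory Num.Theory.
Local Open Scope ring_scope.

(** Let M be one of the four one-dimensional modules, on which T_i, i >= 1, acts by
    chi = q or -1, and let t0 be the standard tableau of the claimed label whose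
    first b entries fill a row or a column of the second component, the other ones
    filling the first component by columns of height p, where p = 1 if chi = q and
    p = e - 1 if chi = -1.

    If M is a composition factor of the specialization of V^mu, then the
    Jucys-Murphy eigenvalues of M are the residues of some standard mu-tableau.
    Entry by entry, the charged contents of that tableau are at most those of t0,
    whence mu << la, and for mu = la the tableau is t0, so that M occurs at most
    once in the specialization of V^la.

    It does occur, for a suitable integral form. In the seminormal form of KV^la
    let Z be the C[q]-span of the orbit of the vector of t0 under the T_i, i > b.
    As at each step at most two nodes are removable, the coefficient along the
    vector of t0 is, on Z, regular at the specialization, where it gives a
    functional on which these T_i act by chi. Z is free because C[q] is principal,
    and translating a basis by the shuffles of {1..b} and {b+1..n} gives a basis of
    an H-stable lattice over A which has M as a quotient after specialization. *)

(** * Standard tableaux *)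

(** The height p = e - 1 comes from the residues: when every T_i acts by -1, the residue drops by
    one at each entry, and the head of a column carries the residue that follows the foot of the
    previous column exactly when p is -1 modulo e. The second component takes the first b entries
    because none of their residues is that of the corner of the first one; s_1 > s_2 gives b <= p
    (s_1 - s_2), so that the second component never overtakes the first later on. The obstacle to an
    integral form is freeness: A is not principal, and seminormal coefficients have poles at the
    specialization. On tableaux that begin as t0, the T_i with i > b only compare contents of the
    first component, where Q_1 cancels; this leaves C[q] as base ring, and Q_1, Q_2 come back with
    the shuffles only. The coefficient along t0 is regular because the relevant matrix entry of T_i
    is affine in the content of one node, hence given by a Jucys-Murphy element, which acts on these
    vectors as a multiple of a word in the T_i, i > b. *)

Section TableauCombinatorics.

Local Open Scope nat_scope.

(** [standard] for functions on [nat], of which only the values below n count; this keeps the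
    arithmetic of entries free of ordinals. [standardE] relates the two. *)
Definition std (n : nat) (la : bipart) (f : nat -> node) : Prop :=
  [/\ forall k k', k < n -> k' < n -> f k = f k' -> k = k',
      forall x, in_diagram la x <-> exists2 k, k < n & f k = x,
      forall k k' a b c, k < n -> k' < n ->
        f k = (a, b, c) -> f k' = (a, b.+1, c) -> k < k'
    & forall k k' a b c, k < n -> k' < n ->
        f k = (a, b, c) -> f k' = (a.+1, b, c) -> k < k'].

Lemma is_part_nth p i j : is_part p -> i <= j -> nth 0 p j <= nth 0 p i.
Proof.
case/andP=> sp _ ij; case: (ltnP j (size p)) => jp; last by rewrite nth_default.
have geq_trans : transitive geq by move=> a b c /= h1 h2; apply: leq_trans h2 h1.
have := sorted_leq_nth geq_trans (fun x => leqnn x) 0 sp.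
by apply; rewrite ?inE ?(leq_ltn_trans ij).
Qed.

Lemma is_part_ext p p' : is_part p -> is_part p' ->
  (forall i, nth 0 p i = nth 0 p' i) -> p = p'.
Proof.
move=> /andP[_ z] /andP[_ z'] E.
apply: (@eq_from_nth _ 0) => [|i _]; last exact: E.
apply/eqP; rewrite eqn_leq; apply/andP; split; rewrite leqNgt; apply/negP => lt.
- by move/negP: z; apply; rewrite -[0](@nth_default _ 0 p' (size p')) // -E mem_nth.
- by move/negP: z'; apply; rewrite -[0](@nth_default _ 0 p (size p)) // E mem_nth.
Qed.

Section Tableaux.

Variables (n : nat) (la : bipart).
Hypotheses (la1 : is_part la.1) (la2 : is_part la.2).

Lemma diagram_closed a b c a' b' : a' <= a -> b' <= b ->
  in_diagram la (a, b, c) -> in_diagram la (a', b', c).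
Proof.
rewrite /in_diagram /= => ha hb h.
apply: leq_ltn_trans hb (leq_trans h _).
by case: c {h} => /=; apply: is_part_nth.
Qed.

Variable f : nat -> node.
Hypothesis Hf : std n la f.

Lemma std_pred k a b c a' b' : k < n -> f k = (a, b, c) -> a' <= a -> b' <= b ->
  exists2 k', k' < n & f k' = (a', b', c).
Proof.
case: Hf => _ H _ _ kn fk ha hb; apply/H; apply: diagram_closed ha hb _.
by apply/H; exists k.
Qed.

Lemma std_mono k k' a b c a' b' : k < n -> k' < n ->
  f k = (a, b, c) -> f k' = (a', b', c) -> a <= a' -> b <= b' -> k <= k'.
Proof.
move: {2}(a' - a + (b' - b)) (erefl (a' - a + (b' - b))) => m.
elim: m k' a' b' => [|m IH] k' a' b' E kn k'n fk fk' ha hb.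
  have [? ?] : a = a' /\ b = b' by lia.
  subst a' b'; case: Hf => inj _ _ _.
  by rewrite (inj k k') // fk fk'.
case: Hf => _ _ hrow hcol.
case: (ltnP a a') => [lta|gea].
  have [k2 k2n fk2] : exists2 k2, k2 < n & f k2 = (a'.-1, b', c).
    by apply: std_pred k'n fk' _ _; lia.
  have h1 : k <= k2 by apply: IH k2n fk fk2 _ _ => //; lia.
  apply: leq_trans h1 (ltnW _); apply: (hcol _ _ a'.-1 b' c) => //.
  by rewrite fk' prednK // (leq_ltn_trans _ lta).
have [k2 k2n fk2] : exists2 k2, k2 < n & f k2 = (a', b'.-1, c).
  by apply: std_pred k'n fk' _ _; lia.
have h1 : k <= k2 by apply: IH k2n fk fk2 _ _ => //; lia.
apply: leq_trans h1 (ltnW _); apply: (hrow _ _ a' b'.-1 c) => //.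
by rewrite fk' prednK //; lia.
Qed.

(** Stepping back to the corner of component c lowers the entry at each of the a + b steps, and the
    corner itself is not filled before time b0. *)
Lemma std_bound b0 k a b c : (forall i, i < b0 -> i < n -> (f i).2 != c) ->
  k < n -> f k = (a, b, c) -> b0 + a + b <= k.
Proof.
move=> hc; move: {2}(a + b) (erefl (a + b)) => m.
elim: m k a b => [|m IH] k a b E kn fk.
  have -> : b0 + a + b = b0 by lia.
  rewrite leqNgt; apply/negP => kb.
  by move: (hc _ kb kn); rewrite fk eqxx.
case: Hf => _ _ hrow hcol.
case: (posnP a) => [a0|apos].
  have [k2 k2n fk2] : exists2 k2, k2 < n & f k2 = (a, b.-1, c).
    by apply: std_pred kn fk _ _; lia.
  have := IH _ _ _ _ k2n fk2; have : k2 < k.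
    by apply: (hrow _ _ a b.-1 c) => //; rewrite fk prednK //; lia.
  by move=> h /(_ ltac:(lia)) h'; lia.
have [k2 k2n fk2] : exists2 k2, k2 < n & f k2 = (a.-1, b, c).
  by apply: std_pred kn fk _ _; lia.
have := IH _ _ _ _ k2n fk2; have : k2 < k.
  by apply: (hcol _ _ a.-1 b c) => //; rewrite fk prednK //; lia.
by move=> h /(_ ltac:(lia)) h'; lia.
Qed.

Lemma std_bound0 k a b c : k < n -> f k = (a, b, c) -> a + b <= k.
Proof. by move=> kn fk; have := @std_bound 0 k a b c; apply. Qed.

(** The hypothesis on row neighbours makes each column step cost p units of time instead of one;
    residues will supply it with p = e - 1. *)
Lemma std_bound_step p b0 k a b c : 0 < p ->
  (forall i, i < b0 -> i < n -> (f i).2 != c) ->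
  (forall k k' a b, k < n -> k' < n -> f k = (a, b, c) -> f k' = (a, b.+1, c) ->
    k + p <= k') ->
  k < n -> f k = (a, b, c) -> b0 + a + b * p <= k.
Proof.
move=> p0 hc hp; elim: b k => [|b IH] k kn fk.
  by have := std_bound hc kn fk; lia.
have [k2 k2n fk2] : exists2 k2, k2 < n & f k2 = (a, b, c).
  by apply: std_pred kn fk _ _; lia.
have := IH _ k2n fk2; have := hp _ _ _ _ k2n kn fk2 fk; lia.
Qed.

(** Between two nodes of one diagonal, the right and lower neighbours of the first one must be
    filled, and then the node diagonally below it. Hence contents at distance one or two in time
    differ, which the denominators of the seminormal form require. *)
Lemma std_same_content k k' a b a' b' c : k < n -> k' < n ->
  f k = (a, b, c) -> f k' = (a', b', c) -> a' + b = a + b' -> k < k' -> k + 3 <= k'.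
Proof.
move=> kn k'n fk fk' E lt.
have lta : a < a'.
  rewrite ltnNge; apply/negP => ge.
  by have := std_mono k'n kn fk' fk ge; lia.
have [k1 k1n fk1] : exists2 k1, k1 < n & f k1 = (a, b.+1, c).
  by apply: std_pred k'n fk' _ _; lia.
have [k2 k2n fk2] : exists2 k1, k1 < n & f k1 = (a.+1, b, c).
  by apply: std_pred k'n fk' _ _; lia.
have [k3 k3n fk3] : exists2 k1, k1 < n & f k1 = (a.+1, b.+1, c).
  by apply: std_pred k'n fk' _ _; lia.
have h3 : k3 <= k' by apply: std_mono k3n k'n fk3 fk' _ _; lia.
case: Hf => _ _ hrow hcol.
have h1 := hrow _ _ _ _ _ kn k1n fk fk1.
have h2 := hcol _ _ _ _ _ kn k2n fk fk2.
have h4 := hcol _ _ _ _ _ k1n k3n fk1 fk3.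
have h5 := hrow _ _ _ _ _ k2n k3n fk2 fk3.
have : k1 <> k2 by move=> E'; move: fk2; rewrite -E' fk1 => -[]; lia.
lia.
Qed.

(** Contents that differ by one belong to nodes comparable in the north-west to south-east order,
    and the later entry cannot be the north-west one. *)
Lemma std_adjacent k a b a' b' c : k.+1 < n ->
  f k = (a, b, c) -> f k.+1 = (a', b', c) ->
  (a' + b == (a + b').+1) || (a + b' == (a' + b).+1) ->
  (a <= a') && (b <= b').
Proof.
move=> kn fk fk' E.
suff : ~ (a' <= a /\ b' <= b) by lia.
case=> h1 h2; have := std_mono kn (ltnW kn) fk' fk h1 h2; lia.
Qed.

End Tableaux.

Definition same_content (x y : node) : Prop :=
  x.2 = y.2 /\ x.1.1 + y.1.2 = y.1.1 + x.1.2.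

(** At the first disagreement the two nodes lie on one diagonal, so the tableau that has the lower
    one contains the upper one at an earlier time; there both tableaux agree, against injectivity.
    The shapes may differ a priori. *)
Lemma std_eq n la mu f f0 :
  is_part la.1 -> is_part la.2 -> is_part mu.1 -> is_part mu.2 ->
  std n mu f -> std n la f0 ->
  (forall k, k < n -> same_content (f k) (f0 k)) ->
  forall k, k < n -> f k = f0 k.
Proof.
move=> la1 la2 mu1 mu2 Hf Hf0 H k; elim/ltn_ind: k => k IH kn.
have [] := H k kn; case fk: (f k) => [[a b] c]; case fk0: (f0 k) => [[a' b'] c'] /=.
move=> Ec; subst c' => E.
case: (ltngtP a a') => [lt|gt|?]; last by subst a'; congr (_, _, _); lia.
- have [k2 k2n fk2] : exists2 k2, k2 < n & f0 k2 = (a, b, c).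
    by apply: (std_pred la1 la2 Hf0 kn fk0); lia.
  have le : k2 <= k by apply: (std_mono la1 la2 Hf0 k2n kn fk2 fk0); lia.
  have ne : k2 <> k by move=> E'; move: fk0; rewrite -E' fk2 => -[]; lia.
  have lt2 : k2 < k by lia.
  have := IH _ lt2 k2n; rewrite fk2 -fk.
  by case: Hf => inj _ _ _ /(inj _ _ k2n kn).
- have [k2 k2n fk2] : exists2 k2, k2 < n & f k2 = (a', b', c).
    by apply: (std_pred mu1 mu2 Hf kn fk); lia.
  have le : k2 <= k by apply: (std_mono mu1 mu2 Hf k2n kn fk2 fk); lia.
  have ne : k2 <> k by move=> E'; move: fk; rewrite -E' fk2 => -[]; lia.
  have lt2 : k2 < k by lia.
  have := IH _ lt2 k2n; rewrite fk2 -fk0 => E2.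
  by case: Hf0 => inj _ _ _; case: ne; apply: inj.
Qed.

Lemma std_shape_eq n la mu f f0 :
  is_part la.1 -> is_part la.2 -> is_part mu.1 -> is_part mu.2 ->
  std n mu f -> std n la f0 ->
  (forall k, k < n -> f k = f0 k) -> mu = la.
Proof.
move=> la1 la2 mu1 mu2 [_ Hf _ _] [_ Hf0 _ _] E.
have D x : in_diagram mu x = in_diagram la x.
  by apply/idP/idP => [/Hf|/Hf0] [k kn <-]; [rewrite E //; apply/Hf0|rewrite -E //; apply/Hf]; exists k.
have N c i : nth 0 (component mu c) i = nth 0 (component la c) i.
  have D' b : (b < nth 0 (component mu c) i) = (b < nth 0 (component la c) i).
    exact: (D (i, b, c)).
  apply/eqP; rewrite eqn_leq; apply/andP; split; rewrite leqNgt.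
    by rewrite D' ltnn.
  by rewrite -D' ltnn.
case: mu la la1 la2 mu1 mu2 N {Hf Hf0 D} => m1 m2 [l1 l2] /= ???? N.
by congr (_, _); apply: is_part_ext => // i; [have := N false i|have := N true i].
Qed.

End TableauCombinatorics.

(** * Dominance of beta-numbers *)

Lemma count_all (T : Type) (a : pred T) s : all a s -> count a s = size s.
Proof. by rewrite all_count => /eqP. Qed.

(** * Sums of the largest terms of a sequence *)

Section SortedSums.

Implicit Types (s : seq rat) (x y : rat).

Definition desc s : seq rat := sort >=%R s.

Lemma nth_desc s i j : (i <= j < size s)%N -> nth 0%R (desc s) j <= nth 0%R (desc s) i.
Proof.
move=> /andP[ij js].
have so : sorted >=%R (desc s) by apply: sort_sorted => a b; exact: le_total.
have tr : transitive (>=%R : rel rat) by move=> a b c /= h1 h2; exact: le_trans h2 h1.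
have := sorted_leq_nth tr (fun x => lexx x) 0 so.
by apply; rewrite ?inE ?size_sort // (leq_ltn_trans ij).
Qed.

Lemma count_desc (a : pred rat) s : count a (desc s) = count a s.
Proof. by apply/permP; rewrite perm_sort. Qed.

Lemma mem_take_desc s i y : (i < size s)%N -> y \in take i.+1 (desc s) ->
  nth 0%R (desc s) i <= y.
Proof.
move=> si /(nthP 0)[j]; rewrite size_take size_sort => h <-.
have ji : (j < i.+1)%N by move: h; case: ifP; lia.
by rewrite nth_take //; apply: nth_desc; lia.
Qed.

Lemma mem_drop_desc s i y : (i < size s)%N -> y \in drop i (desc s) ->
  y <= nth 0%R (desc s) i.
Proof.
move=> si /(nthP 0)[j]; rewrite size_drop size_sort => h <-.
by rewrite nth_drop; apply: nth_desc; rewrite leq_addr /= -ltn_subRL.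
Qed.

Lemma count_gt_desc s i : (i < size s)%N ->
  (count (fun z : rat => (z > nth 0%R (desc s) i)%R) s <= i)%N.
Proof.
move=> si; rewrite -count_desc -[X in count _ X](cat_take_drop i) count_cat.
rewrite [X in (_ + X)%N](_ : _ = 0%N) ?addn0.
  by apply: leq_trans (count_size _ _) _; rewrite size_take size_sort si.
apply/eqP; rewrite -leqn0 leqNgt -has_count; apply/hasPn => y /(mem_drop_desc si).
by rewrite -leNgt.
Qed.

Lemma count_ge_desc s i : (i < size s)%N ->
  (i < count (fun z : rat => (z >= nth 0%R (desc s) i)%R) s)%N.
Proof.
move=> si; rewrite -count_desc -[X in count _ X](cat_take_drop i.+1) count_cat.
apply: leq_trans (leq_addr _ _).
have /count_all -> : all (fun z : rat => (z >= nth 0%R (desc s) i)%R) (take i.+1 (desc s)).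
  by apply/allP => y /(mem_take_desc si).
by rewrite size_take size_sort; case: ifP; lia.
Qed.

(** Counting the terms above y and those at least y pins down the term of rank i, so that [kappa]
    can be computed with any number of rows without looking into the sort. *)
Lemma nth_desc_unique s i y : (count (fun z : rat => (z > y)%R) s <= i)%N ->
  (i < count (fun z : rat => (z >= y)%R) s)%N -> nth 0%R (desc s) i = y.
Proof.
move=> h1 h2; have si : (i < size s)%N by apply: leq_trans h2 (count_size _ _).
have := count_gt_desc si; have := count_ge_desc si.
set z := nth 0 _ _ => hz1 hz2.
case: (ltgtP z y) => // lt; exfalso.
- suff : (count (fun w : rat => (w >= y)%R) s <= count (fun w : rat => (w > z)%R) s)%N by lia.
  by apply: sub_count => w /=; apply: lt_le_trans.
- suff : (count (fun w : rat => (w >= z)%R) s <= count (fun w : rat => (w > y)%R) s)%N by lia.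
  by apply: sub_count => w /=; apply: lt_le_trans.
Qed.

Definition pospart x : rat := Num.max x 0.

(** Dual to the sums of largest terms: [excess s x] plus t x bounds the sum of the t largest terms
    for every x, with equality when x separates these from the others. Unlike those sums, it is
    additive over the terms. *)
Definition excess s x : rat := \sum_(y <- s) pospart (y - x).

Lemma excess_desc s x : excess (desc s) x = excess s x.
Proof. by apply: perm_big; rewrite perm_sort. Qed.

Lemma sum_nth_take s t : (t <= size s)%N ->
  \sum_(i < t) nth 0%R (desc s) i = \sum_(y <- take t (desc s)) y.
Proof.
move=> ts; rewrite (big_nth 0) size_take size_sort.
have -> : (if (t < size s)%N then t else size s) = t by case: ifP; lia.
by rewrite big_mkord; apply: eq_bigr => i _; rewrite nth_take.
Qed.

Lemma sum_const_seq s x : \sum_(y <- s) x = (size s)%:R * x.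
Proof. by rewrite big_const_seq count_predT iter_addr addr0 mulr_natl. Qed.

Lemma top_le_excess s t x : (t <= size s)%N ->
  \sum_(i < t) nth 0%R (desc s) i <= excess s x + t%:R * x.
Proof.
move=> ts; rewrite sum_nth_take // -excess_desc /excess.
rewrite -[X in \sum_(y <- X) pospart _](cat_take_drop t) big_cat /=.
have -> : t%:R * x = \sum_(y <- take t (desc s)) x.
  rewrite sum_const_seq size_take size_sort.
  by have -> : (if (t < size s)%N then t else size s) = t by case: ifP; lia.
rewrite addrAC -big_split /= -[X in X <= _]addr0; apply: lerD.
  by apply: ler_sum => y _; rewrite /pospart; case: (lerP (y - x) 0); lra.
by apply: sumr_ge0 => y _; rewrite /pospart le_max lexx orbT.
Qed.

Lemma top_eq_excess s t x : (t <= size s)%N ->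
  (forall y, y \in take t (desc s) -> x <= y) ->
  (forall y, y \in drop t (desc s) -> y <= x) ->
  \sum_(i < t) nth 0%R (desc s) i = excess s x + t%:R * x.
Proof.
move=> ts h1 h2; rewrite sum_nth_take // -excess_desc /excess.
rewrite -[X in \sum_(y <- X) pospart _](cat_take_drop t) big_cat /=.
have -> : t%:R * x = \sum_(y <- take t (desc s)) x.
  rewrite sum_const_seq size_take size_sort.
  by have -> : (if (t < size s)%N then t else size s) = t by case: ifP; lia.
rewrite addrAC -big_split /= [X in _ = _ + X]big1_seq ?addr0 //.
  apply: eq_big_seq => y /h1 xy; rewrite /pospart.
  by case: (lerP (y - x) 0); lra.
by move=> y /= /h2 yx; rewrite /pospart; case: (lerP (y - x) 0); lra.
Qed.

End SortedSums.

(** * Comparing beta-numbers through tableaux *)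

Section Dominance.

Variable m : rat * rat.

Definition node_value (x : node) : rat :=
  x.1.2%:R - x.1.1%:R + component m x.2.

Definition betas (la : bipart) (r : nat) : seq rat :=
  [seq beta m la c a | c <- [:: false; true], a <- iota 0 r].

Lemma size_betas la r : size (betas la r) = (r + r)%N.
Proof. by rewrite /betas size_allpairs size_iota /=; lia. Qed.

Lemma count_betas P la r : count P (betas la r) =
  (count P [seq beta m la false a | a <- iota 0 r] +
   count P [seq beta m la true a | a <- iota 0 r])%N.
Proof. by rewrite /betas /= cats0 count_cat. Qed.

Lemma beta_desc la c a a' : is_part la.1 -> is_part la.2 -> (a <= a')%N ->
  beta m la c a' <= beta m la c a.
Proof.
move=> la1 la2 aa'; rewrite /beta lerD2r.
have h1 : (nth 0%N (component la c) a' <= nth 0%N (component la c) a)%N.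
  by case: c => /=; apply: is_part_nth.
rewrite -(ler_nat rat) in h1; rewrite -(ler_nat rat) in aa'.
rewrite -[a'.+1]addn1 -[a.+1]addn1 !natrD; lra.
Qed.

(** A beta-number beyond the first i + 1 rows and above the term of rank i would come with i + 1
    others of its component at least as large, one too many; so further rows do not change that
    term. *)
Lemma kappaE la i r : is_part la.1 -> is_part la.2 -> (i < r)%N ->
  kappa m la i = nth 0%R (desc (betas la r)) i.
Proof.
move=> la1 la2 ir; symmetry; apply: nth_desc_unique.
all: have Er : iota 0 r = iota 0 i.+1 ++ iota (0 + i.+1) (r - i.+1) by rewrite -iotaD subnKC.
- have si : (i < size (betas la i.+1))%N by rewrite size_betas; lia.
  have := count_gt_desc si; rewrite -/(kappa m la i); set y := kappa m la i.
  rewrite !count_betas Er !map_cat !count_cat.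
  have key c : (count (fun z : rat => (z > y)%R) [seq beta m la c a | a <- iota 0 i.+1] <= i)%N ->
      count (fun z : rat => (z > y)%R) [seq beta m la c a | a <- iota (0 + i.+1) (r - i.+1)] = 0%N.
    move=> hc; apply/eqP; rewrite -leqn0 leqNgt -has_count; apply/negP.
    rewrite has_map => /hasP[a]; rewrite mem_iota => ha /= ya; move: hc.
    have /count_all -> : all (fun z : rat => (z > y)%R) [seq beta m la c a | a <- iota 0 i.+1].
      rewrite all_map; apply/allP => a'; rewrite mem_iota => ha' /=.
      by apply: lt_le_trans ya _; apply: beta_desc => //; lia.
    by rewrite size_map size_iota ltnn.
  move=> h; have := leq_trans (leq_addr _ _) h; have := leq_trans (leq_addl _ _) h.
  by move=> /key -> /key ->; rewrite !addn0.
- have si : (i < size (betas la i.+1))%N by rewrite size_betas; lia.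
  have := count_ge_desc si; rewrite -/(kappa m la i); set y := kappa m la i.
  rewrite !count_betas Er !map_cat !count_cat => h.
  by apply: leq_trans h _; apply: leq_add; apply: leq_addr.
Qed.

Lemma sum_kappa la t r : is_part la.1 -> is_part la.2 -> (t <= r)%N ->
  \sum_(i < t) kappa m la i = \sum_(i < t) nth 0%R (desc (betas la r)) i.
Proof.
move=> la1 la2 tr; apply: eq_bigr => i _; apply: kappaE => //.
by apply: leq_trans tr.
Qed.

Lemma excess_betas la r x : excess (betas la r) x =
  \sum_(c <- [:: false; true]) \sum_(a <- iota 0 r) pospart (beta m la c a - x).
Proof. by rewrite /excess /betas big_allpairs_dep. Qed.

(** The increase of the positive part when a beta-number goes from y - 1 to y, that is, when a node
    of value y is appended to a row. *)
Definition step (y x : rat) : rat := pospart (y - x) - pospart (y - 1 - x).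

Lemma step_mono y y' x : y <= y' -> step y x <= step y' x.
Proof.
move=> h; rewrite /step /pospart.
by case: (lerP (y - x) 0); case: (lerP (y - 1 - x) 0);
  case: (lerP (y' - x) 0); case: (lerP (y' - 1 - x) 0); lra.
Qed.

(** At the point y' - 1 a node of value y' contributes its full 1, and any smaller value contributes
    less. *)
Lemma step_strict y y' : y < y' -> step y (y' - 1) < step y' (y' - 1).
Proof.
move=> h; rewrite /step /pospart.
by case: (lerP (y - (y' - 1)) 0); case: (lerP (y - 1 - (y' - 1)) 0);
  case: (lerP (y' - (y' - 1)) 0); case: (lerP (y' - 1 - (y' - 1)) 0); lra.
Qed.

Lemma pospart_beta la c a x : pospart (beta m la c a - x) =
  pospart (beta m ([::], [::]) c a - x) +
  \sum_(b <- iota 0 (nth 0%N (component la c) a)) step (node_value (a, b, c)) x.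
Proof.
rewrite /beta (_ : nth 0%N (component ([::], [::]) c) a = 0%N); last first.
  by case: c => /=; rewrite nth_nil.
elim: (nth _ _ _) => [|l IH]; first by rewrite big_nil addr0.
rewrite -[in iota 0 l.+1]addn1 iotaD big_cat /= big_seq1 add0n addrA -IH /step.
rewrite /node_value /=.
have -> : l.+1%:R - a.+1%:R + component m c - x = l%:R - a%:R + component m c - x :> rat.
  by rewrite -[l.+1]addn1 -[a.+1]addn1 !natrD; lra.
have -> : l%:R - a.+1%:R + component m c - x = l%:R - a%:R + component m c - 1 - x :> rat.
  by rewrite -[a.+1]addn1 !natrD; lra.
by rewrite addrC subrK.
Qed.

Definition diagram_nodes (la : bipart) (r : nat) : seq node :=
  [seq (x, c) | c <- [:: false; true],
     x <- [seq (a, b) | a <- iota 0 r, b <- iota 0 (nth 0%N (component la c) a)]].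

Lemma sum_diagram_nodes la r (G : node -> rat) :
  \sum_(x <- diagram_nodes la r) G x =
  \sum_(c <- [:: false; true]) \sum_(a <- iota 0 r)
    \sum_(b <- iota 0 (nth 0%N (component la c) a)) G (a, b, c).
Proof.
rewrite /diagram_nodes big_allpairs_dep; apply: eq_bigr => c _.
by rewrite big_allpairs_dep.
Qed.

Lemma mem_diagram_nodes la r x :
  (x \in diagram_nodes la r) = (in_diagram la x && (x.1.1 < r)%N).
Proof.
apply/allpairsPdep/idP => [[c [y [_ /allpairsPdep[a [b [ha hb ->]]] ->]]]|].
  by rewrite !mem_iota in ha hb; rewrite /in_diagram /=; lia.
case: x => [[a b] c]; rewrite /in_diagram /= => /andP[h1 h2].
exists c, (a, b); split=> //; first by case: c {h1}.
by apply/allpairsPdep; exists a, b; rewrite !mem_iota; split => //; lia.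
Qed.

Lemma uniq_diagram_nodes la r : uniq (diagram_nodes la r).
Proof.
apply: allpairs_uniq_dep => // [c _|[c x] [c' x'] _ _ /= [-> ->] //].
apply: allpairs_uniq_dep => [|a _|[a b] [a' b'] _ _ /= [-> ->]] //; exact: iota_uniq.
Qed.

(** The tableau enumerates the nodes, all of which lie in the first n rows; hence the condition on
    r. *)
Lemma excess_tableau n la f r x : is_part la.1 -> is_part la.2 -> std n la f ->
  (n <= r)%N ->
  excess (betas la r) x =
  excess (betas ([::], [::]) r) x + \sum_(k <- iota 0 n) step (node_value (f k)) x.
Proof.
move=> la1 la2 Hf nr.
rewrite -(big_map f xpredT (fun y => step (node_value y) x)).
have P : perm_eq (map f (iota 0 n)) (diagram_nodes la r).
  have [inj H _ _] := Hf; apply: uniq_perm.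
  - by rewrite map_inj_in_uniq ?iota_uniq // => k k'; rewrite !mem_iota; apply: inj.
  - exact: uniq_diagram_nodes.
  move=> [[a b] c]; rewrite mem_diagram_nodes; apply/mapP/idP.
    move=> [k]; rewrite mem_iota => /= kn E; apply/andP; split.
      by rewrite E; apply/H; exists k.
    by have := std_bound0 la1 la2 Hf kn (esym E) => /=; lia.
  by move=> /andP[/H[k kn E] _]; exists k; rewrite ?mem_iota.
rewrite (perm_big _ P) sum_diagram_nodes !excess_betas -big_split /=; apply: eq_bigr => c _.
by rewrite -big_split /=; apply: eq_bigr => a _; apply: pospart_beta.
Qed.

Lemma excess_le n la mu f f0 r x :
  is_part la.1 -> is_part la.2 -> is_part mu.1 -> is_part mu.2 ->
  std n mu f -> std n la f0 -> (n <= r)%N ->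
  (forall k, (k < n)%N -> node_value (f k) <= node_value (f0 k)) ->
  excess (betas mu r) x <= excess (betas la r) x.
Proof.
move=> la1 la2 mu1 mu2 Hf Hf0 nr H.
rewrite (excess_tableau x mu1 mu2 Hf nr) (excess_tableau x la1 la2 Hf0 nr) lerD2l.
rewrite [X in X <= _]big_seq [X in _ <= X]big_seq; apply: ler_sum => k; rewrite mem_iota => /= kn; apply: step_mono.
exact: H.
Qed.

Lemma excess_lt n la mu f f0 r k0 :
  is_part la.1 -> is_part la.2 -> is_part mu.1 -> is_part mu.2 ->
  std n mu f -> std n la f0 -> (n <= r)%N ->
  (forall k, (k < n)%N -> node_value (f k) <= node_value (f0 k)) ->
  (k0 < n)%N -> node_value (f k0) < node_value (f0 k0) ->
  excess (betas mu r) (node_value (f0 k0) - 1) < excess (betas la r) (node_value (f0 k0) - 1).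
Proof.
move=> la1 la2 mu1 mu2 Hf Hf0 nr H k0n lt.
rewrite (excess_tableau _ mu1 mu2 Hf nr) (excess_tableau _ la1 la2 Hf0 nr) ltrD2l.
have k0i : k0 \in iota 0 n by rewrite mem_iota.
rewrite [X in X < _](bigD1_seq k0) ?iota_uniq //= [X in _ < X](bigD1_seq k0) ?iota_uniq //=.
apply: ltr_leD; first exact: step_strict.
rewrite [X in X <= _]big_seq_cond [X in _ <= X]big_seq_cond; apply: ler_sum => k; rewrite mem_iota => /= /andP[kn _].
by apply: step_mono; exact: H.
Qed.

Lemma beta_small la x : is_part la.1 -> is_part la.2 ->
  exists a0, forall c a, (a0 <= a)%N -> beta m la c a <= x.
Proof.
move=> la1 la2.
have ex c : exists a0, forall a, (a0 <= a)%N -> beta m la c a <= x.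
  set z := (nth 0%N (component la c) 0)%:R + component m c - x.
  exists (Num.Def.archi_bound `|z|) => a ha; rewrite /beta.
  have h1 : (nth 0%N (component la c) a <= nth 0%N (component la c) 0)%N.
    by case: c {z ha} => /=; apply: is_part_nth.
  have h2 := archi_boundP (normr_ge0 z); have h3 := ler_norm z.
  rewrite -(ler_nat rat) in h1; rewrite -(ler_nat rat) in ha.
  by rewrite -[a.+1]addn1 natrD; rewrite /z in h2 h3 *; lra.
have [a1 h1] := ex false; have [a2 h2] := ex true.
exists (a1 + a2)%N => -[] a ha; [apply: h2|apply: h1]; lia.
Qed.

Lemma count_betas_gt la x a0 r : (forall c a, (a0 <= a)%N -> beta m la c a <= x) ->
  (count (fun z : rat => (z > x)%R) (betas la r) <= a0 + a0)%N.
Proof.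
move=> h; rewrite count_betas; apply: leq_add.
  rewrite count_map; apply: leq_trans (_ : count (fun a => a < a0)%N (iota 0 r) <= _)%N.
    by apply: sub_count => a /=; apply: contraTltn => /(h false); rewrite leNgt.
  rewrite -size_filter -[X in (_ <= X)%N](size_iota 0); apply: uniq_leq_size.
    by rewrite filter_uniq ?iota_uniq.
  by move=> a; rewrite mem_filter !mem_iota; lia.
rewrite count_map; apply: leq_trans (_ : count (fun a => a < a0)%N (iota 0 r) <= _)%N.
  by apply: sub_count => a /=; apply: contraTltn => /(h true); rewrite leNgt.
rewrite -size_filter -[X in (_ <= X)%N](size_iota 0); apply: uniq_leq_size.
  by rewrite filter_uniq ?iota_uniq.
by move=> a; rewrite mem_filter !mem_iota; lia.
Qed.

Lemma top_le_of_excess la mu t r :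
  is_part la.1 -> is_part la.2 -> is_part mu.1 -> is_part mu.2 -> (t <= r)%N ->
  (forall x, excess (betas mu r) x <= excess (betas la r) x) ->
  \sum_(i < t) kappa m mu i <= \sum_(i < t) kappa m la i.
Proof.
move=> la1 la2 mu1 mu2 tr H.
case: t tr => [|t] tr; first by rewrite !big_ord0.
have ts : (t < size (betas la r))%N by rewrite size_betas; lia.
rewrite (@sum_kappa mu _ r) // (@sum_kappa la _ r) //.
set x := nth 0%R (desc (betas la r)) t.
rewrite (@top_eq_excess (betas la r) _ x) //.
- apply: le_trans (@top_le_excess (betas mu r) _ x _) _; first by rewrite size_betas; lia.
  by rewrite lerD2r.
- by move=> y; apply: mem_take_desc.
- move=> y; rewrite -addn1 addnC -drop_drop => /mem_drop; exact: mem_drop_desc.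
Qed.

Lemma tableau_eq_of_values n la mu f f0 :
  is_part la.1 -> is_part la.2 -> is_part mu.1 -> is_part mu.2 ->
  std n mu f -> std n la f0 ->
  (forall k, (k < n)%N -> node_value (f k) = node_value (f0 k)) ->
  (forall k, (k < n)%N -> node_value (f k) = node_value (f0 k) -> (f k).2 = (f0 k).2) ->
  forall k, (k < n)%N -> f k = f0 k.
Proof.
move=> la1 la2 mu1 mu2 Hf Hf0 H Heq.
apply: (std_eq la1 la2 mu1 mu2 Hf Hf0) => k kn.
have E := H k kn; have E2 := Heq _ kn E.
split=> //; move: E; rewrite /node_value E2 => /addIr E.
have E3 : ((f k).1.1 + (f0 k).1.2)%:R = ((f0 k).1.1 + (f k).1.2)%:R :> rat.
  by rewrite !natrD; lra.
by apply/eqP; rewrite -(eqr_nat rat); apply/eqP.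
Qed.

(** Both tableaux have the same shape, hence the same excess function, which excludes a strict
    inequality at any entry. *)
Lemma tableau_rigid n la f f0 :
  is_part la.1 -> is_part la.2 -> std n la f -> std n la f0 ->
  (forall k, (k < n)%N -> node_value (f k) <= node_value (f0 k)) ->
  (forall k, (k < n)%N -> node_value (f k) = node_value (f0 k) -> (f k).2 = (f0 k).2) ->
  forall k, (k < n)%N -> f k = f0 k.
Proof.
move=> la1 la2 Hf Hf0 H Heq.
apply: (tableau_eq_of_values la1 la2 la1 la2 Hf Hf0 _ Heq) => k kn.
apply/eqP; rewrite eq_le H // leNgt; apply/negP => lt.
by have := excess_lt la1 la2 la1 la2 Hf Hf0 (leqnn n) H kn lt; rewrite ltxx.
Qed.

(* Sums of the t largest beta-numbers compare through the excess functions
   x |-> sum (beta - x)^+, to which each node contributes monotonically. *)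
Lemma bip_le_of_tableaux n la mu f f0 :
  is_part la.1 -> is_part la.2 -> is_part mu.1 -> is_part mu.2 ->
  std n mu f -> std n la f0 ->
  (forall k, (k < n)%N -> node_value (f k) <= node_value (f0 k)) ->
  (forall k, (k < n)%N -> node_value (f k) = node_value (f0 k) -> (f k).2 = (f0 k).2) ->
  bip_le m mu la.
Proof.
move=> la1 la2 mu1 mu2 Hf Hf0 H Heq.
case: (pselect (exists2 k, (k < n)%N & node_value (f k) < node_value (f0 k))); last first.
  move=> nex; left; apply: (std_shape_eq la1 la2 mu1 mu2 Hf Hf0).
  apply: (tableau_eq_of_values la1 la2 mu1 mu2 Hf Hf0 _ Heq) => k kn.
  by apply/eqP; rewrite eq_le H // leNgt; apply/negP => lt; apply: nex; exists k.
case=> k0 k0n lt; right; split; last first.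
  move=> t t0; apply: (@top_le_of_excess _ _ _ (n + t)) => //; first lia.
  by move=> x; apply: (excess_le x la1 la2 mu1 mu2 Hf Hf0) => //; lia.
(* If the two [kappa] agreed, so would the sums of their t largest terms, t being the number of
   beta-numbers of [la] above x; this contradicts the strict inequality of the excesses at x. *)
move=> E; set x := node_value (f0 k0) - 1.
have [a0 ha0] := beta_small x la1 la2.
(* Enough rows to contain all beta-numbers of [la] above x and to have t <= r, as [sum_kappa]
   demands. *)
set r := (n + a0 + a0)%N.
set t := count (fun z : rat => (z > x)%R) (betas la r).
have tr : (t <= r)%N by have := count_betas_gt r ha0; rewrite -/t /r; lia.
have ts : (t <= size (betas la r))%N by rewrite size_betas; lia.
have := excess_lt la1 la2 mu1 mu2 Hf Hf0 (_ : n <= r)%N H k0n lt.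
rewrite -/x => /(_ ltac:(rewrite /r; lia)); apply/negP; rewrite -leNgt.
have := @top_eq_excess (betas la r) t x ts.
have h1 : forall y, y \in take t (desc (betas la r)) -> x <= y.
  case et: t => [|t'] y; first by rewrite take0.
  have t's : (t' < size (betas la r))%N by rewrite -et.
  move=> /(mem_take_desc t's); apply: le_trans; rewrite leNgt; apply/negP => lt1.
  suff : (t <= t')%N by rewrite et ltnn.
  apply: leq_trans (count_gt_desc t's); apply: sub_count => z /=.
  exact: lt_trans.
have h2 : forall y, y \in drop t (desc (betas la r)) -> y <= x.
  move=> y yd; rewrite leNgt; apply/negP => lt1.
  have := count_cat (fun z : rat => (z > x)%R) (take t (desc (betas la r))) (drop t (desc (betas la r))).
  rewrite cat_take_drop count_desc -/t.
  have : (0 < count (fun z : rat => (z > x)%R) (drop t (desc (betas la r))))%N.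
    by rewrite -has_count; apply/hasP; exists y.
  case et: t => [|t']; first by rewrite take0 /=; lia.
  have t's : (t' < size (betas la r))%N by rewrite -et.
  have /count_all -> : all (fun z : rat => (z > x)%R) (take t'.+1 (desc (betas la r))).
    apply/allP => w /(mem_take_desc t's); apply: lt_le_trans.
    rewrite ltNge; apply/negP => le1.
    have ydr : y \in drop t' (desc (betas la r)).
      by move: yd; rewrite et -addn1 addnC -drop_drop => /mem_drop.
    by have := lt_le_trans lt1 (mem_drop_desc t's ydr); rewrite ltNge le1.
  by rewrite size_takel ?size_sort //; lia.
move=> /(_ h1 h2); rewrite -sum_kappa // => E1.
have := @top_le_excess (betas mu r) t x; rewrite size_betas => /(_ ltac:(lia)).
rewrite -sum_kappa // (eq_bigr (fun i : 'I_t => kappa m la i)) => [|i _]; last exact: E.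
by rewrite E1 lerD2r.
Qed.

End Dominance.

(** * The label and its tableau *)

Definition congr_mod (e : nat) (x y : int) : Prop := exists z : int, x = y + z * e%:Z.

Definition content (s : int * int) (x : node) : int :=
  component s x.2 + x.1.2%:Z - x.1.1%:Z.

(* sg = true is the sign-like case T_i |-> -1, sg = false the case T_i |-> q. *)
Definition dsign (sg : bool) : int := if sg then -1 else 1.

Definition height (sg : bool) (e : nat) : nat := if sg then e.-1 else 1%N.

Definition line (sg : bool) (b : nat) : seq nat := if sg then nseq b 1%N else mkpart [:: b].

Definition line_node (sg : bool) (k : nat) : node :=
  if sg then (k, 0%N, true) else (0%N, k, true).

Definition label_shape (sg : bool) (p b n : nat) : bipart :=
  (mull_row p.+1 (n - b), line sg b).

Definition label_tab (sg : bool) (p b k : nat) : node :=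
  if (k < b)%N then line_node sg k
  else (((k - b) %% p)%N, ((k - b) %/ p)%N, false).

Lemma mkpart_is_part s : sorted geq s -> is_part (mkpart s).
Proof.
move=> so; apply/andP; split.
  by apply: sorted_filter so => a b c /= h1 h2; apply: leq_trans h2 h1.
by rewrite mem_filter ltnn.
Qed.

Lemma nth_mkpart s i : sorted geq s -> nth 0%N (mkpart s) i = nth 0%N s i.
Proof.
elim: s i => [|x s IH] i //= so; rewrite /mkpart /=.
have so' := path_sorted so.
case: (posnP x) => [x0|xp]; last by case: i => [|i] //=; apply: IH.
have s0 : all (pred1 0%N) s.
  have geqT : transitive geq by move=> a b c /= h1 h2; apply: leq_trans h2 h1.
  apply: sub_all (order_path_min geqT so) => y /=; rewrite x0 => yx; apply/eqP.
  by move: yx; rewrite /geq /=; lia.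
have -> : [seq y <- s | 0 < y]%N = [::].
  by apply/eqP; rewrite -size_eq0 size_filter -leqn0 leqNgt -has_count;
    apply/hasPn => y /(allP s0) /eqP ->.
rewrite nth_nil; case: i => [|i] /=; first by rewrite x0.
case: (ltnP i (size s)) => h; last by rewrite nth_default.
by apply/esym/eqP/(allP s0)/mem_nth.
Qed.

Lemma sumn_mkpart s : sumn (mkpart s) = sumn s.
Proof. by elim: s => [|[|x] s IH] //=; rewrite ?add0n -?IH. Qed.

Lemma sorted_two r k (q : nat) : sorted geq (nseq r q.+1 ++ nseq k q).
Proof.
have cst m x y : (x <= y)%N -> path geq y (nseq m x).
  elim: m y => //= m IH y xy; rewrite IH //.
  by rewrite andbT.
have h m (x : nat) : sorted geq (nseq m x) by case: m => //= m; apply: cst.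
elim: r => [|r IH] //=.
case: r IH => [|r] /= IH; first exact: cst.
by rewrite leqnn.
Qed.

Lemma nth_mull_row p m a : (0 < p)%N ->
  nth 0%N (mull_row p.+1 m) a = if (a < p)%N then (m %/ p + (a < m %% p))%N else 0%N.
Proof.
move=> p0; rewrite /mull_row /= nth_mkpart ?sorted_two // nth_cat size_nseq !nth_nseq.
have := ltn_pmod m p0; set r := (m %% p)%N => rp.
case: (ltnP a r) => ar; first by rewrite (ltn_trans ar rp) addn1.
have -> : (a - r < p - r)%N = (a < p)%N by lia.
by rewrite addn0.
Qed.

Lemma mull_row_is_part p m : is_part (mull_row p.+1 m).
Proof. by apply: mkpart_is_part; apply: sorted_two. Qed.

Lemma sumn_mull_row p m : (0 < p)%N -> sumn (mull_row p.+1 m) = m.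
Proof.
move=> p0; rewrite sumn_mkpart sumn_cat !sumn_nseq /=.
have := divn_eq m p; have := ltn_pmod m p0.
set q := (m %/ p)%N; set r := (m %% p)%N => h1 ->; nia.
Qed.

Lemma line_is_part sg b : is_part (line sg b).
Proof.
case: sg; last by apply: mkpart_is_part.
apply/andP; split; last by elim: b => //= b IH; rewrite inE.
by have := sorted_two b 0 0; rewrite cats0.
Qed.

Lemma sumn_line sg b : sumn (line sg b) = b.
Proof. by case: sg; rewrite /line ?sumn_mkpart ?sumn_nseq /= ?mul1n ?addn0. Qed.

Lemma nth_line sg b a : nth 0%N (line sg b) a =
  if sg then (a < b)%N : nat else if a == 0%N then b else 0%N.
Proof.
case: sg; first by rewrite /line nth_nseq; case: ifP.
by rewrite /line nth_mkpart //; case: a => //= a; rewrite nth_nil.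
Qed.

Lemma label_is_bipart sg p b n : (0 < p)%N -> (b <= n)%N ->
  is_bipart n (label_shape sg p b n).
Proof.
move=> p0 bn; rewrite /is_bipart mull_row_is_part line_is_part /=.
by rewrite sumn_mull_row // sumn_line subnK.
Qed.

(** The shape behind the formula of the Mullineux image: m boxes are poured into columns of height
    p, the box in row a and column c being number c p + a. *)
Lemma in_mull_row p m a c : (0 < p)%N ->
  (c < nth 0%N (mull_row p.+1 m) a)%N = (a < p)%N && (c * p + a < m)%N.
Proof.
move=> p0; rewrite nth_mull_row //; case: (ltnP a p) => ap //=.
have := divn_eq m p; have := ltn_pmod m p0.
set q := (m %/ p)%N; set r := (m %% p)%N => h1 ->.
by apply/idP/idP; case: (ltnP a r) => h; nia.
Qed.

Lemma label_std sg p b n : (0 < p)%N -> (b <= n)%N ->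
  std n (label_shape sg p b n) (label_tab sg p b).
Proof.
move=> p0 bn.
have pair_inj (k k' : nat) : (b <= k)%N -> (b <= k')%N -> ((k - b) %% p = (k' - b) %% p)%N ->
    ((k - b) %/ p = (k' - b) %/ p)%N -> k = k'.
  by move=> h h' Em Eq; have := divn_eq (k - b)%N p; rewrite Em Eq -divn_eq; lia.
split.
- move=> k k' _ _; rewrite /label_tab; case: ltnP => h; case: ltnP => h'.
  + by rewrite /line_node; case: sg => -[].
  + by case: sg.
  + by case: sg.
  + by case=> Em Eq; apply: pair_inj.
- move=> [[a c] [|]]; rewrite /in_diagram /=.
    rewrite nth_line; split.
      case: sg => h; [exists a|exists c]; rewrite /label_tab /line_node; try lia.
      * have -> : (a < b)%N by lia.
        by have -> : c = 0%N by lia.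
      * by move: h; case: eqP => _; rewrite ?ltn0 // => h; lia.
      * by move: h; case: eqP => [->|_]; rewrite ?ltn0 // => ->.
    case=> k kn; rewrite /label_tab; case: ltnP => // kb.
    by rewrite /line_node; case: sg => -[<- <-] //; rewrite kb.
  rewrite in_mull_row //; split.
    move=> /andP[ap h]; exists (b + (c * p + a))%N; first lia.
    by rewrite /label_tab ltnNge leq_addr /= addKn modnMDl modn_small // divnMDl //
      divn_small // addn0.
  case=> k kn; rewrite /label_tab; case: ltnP => kb; first by rewrite /line_node; case: sg.
  by case=> <- <-; rewrite ltn_pmod //= -divn_eq; lia.
- move=> k k' a c d kn k'n; rewrite /label_tab.
  case: ltnP => h; case: ltnP => h' //.
  + by rewrite /line_node; case: sg => -[? ? ?] [? ? ?]; lia.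
  + by rewrite /line_node; case: sg => -[? ? <-] [? ? //].
  + by rewrite /line_node; case: sg => -[? ? <-] [? ? //].
  + case=> Ea Ec _ [Ea' Ec' _].
    have := divn_eq (k - b)%N p; have := divn_eq (k' - b)%N p.
    by rewrite Ea Ec Ea' Ec'; nia.
- move=> k k' a c d kn k'n; rewrite /label_tab.
  case: ltnP => h; case: ltnP => h' //.
  + by rewrite /line_node; case: sg => -[? ? ?] [? ? ?]; lia.
  + by rewrite /line_node; case: sg => -[? ? <-] [? ? //].
  + by rewrite /line_node; case: sg => -[? ? <-] [? ? //].
  + case=> Ea Ec _ [Ea' Ec' _].
    have := divn_eq (k - b)%N p; have := divn_eq (k' - b)%N p.
    by rewrite Ea Ec Ea' Ec'; nia.
Qed.

Lemma height_gt0 sg e : (2 <= e)%N -> (0 < height sg e)%N.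
Proof. by rewrite /height; case: sg; lia. Qed.

(** * Extremality of the label among the tableaux with prescribed residues *)

Section Maximality.

Variables (n e : nat) (s : int * int) (sg : bool) (b : nat) (c0 : bool).
Let p := height sg e.

Hypotheses (he : (2 <= e)%N) (bn : (b <= n)%N) (hs : s.2 < s.1).
Hypothesis hc0 : (0 < b)%N -> c0 = true.
Hypothesis hb : (b < e)%N.
Hypothesis hres : forall k, (k < b)%N -> ~ congr_mod e s.1 (s.2 + dsign sg * k%:Z).
Hypothesis hres' : (b < n)%N -> congr_mod e (component s c0 + dsign sg * b%:Z) s.1.
Hypothesis hgap : b%:Z <= p%:Z * (s.1 - s.2).

Variables (mu : bipart) (f : nat -> node).
Hypotheses (mu1 : is_part mu.1) (mu2 : is_part mu.2) (Hf : std n mu f).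
Hypothesis hf : forall k, (k < n)%N ->
  congr_mod e (content s (f k)) (component s c0 + dsign sg * k%:Z).

Let p0 : (0 < p)%N. Proof. exact: height_gt0. Qed.

(** The corner of the first component has residue s_1, which [hres] excludes. In the second
    component the entries so far form a line of length k, and the residue of the one addable node
    off this line differs from the required one by k + 1 up to sign, not a multiple of e as k < b <
    e. *)
Lemma initial_forced k : (k < b)%N -> f k = line_node sg k.
Proof.
elim/ltn_ind: k => k IH kb.
have kn : (k < n)%N by lia.
have := hf kn; rewrite (hc0 (leq_ltn_trans (leq0n k) kb)) /content /=.
case fk: (f k) => [[x y] c] /=.
have pr x' y' : (x' <= x)%N -> (y' <= y)%N -> ((x' < x) || (y' < y))%N ->
    exists2 k2, (k2 < k)%N & line_node sg k2 = (x', y', c).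
  move=> hx hy hxy.
  have [k2 k2n fk2] := std_pred mu1 mu2 Hf kn fk hx hy.
  have le := std_mono mu1 mu2 Hf k2n kn fk2 fk hx hy.
  have ne : k2 <> k by move=> E; move: fk; rewrite -E fk2 => -[]; lia.
  have lt : (k2 < k)%N by lia.
  by exists k2 => //; rewrite -IH //; lia.
(* In the first component the predecessors would be among the first k nodes, all of which lie in the
   second one; only the corner is left. *)
case: c fk pr => fk pr H; last first.
  have [E1 E2] : x = 0%N /\ y = 0%N.
    case: (posnP (x + y)) => [|pos]; first lia.
    have [k2 _] := pr 0%N 0%N (leq0n _) (leq0n _) ltac:(lia).
    by rewrite /line_node; case: (sg).
  by case: (hres kb); move: H; rewrite E1 E2 /= addr0 subr0.
have [z Hz] := H.
have kb' : (k < e)%N by lia.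
move: Hz pr; rewrite /component /dsign /line_node; case: (sg) => Hz pr.
- case: (posnP y) => y0.
    subst y.
    have xk := std_bound0 mu1 mu2 Hf kn fk.
    have z0 : z = 0 by nia.
    by congr (_, _, _); lia.
  have [k2 k2k [E1 E2]] := pr x y.-1 (leqnn _) ltac:(lia) ltac:(lia).
  case: (posnP x) => x0; last first.
    by have [k3 k3k [E3 E4]] := pr x.-1 y ltac:(lia) (leqnn _) ltac:(lia); lia.
  exfalso; have ze : z * e%:Z = 1 + k%:Z by lia.
  have : (z <= 0) || (1 <= z) by lia.
  by case/orP => hz; clear - hz ze kb hb he; nia.
- case: (posnP x) => x0.
    subst x.
    have xk := std_bound0 mu1 mu2 Hf kn fk.
    have z0 : z = 0 by nia.
    by congr (_, _, _); lia.
  have [k2 k2k [E1 E2]] := pr x.-1 y ltac:(lia) (leqnn _) ltac:(lia).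
  case: (posnP y) => y0; last first.
    by have [k3 k3k [E3 E4]] := pr x y.-1 (leqnn _) ltac:(lia) ltac:(lia); lia.
  exfalso; have ze : z * e%:Z = - (1 + k%:Z) by lia.
  have : (z <= -1) || (0 <= z) by lia.
  by case/orP => hz; clear - hz ze kb hb he; nia.
Qed.

(** Along a row the content grows by one, whereas in the sign case the residue drops by one at each
    entry: the time between row neighbours is -1 modulo e, hence at least e - 1 = p. *)
Lemma time_bound k x y c : (b <= k < n)%N -> f k = (x, y, c) ->
  ((if c then 0 else b) + x + y * p <= k)%N.
Proof.
move=> /andP[bk kn] fk; apply: (std_bound_step mu1 mu2 Hf p0) fk => //.
- case: c => // i ib ni; rewrite initial_forced //.
  by rewrite /line_node; case: (sg).
- move=> k1 k2 x1 y1 k1n k2n fk1 fk2.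
  have lt : (k1 < k2)%N by case: Hf => _ _ h _; apply: h fk1 fk2.
  have [z1 Hz1] := hf k1n; have [z2 Hz2] := hf k2n.
  rewrite fk1 /content /= in Hz1; rewrite fk2 /content /= in Hz2.
  move: Hz1 Hz2; rewrite /p /height /dsign; case: (sg) => Hz1 Hz2; last by lia.
  have ze : (z2 - z1) * e%:Z = 1 + (k2%:Z - k1%:Z) by lia.
  move: (z2 - z1) ze => z ze.
  have : (z <= 0) || (1 <= z) by lia.
  by case/orP => hz; clear - hz ze lt he; nia.
Qed.

(** With k - b = B p + i, [time_bound] and, for the second component, [hgap] bound the content by
    s_1 + B. It is also congruent modulo e to the content s_1 + B - i of the label; as 0 <= i < e,
    the bound improves to s_1 + B - i. *)
Lemma content_le k : (b <= k < n)%N ->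
  content s (f k) <= content s (label_tab sg p b k).
Proof.
move=> bkn; have /andP[bk kn] := bkn.
have [z1 Hz1] := hf kn; have [z2 Hz2] := hres' (leq_ltn_trans bk kn).
case fk: (f k) => [[x y] c].
have tb := time_bound bkn fk.
rewrite /label_tab ltnNge bk /= /content /=.
have dK := divn_eq (k - b)%N p; have iK := ltn_pmod (k - b)%N p0.
set B := ((k - b) %/ p)%N in dK *; set i := ((k - b) %% p)%N in iK dK *.
have kE : k%:Z = b%:Z + B%:Z * p%:Z + i%:Z by lia.
set Y := component s c + y%:Z - x%:Z.
have YB : Y <= s.1 + B%:Z.
  rewrite /Y; case: c tb {fk Y} => /= tb; last first.
    suff : (y <= B)%N by lia.
    by rewrite /B leq_divRL //; lia.
  suff : y%:Z <= s.1 - s.2 + B%:Z by lia.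
  have : y%:Z * p%:Z <= b%:Z + B%:Z * p%:Z + i%:Z by lia.
  have : i%:Z < p%:Z by lia.
  by move: hgap; set g := s.1 - s.2; nia.
have [z Yz] : exists z : int, Y = s.1 + B%:Z - i%:Z + z * e%:Z.
  move: Hz1; rewrite fk /content /= -/Y kE => ->.
  have -> : component s c0 = s.1 + z2 * e%:Z - dsign sg * b%:Z by lia.
  move: iK; rewrite /p /height /dsign; case: (sg) => iK.
    have eE : (e.-1)%:Z = e%:Z - 1 by lia.
    by rewrite eE; exists (z1 + z2 - B%:Z); ring.
  have -> : i = 0%N by lia.
  by exists (z1 + z2); ring.
have ie : (i < e)%N by move: iK; rewrite /p /height; case: (sg); lia.
have : (z <= 0) || (1 <= z) by lia.
by case/orP => hz; [nia|exfalso; nia].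
Qed.

Variable v : rat * rat.
Hypothesis hv : v.1 < v.2.

Lemma node_valueE x : node_value (charge s v) x = (content s x)%:~R - component v x.2.
Proof.
rewrite /node_value /content /charge !rmorphB !rmorphD /= !pmulrn.
by case: (x.2) => /=; lra.
Qed.

(** Values subtract v_c from contents. As v_1 < v_2 and the label has its late entries in the first
    component, [content_le] passes to values, and a late tie can occur in that component only. *)
Lemma label_value_le k : (k < n)%N ->
  node_value (charge s v) (f k) <= node_value (charge s v) (label_tab sg p b k).
Proof.
move=> kn; case: (ltnP k b) => kb.
  by rewrite /label_tab kb initial_forced.
have := @content_le k; rewrite kb kn => /(_ isT); rewrite !node_valueE -(ler_int rat).
have -> : (label_tab sg p b k).2 = false by rewrite /label_tab ltnNge kb.
set u : rat := (content s (f k))%:~R; set w : rat := (content s (label_tab _ _ _ _))%:~R.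
move: u w => u w; have := hv.
by case: (f k).2 => /=; lra.
Qed.

Lemma label_value_component k : (k < n)%N ->
  node_value (charge s v) (f k) = node_value (charge s v) (label_tab sg p b k) ->
  (f k).2 = (label_tab sg p b k).2.
Proof.
move=> kn; case: (ltnP k b) => kb.
  by rewrite /label_tab kb initial_forced.
have := @content_le k; rewrite kb kn => /(_ isT); rewrite !node_valueE -(ler_int rat).
have -> : (label_tab sg p b k).2 = false by rewrite /label_tab ltnNge kb.
set u : rat := (content s (f k))%:~R; set w : rat := (content s (label_tab _ _ _ _))%:~R.
move: u w => u w; have := hv.
by case: (f k).2 => //= h1 h2 h3; exfalso; lra.
Qed.

Lemma label_dominates : bip_le (charge s v) mu (label_shape sg p b n).
Proof.
have /and3P[la1 la2 _] := label_is_bipart sg p0 bn.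
exact: (bip_le_of_tableaux la1 la2 mu1 mu2 Hf (label_std sg p0 bn) label_value_le
  label_value_component).
Qed.

Lemma label_tab_unique : mu = label_shape sg p b n ->
  forall k, (k < n)%N -> f k = label_tab sg p b k.
Proof.
move=> E; have Hf' := Hf; rewrite E in Hf'.
have /and3P[la1 la2 _] := label_is_bipart sg p0 bn.
exact: (tableau_rigid la1 la2 Hf' (label_std sg p0 bn) label_value_le label_value_component).
Qed.

End Maximality.

(** * Rearranging the entries of the two components *)

Section Unshuffling.

Local Open Scope nat_scope.

Section Unshuffle.

Variables (n b : nat) (w : nat -> bool).
Hypothesis wb : count w (iota 0 n) = b.

Let cnt k := count w (iota 0 k).

(* The position, in the word true^b false^(n-b), of the k-th letter of w. *)
Definition unshuffle (k : nat) : nat := if w k then cnt k else b + (k - cnt k).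

Let cntS k : cnt k.+1 = cnt k + w k.
Proof. by rewrite /cnt -addn1 iotaD count_cat /= addn0 add0n. Qed.

Let cnt_le k : cnt k <= k.
Proof. by rewrite /cnt -[X in _ <= X](size_iota 0) count_size. Qed.

Let cnt_mono k j : cnt (k + j) <= cnt k + j /\ cnt k <= cnt (k + j).
Proof.
elim: j => [|j IH]; first by rewrite !addn0.
by rewrite addnS cntS; case: (w _); lia.
Qed.

Let cnt_n k : k <= n -> cnt k <= b.
Proof. by move=> kn; have := cnt_mono k (n - k); rewrite subnKC // -wb /cnt; lia. Qed.

Let cnt_n' k : k <= n -> k - cnt k <= n - b.
Proof. by move=> kn; have := cnt_mono k (n - k); rewrite subnKC // -wb /cnt; lia. Qed.

Lemma unshuffle_comp k : k < n -> (unshuffle k < b) = w k.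
Proof.
move=> kn; rewrite /unshuffle; case wk: (w k); last by lia.
by have := cnt_n kn; rewrite cntS wk; lia.
Qed.

Let b_le : b <= n. Proof. by rewrite -wb -[X in _ <= X](size_iota 0) count_size. Qed.

Lemma unshuffle_lt k : k < n -> unshuffle k < n.
Proof.
move=> kn; have := unshuffle_comp kn; rewrite /unshuffle; case wk: (w k) => h; first by lia.
by have := cnt_n' kn; rewrite cntS wk; have := cnt_le k; lia.
Qed.

Lemma unshuffle_mono k k' : w k = w k' -> k < k' -> unshuffle k < unshuffle k'.
Proof.
move=> E kk'; rewrite /unshuffle -E.
have := cnt_mono k.+1 (k' - k.+1); rewrite subnKC // cntS.
by have := cnt_le k; have := cnt_le k'; case: (w k); lia.
Qed.

Lemma unshuffle_inj k k' : k < n -> k' < n -> unshuffle k = unshuffle k' -> k = k'.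
Proof.
move=> kn k'n E; have E2 : w k = w k' by rewrite -!unshuffle_comp // E.
case: (ltngtP k k') => // lt.
  by have := unshuffle_mono E2 lt; rewrite E ltnn.
by have := unshuffle_mono (esym E2) lt; rewrite E ltnn.
Qed.

Lemma unshuffle_onto i : i < n -> exists2 k, k < n & unshuffle k = i.
Proof.
move=> hi; pose f (k : 'I_n) : 'I_n := Ordinal (unshuffle_lt (ltn_ord k)).
have fi : injective f.
  by move=> k k' /(congr1 val) /= /unshuffle_inj E; apply: val_inj; apply: E.
have [g _ fg] := injF_bij fi.
by exists (g (Ordinal hi)); rewrite ?ltn_ord // -[unshuffle _]/(val (f _)) fg.
Qed.

(** Standardness compares only entries of one component, whose order [unshuffle] preserves. Applied
    to tableaux that fill the second component first, it gives one tableau per word, hence a lower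
    bound for their number. *)
Lemma std_unshuffle la t : std n la t -> (forall k, k < n -> (t k).2 = (k < b)) ->
  std n la (fun k => t (unshuffle k)).
Proof.
move=> [inj D hrow hcol] tc.
have wE k : k < n -> (t (unshuffle k)).2 = w k.
  by move=> kn; rewrite tc ?unshuffle_lt // unshuffle_comp.
have mono k k' : k < n -> k' < n -> w k = w k' -> unshuffle k < unshuffle k' -> k < k'.
  move=> kn k'n E lt; case: (ltngtP k k') => // [gt|eq].
    by have := unshuffle_mono (esym E) gt; lia.
  by rewrite eq ltnn in lt.
split.
- move=> k k' kn k'n /(inj _ _ (unshuffle_lt kn) (unshuffle_lt k'n)).
  exact: unshuffle_inj.
- move=> x; split=> [/D[i hi <-]|[k kn <-]].
    by have [k kn <-] := unshuffle_onto hi; exists k.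
  by apply/D; exists (unshuffle k); rewrite ?unshuffle_lt.
- move=> k k' a c cc kn k'n E E'; apply: mono => //.
    by rewrite -!wE // E E'.
  by apply: hrow E E'; apply: unshuffle_lt.
- move=> k k' a c cc kn k'n E E'; apply: mono => //.
    by rewrite -!wE // E E'.
  by apply: hcol E E'; apply: unshuffle_lt.
Qed.

End Unshuffle.

Lemma count_nth_rev (v : seq bool) : count (nth false (rev v)) (iota 0 (size v)) = count id v.
Proof.
rewrite -(count_map (nth false (rev v)) id) -(size_rev v).
by rewrite -/(mkseq _ _) mkseq_nth count_rev.
Qed.

End Unshuffling.

(** * Lattices over C[q] *)

Definition set_row (R : Type) d (P : 'M[R]_d) (i0 : 'I_d) (w : 'rV[R]_d) : 'M[R]_d :=
  \matrix_(i, j) (if i == i0 then w 0 j else P i j).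

(** Cramer's rule: the cofactors along the replaced row do not see it. *)
Lemma det_set_row (R : comNzRingType) d (P : 'M[R]_d) i0 w :
  \det (set_row P i0 w) = (w *m \adj P) 0 i0.
Proof.
rewrite (expand_det_row _ i0) mxE; apply: eq_bigr => j _.
rewrite !mxE eqxx; congr (_ * _); rewrite /cofactor; congr (_ * \det _).
by apply/matrixP => a b; rewrite !mxE eq_sym (negbTE (neq_lift _ _)).
Qed.

(* A lattice in k[X]^d has a basis: take linearly independent elements whose
   determinant has minimal degree, and divide Cramer's coordinates by it. *)
Lemma poly_lattice_basis (C : fieldType) d (L : 'rV[{poly C}]_d -> Prop) (M0 : 'M_d) :
  (forall x y, L x -> L y -> L (x + y)) ->
  (forall p x, L x -> L (p *: x)) ->
  (forall i, L (row i M0)) -> \det M0 != 0 ->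
  exists P : 'M[{poly C}]_d, [/\ forall i, L (row i P), \det P != 0 &
    forall x, L x -> exists y, x = y *m P].
Proof.
move=> LD LZ LM0 dM0.
pose good k := `[< exists P : 'M[{poly C}]_d,
  [/\ forall i, L (row i P), \det P != 0 & size (\det P) = k] >].
have ex : exists k, good k by exists (size (\det M0)); apply/asboolP; exists M0.
case: (ex_minnP ex) => k /asboolP[P [LP dP szP]] kmin.
exists P; split => // w Lw.
have dvd i0 : \det P %| (w *m \adj P) 0 i0.
  set y := (w *m \adj P) 0 i0; rewrite /dvdp; apply/negPn/negP => r0.
  (* Subtracting a multiple of row i0 turns the determinant into the remainder of y; if nonzero, it
     would have smaller degree, against minimality. *)
  have rE : \det (set_row P i0 (w - (y %/ \det P) *: row i0 P)) = y %% \det P.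
    rewrite det_set_row mulmxBl mxE [X in _ + X]mxE -scalemxAl -row_mul mul_mx_adj -/y.
    rewrite !mxE eqxx mulr1n {1}(divp_eq y (\det P)).
    by rewrite addrAC subrr add0r.
  have : good (size (y %% \det P)).
    apply/asboolP; exists (set_row P i0 (w - (y %/ \det P) *: row i0 P)).
    split; rewrite ?rE // => i.
    case: (eqVneq i i0) => [->|ii0].
      have -> : row i0 (set_row P i0 (w - (y %/ \det P) *: row i0 P)) =
          w + (- (y %/ \det P)) *: row i0 P.
        by apply/rowP => j; rewrite !mxE eqxx mulNr.
      by apply: LD => //; apply: LZ.
    have -> : row i (set_row P i0 (w - (y %/ \det P) *: row i0 P)) = row i P; last exact: LP.
    by apply/rowP => j; rewrite !mxE (negbTE ii0).
  by move/kmin; rewrite -szP leqNgt ltn_modp dP.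
exists (\row_i ((w *m \adj P) 0 i %/ \det P)).
set x := \row_i _.
have xE : w *m \adj P = \det P *: x.
  by apply/rowP => i; rewrite [RHS]mxE [x _ _]mxE mulrC divpK.
have : \det P *: w = \det P *: (x *m P).
  by rewrite scalemxAl -xE -mulmxA mul_adj_mx mul_mx_scalar.
move/rowP => E; apply/rowP => j; have := E j; rewrite !mxE => /(mulfI dP).
by move=> ->.
Qed.

(** * Composition series *)

Section CompositionSeries.

Variables (F : fieldType) (n d : nat) (T : 'I_n -> 'M[F]_d).

(** A composition series of the submodule W only, to allow induction on the rank of W. The last term
    is W up to equality of row spaces. *)
Definition maximal_chain (W : 'M[F]_d) (Us : seq 'M[F]_d) : Prop :=
  let U i := nth 0 (0 :: Us) i in
  [/\ (last 0 Us == W)%MS,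
      forall i, (i <= size Us)%N -> submodule T (U i),
      forall i, (i < size Us)%N -> (U i < U i.+1)%MS
    & forall i V, (i < size Us)%N -> submodule T V ->
        (U i <= V)%MS -> (V <= U i.+1)%MS -> (V == U i)%MS \/ (V == U i.+1)%MS].

Lemma submodule0 : submodule T 0.
Proof. by move=> i; rewrite mul0mx sub0mx. Qed.

Lemma maximal_chain_rcons V W Us : maximal_chain V Us -> submodule T W -> (V < W)%MS ->
  (forall X, submodule T X -> (V <= X)%MS -> (X <= W)%MS -> (X == V)%MS \/ (X == W)%MS) ->
  maximal_chain W (rcons Us W).
Proof.
move=> [/eqmxP lastV sub lt max] hW VW maxW.
have nthE i : (i <= size Us)%N -> nth 0 (0 :: rcons Us W) i = nth 0 (0 :: Us) i.
  by move=> hi; rewrite -rcons_cons nth_rcons /= ltnS hi.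
have nthL : nth 0 (0 :: rcons Us W) (size Us).+1 = W.
  by rewrite -rcons_cons nth_rcons /= ltnn eqxx.
have lastE : nth 0 (0 :: Us) (size Us) = last 0 Us by rewrite nth_last.
split=> [|i|i|i X]; rewrite ?last_rcons ?submx_refl // size_rcons => hi.
- move: hi; rewrite leq_eqVlt => /orP[/eqP->|hi]; first by rewrite nthL.
  by rewrite nthE //; apply: sub.
- move: hi; rewrite ltnS leq_eqVlt => /orP[/eqP->|hi]; last first.
    by rewrite !nthE ?lt // ltnW.
  by rewrite nthL nthE // lastE /ltmx !lastV.
- move: hi; rewrite ltnS leq_eqVlt => /orP[/eqP->|hi]; last first.
    by rewrite !nthE // ?(ltnW hi) //; apply: max.
  by rewrite nthL nthE // lastE !lastV; exact: maxW.
Qed.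

Lemma maximal_chain_exists W : submodule T W -> exists Us, maximal_chain W Us.
Proof.
move: {2}(\rank W) (erefl (\rank W)) => k; elim/ltn_ind: k W => k IH W rW hW.
have [W0|W0] := eqVneq W 0.
  exists [::]; rewrite W0; split=> //=; first by rewrite submx_refl.
  by move=> i _; case: i => [|i]; rewrite /= ?nth_nil; apply: submodule0.
(* A proper submodule of largest rank is a maximal one. *)
pose P j := `[< exists V, [/\ submodule T V, (V < W)%MS & \rank V = j] >].
have P0 : exists j, P j.
  exists 0%N; apply/asboolP; exists 0; rewrite mxrank0; split=> //; first exact: submodule0.
  by rewrite lt0mx.
have Pb j : P j -> (j <= k)%N.
  by move=> /asboolP[V [_ VW <-]]; rewrite -rW mxrankS // ltmxW.
have [j /asboolP[V [hV VW rV]] jmax] := ex_maxnP P0 Pb.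
have lt : (j < k)%N by rewrite -rW -rV ltmxErank in VW *; case/andP: VW.
have [Us HUs] := IH j lt V rV hV.
exists (rcons Us W); apply: (maximal_chain_rcons HUs hW VW) => X hX VX XW.
have [WX|nWX] := boolP (W <= X)%MS; first by right; rewrite XW.
left; rewrite VX andbT -(mxrank_leqif_sup VX) eqn_leq mxrankS //= rV.
by apply: jmax; apply/asboolP; exists X; rewrite /ltmx XW.
Qed.

Variables (chi : nat -> F) (Ga : 'cV[F]_d).
Hypotheses (Ga0 : Ga != 0) (TGa : forall i : 'I_n, T i *m Ga = chi i *: Ga).

(** Ga is a homomorphism onto the module with character chi. Its kernel is a submodule of
    codimension one, and a series of the kernel followed by the whole space has this character on
    top. *)
Lemma composition_series_quotient : exists2 Us, composition_series T Us &
  (0 < count (fun i => `[< subquotient_iso T (nth 0%R (0%R :: Us) i)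
                          (nth 0%R (0%R :: Us) i.+1) (fun i => (chi i)%:M%R : 'M[F]_1) >])
             (iota 0 (size Us)))%N.
Proof.
have rGa : \rank Ga = 1%N by apply/eqP; rewrite eqn_leq rank_leq_col lt0n mxrank_eq0.
have kst : submodule T (kermx Ga).
  move=> i; apply/sub_kermxP; rewrite -mulmxA TGa -scalemxAr mulmx_ker.
  by rewrite scaler0.
have [Us HUs] := maximal_chain_exists kst.
have HV : maximal_chain 1%:M (rcons Us 1%:M).
  apply: (maximal_chain_rcons HUs) => [i||X hX kX _]; first by apply: submx1.
    by rewrite ltmxErank submx1 mxrank_ker mxrank1 rGa; have := rank_leq_row Ga; lia.
  have [fX|] := boolP (row_full X); first by right; rewrite submx1 sub1mx.
  rewrite /row_full => nf; left; rewrite kX andbT -(mxrank_leqif_sup kX).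
  rewrite eqn_leq mxrankS //= mxrank_ker rGa.
  by have := rank_leq_row X; lia.
exists (rcons Us 1%:M).
  have [h1 h2 h3 h4] := HV; split=> //.
  by rewrite last_rcons /row_full mxrank1.
rewrite -has_count; apply/hasP; exists (size Us).
  by rewrite mem_iota size_rcons /= ltnS leqnn.
apply/asboolP.
have -> : nth 0 (0 :: rcons Us 1%:M) (size Us).+1 = 1%:M :> 'M[F]_d.
  by rewrite -rcons_cons nth_rcons /= ltnn eqxx.
have -> : nth 0 (0 :: rcons Us 1%:M) (size Us) = last 0 Us.
  by rewrite -rcons_cons nth_rcons /= ltnSn nth_last.
have [/eqmxP lastE _ _ _] := HUs.
exists Ga; split=> [||i]; rewrite ?mul1mx.
- by rewrite /row_full rGa.
- by rewrite !lastE capmxSr sub_capmx submx1 submx_refl.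
- by rewrite TGa mul_mx_scalar.
Qed.

End CompositionSeries.

(** * Seminormal forms *)

Section GenericContents.

Variable C : fieldType.

Notation K := (genK C).
Notation qK := (qK C).
Notation QK := (QK C).

Lemma qK_neq0 : qK != 0. Proof. exact: fracK_q_neq0. Qed.

Lemma qP_exp k : qP C ^+ k = ('X^k)%:P%:P.
Proof. by rewrite /qP -!rmorphXn. Qed.

Lemma gen_inj_nat c c' i j :
  component QK c * qK ^+ i = component QK c' * qK ^+ j -> c = c' /\ i = j.
Proof.
have E b : component QK b = fracK (if b then Q2P C else Q1P C) by case: b.
rewrite !E /fracK -!tofracXn -!tofracM => /eqP; rewrite tofrac_eq => /eqP.
have Xi (a b : nat) : qP C ^+ a = qP C ^+ b -> a = b.
  rewrite !qP_exp => /polyC_inj /polyC_inj /(congr1 (fun p : {poly C} => size p)).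
  by rewrite !size_polyXn => -[].
have szX k : qP C ^+ k != 0 by rewrite qP_exp !polyC_eq0 -size_poly_eq0 size_polyXn.
have qn k : ('X^k)%:P != 0 :> {poly {poly C}}.
  by rewrite polyC_eq0 -size_poly_eq0 size_polyXn.
have Q1n : Q1P C != 0 by rewrite polyC_eq0 polyX_eq0.
have Q2n : Q2P C != 0 by rewrite polyX_eq0.
case: c; case: c' => H.
- by split=> //; apply: Xi; apply: mulfI H.
(* One side has degree one in Q_2, the other one is constant in it. *)
- exfalso; move: H; rewrite [Q2P C * _]mulrC !qP_exp /Q1P /Q2P -polyCM.
  move=> /(congr1 (fun p : {poly _} => size p)); rewrite size_Cmul ?qn // size_polyX size_polyC.
  by case: eqP.
- exfalso; move: H; rewrite [Q2P C * _]mulrC !qP_exp /Q1P /Q2P -polyCM.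
  move=> /(congr1 (fun p : {poly _} => size p)); rewrite size_Cmul ?qn // size_polyX size_polyC.
  by case: eqP.
- by split=> //; apply: Xi; apply: mulfI H.
Qed.

Lemma gen_inj c c' (z w : int) :
  component QK c * qK ^ z = component QK c' * qK ^ w -> c = c' /\ z = w.
Proof.
move=> /(congr1 (fun x => x * qK ^ (absz z + absz w)%N%:Z)).
rewrite /= -!mulrA -!expfzDr ?qK_neq0 //.
have [i Ei] : exists i : nat, z + (absz z + absz w)%N%:Z = i%:Z.
  by exists (absz (z + (absz z + absz w)%N%:Z)); lia.
have [j Ej] : exists i : nat, w + (absz z + absz w)%N%:Z = i%:Z.
  by exists (absz (w + (absz z + absz w)%N%:Z)); lia.
rewrite Ei Ej -!exprnP => /gen_inj_nat[-> E].
by split=> //; lia.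
Qed.

End GenericContents.

(** * Jucys-Murphy words and adjacent transpositions *)

Lemma row_matrixE (R : pzSemiRingType) m d (A B : 'M[R]_(m, d)) :
  (forall r, delta_mx 0 r *m A = delta_mx (0 : 'I_1) r *m B) -> A = B.
Proof. by move=> H; apply/row_matrixP => r; rewrite !rowE. Qed.

Definition jm_word (k : nat) : seq nat := rev (iota 1 k) ++ iota 0 k.+1.

Lemma jm_wordS k : jm_word k.+1 = k.+1 :: rcons (jm_word k) k.+1.
Proof.
have E m : iota m k.+1 = rcons (iota m k) (m + k) by rewrite -addn1 iotaD cats1.
rewrite /jm_word E rev_rcons; have -> : iota 0 k.+2 = rcons (iota 0 k.+1) k.+1.
  by rewrite -[k.+2]addn1 iotaD cats1.
by rewrite -rcons_cat.
Qed.

HB.instance Definition _ (R : pzSemiRingType) d :=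
  Monoid.isLaw.Build 'M[R]_d 1%:M mulmx (@mulmxA R d d d d) (@mul1mx R d d) (@mulmx1 R d d).

Section WordProducts.

Variables (R : comNzRingType) (d : nat) (T : nat -> 'M[R]_d).

Definition wprod (l : seq nat) : 'M[R]_d := \big[mulmx/1%:M]_(j <- l) T j.

Lemma wprod_nil : wprod [::] = 1%:M. Proof. by rewrite /wprod big_nil. Qed.

Lemma wprod_cons j l : wprod (j :: l) = T j *m wprod l.
Proof. by rewrite /wprod big_cons. Qed.

Lemma wprod_cat l l' : wprod (l ++ l') = wprod l *m wprod l'.
Proof. by rewrite /wprod big_cat. Qed.

Lemma wprod1 j : wprod [:: j] = T j. Proof. by rewrite /wprod big_seq1. Qed.

Lemma wprod_rcons l j : wprod (rcons l j) = wprod l *m T j.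
Proof. by rewrite -cats1 wprod_cat wprod1. Qed.

Lemma wprod_jmS k : wprod (jm_word k.+1) = T k.+1 *m wprod (jm_word k) *m T k.+1.
Proof. by rewrite jm_wordS wprod_cons wprod_rcons mulmxA. Qed.

Lemma wprod_jm0 : wprod (jm_word 0) = T 0%N.
Proof. by rewrite /jm_word /= wprod1. Qed.

End WordProducts.

Lemma map_wprod (R S : comNzRingType) (f : {rmorphism R -> S}) d (T : nat -> 'M[R]_d) l :
  map_mx f (wprod T l) = wprod (fun k => map_mx f (T k)) l.
Proof.
elim: l => [|j l IH]; first by rewrite !wprod_nil map_mx1.
by rewrite !wprod_cons map_mxM IH.
Qed.

Lemma jucys_murphyE (F : fieldType) n d (T : nat -> 'M[F]_d) (q : F) (k : 'I_n) :
  jucys_murphy (fun i : 'I_n => T i) q k = q ^- k *: wprod T (jm_word k).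
Proof.
rewrite /jucys_murphy; congr (_ *: _).
have E P : [seq val j | j : 'I_n <- enum 'I_n & P (val j)] = [seq j <- iota 0 n | P j].
  by rewrite -val_enum_ord filter_map.
rewrite /wprod -(big_map (fun j : 'I_n => val j) xpredT T) map_cat map_rev.
rewrite (E (fun j => (0 < j <= k)%N)) (E (fun j => (j <= k)%N)); congr bigop.
have kn := ltn_ord k.
have -> : iota 0 n = iota 0 k.+1 ++ iota k.+1 (n - k.+1) by rewrite -iotaD subnKC.
have h1 : [seq j <- iota k.+1 (n - k.+1) | (j <= k)%N] = [::].
  by apply/eqP; rewrite -(negbK (_ == _)) -has_filter; apply/hasPn => j; rewrite mem_iota; lia.
have h2 : [seq j <- iota k.+1 (n - k.+1) | (0 < j <= k)%N] = [::].
  by apply/eqP; rewrite -(negbK (_ == _)) -has_filter; apply/hasPn => j; rewrite mem_iota; lia.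
rewrite !filter_cat h1 h2 !cats0 /jm_word; congr (rev _ ++ _).
  by rewrite /=; apply/all_filterP/allP => j; rewrite mem_iota; lia.
by apply/all_filterP/allP => j; rewrite mem_iota; lia.
Qed.

Definition transp (i k : nat) : nat :=
  if k == i then i.+1 else if k == i.+1 then i else k.

(** Splits first on the conditions that contain no conditional, so that nested transpositions unfold
    from the inside. *)
Ltac transp_lia :=
  rewrite /transp;
  repeat match goal with
  | |- context [if ?k == ?i then _ else _] =>
    lazymatch k with
    | context [if _ then _ else _] => fail
    | _ => case: (k =P i) => ?
    end
  end; lia.

Lemma transpK i k : transp i (transp i k) = k.
Proof. by transp_lia. Qed.

Lemma transp_lt n i k : (i.+1 < n)%N -> (k < n)%N -> (transp i k < n)%N.
Proof. by transp_lia. Qed.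

Lemma transp_l i : transp i i = i.+1.
Proof. by rewrite /transp eqxx. Qed.

Lemma transp_r i : transp i i.+1 = i.
Proof. by rewrite /transp eqxx gtn_eqF. Qed.

Lemma transp_o i k : k != i -> k != i.+1 -> transp i k = k.
Proof. by rewrite /transp => /negbTE-> /negbTE->. Qed.

Lemma transp_braid i k :
  transp i (transp i.+1 (transp i k)) = transp i.+1 (transp i (transp i.+1 k)).
Proof.
have [->|n1] := eqVneq k i.
  by rewrite transp_l transp_l transp_o ?(@transp_o i.+1 i) ?transp_l ?transp_l //; lia.
have [->|n2] := eqVneq k i.+1.
  rewrite transp_r transp_l (@transp_o i.+1 i) ?(@transp_o i i.+2) ?transp_l ?transp_r //; lia.
have [->|n3] := eqVneq k i.+2.
  by rewrite (@transp_o i i.+2) ?transp_r ?transp_r ?(@transp_o i.+1 i) //; lia.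
by rewrite !transp_o.
Qed.

Lemma transp_comm i j k : (i.+1 < j)%N ->
  transp i (transp j k) = transp j (transp i k).
Proof. by move=> ij; transp_lia. Qed.

(** * The seminormal form satisfies the relations *)

Section Seminormal.

Variables (F : fieldType) (q : F) (n d : nat).
Variables (x : 'I_d -> nat -> F) (sw : nat -> 'I_d -> 'I_d).

Definition adm (a b : F) : bool := (b != q * a) && (a != q * b).

Definition acoef (a b : F) : F := (q - 1) * b / (b - a).

(** The formula vanishes by itself for a = q b. The guard also covers b = q a, where the swapped
    tableau does not exist; this is consistent because the quadratic relation only constrains the
    product of the two off-diagonal coefficients. *)
Definition bcoef (a b : F) : F := if adm a b then (q * b - a) / (b - a) else 0.

Hypothesis q0 : q != 0.
Hypothesis xne : forall r k, (k.+1 < n)%N -> x r k != x r k.+1.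
Hypothesis xne2 : forall r k, (k.+2 < n)%N -> x r k != x r k.+2.
Hypothesis swx : forall r i k, (i.+1 < n)%N -> (k < n)%N ->
  adm (x r i) (x r i.+1) -> x (sw i r) k = x r (transp i k).
Hypothesis xinj : forall r r', (forall k, (k < n)%N -> x r k = x r' k) -> r = r'.

Lemma swx_l r i : (i.+1 < n)%N -> adm (x r i) (x r i.+1) -> x (sw i r) i = x r i.+1.
Proof. by move=> hi ad; rewrite swx ?(ltnW hi) // /transp eqxx. Qed.

Lemma swx_r r i : (i.+1 < n)%N -> adm (x r i) (x r i.+1) -> x (sw i r) i.+1 = x r i.
Proof. by move=> hi ad; rewrite swx // /transp eqxx ifN // gtn_eqF. Qed.

Lemma swx_o r i k : (i.+1 < n)%N -> adm (x r i) (x r i.+1) -> (k < n)%N ->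
  k != i -> k != i.+1 -> x (sw i r) k = x r k.
Proof. by move=> hi ad kn ki ki1; rewrite swx // /transp (negbTE ki) (negbTE ki1). Qed.

Lemma admC a b : adm a b = adm b a.
Proof. by rewrite /adm andbC. Qed.

(** If the pair is not admissible, one of the two numerators on the right vanishes; so the product
    is one rational function in all cases. *)
Lemma bcoefM a b : a != b ->
  bcoef a b * bcoef b a = (q * b - a) / (b - a) * ((q * a - b) / (a - b)).
Proof.
move=> ab; rewrite /bcoef -(admC a b); case: ifP => // /negbT.
rewrite negb_and !negbK => /orP[/eqP->|/eqP->].
  by rewrite subrr !mul0r mulr0.
by rewrite subrr !mul0r.
Qed.

Lemma bcoef_neq0 a b : adm a b -> a != b -> bcoef a b != 0.
Proof.
move=> ad ab; rewrite /bcoef ad mulf_neq0 ?invr_eq0 ?subr_eq0 //.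
  by move: ad; rewrite eq_sym => /andP[].
by rewrite eq_sym.
Qed.

Definition sn (k : nat) : 'M[F]_d :=
  if k is i.+1 then
    \matrix_(r, r') (acoef (x r i) (x r i.+1) * (r' == r)%:R +
                     bcoef (x r i) (x r i.+1) * (r' == sw i r)%:R)
  else \matrix_(r, r') (x r 0%N * (r' == r)%:R).

Let E r : 'rV[F]_d := delta_mx 0 r.

Lemma sn0E r : E r *m sn 0 = x r 0%N *: E r.
Proof. by rewrite -rowE; apply/rowP => j; rewrite !mxE eqxx. Qed.

Lemma snE r i : E r *m sn i.+1 =
  acoef (x r i) (x r i.+1) *: E r + bcoef (x r i) (x r i.+1) *: E (sw i r).
Proof. by rewrite -rowE; apply/rowP => j; rewrite !mxE !eqxx. Qed.

Lemma swK r i : (i.+1 < n)%N -> adm (x r i) (x r i.+1) -> sw i (sw i r) = r.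
Proof.
move=> hi ad; apply: xinj => k kn.
have ad' : adm (x (sw i r) i) (x (sw i r) i.+1).
  by rewrite swx_l // swx_r // admC.
rewrite swx // swx ?transp_lt //.
by rewrite transpK.
Qed.

(** The contents of a swapped tableau are known only if the swap is admissible, which a nonzero
    coefficient c ensures; carrying c along makes the formula unconditional. *)
Lemma guarded_step (c a b : F) r i :
  (c != 0 -> x r i = a /\ x r i.+1 = b) ->
  c *: (E r *m sn i.+1) = c *: (acoef a b *: E r + bcoef a b *: E (sw i r)).
Proof.
have [->|c0 /(_ isT)[h1 h2]] := eqVneq c 0; first by rewrite !scale0r.
by rewrite snE h1 h2.
Qed.

Lemma sn_quadratic i : (i.+1 < n)%N -> (sn i.+1 - q%:M) *m (sn i.+1 + 1%:M) = 0.
Proof.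
move=> hi; apply: row_matrixE => r; rewrite mulmx0.
rewrite mulmxA mulmxBr mulmxBl !mulmxDr !mulmx1 !mul_mx_scalar -/(E r).
rewrite snE; set a := x r i; set b := x r i.+1.
have ab : a != b by apply: xne.
have ba0 : b - a != 0 by rewrite subr_eq0 eq_sym.
have ab0 : a - b != 0 by rewrite subr_eq0.
rewrite mulmxDl -!scalemxAl snE -/a -/b.
rewrite (@guarded_step _ b a); last first.
  rewrite /bcoef; case: ifP => [ad _|]; last by rewrite eqxx.
  by rewrite swx_l // swx_r.
have swr : bcoef a b *: (acoef b a *: E (sw i r) + bcoef b a *: E (sw i (sw i r))) =
   (bcoef a b * acoef b a) *: E (sw i r) + (bcoef a b * bcoef b a) *: E r.
  rewrite scalerDr !scalerA /bcoef; case: (boolP (adm a b)) => ad; last by rewrite !mul0r !scale0r.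
  by rewrite swK.
rewrite swr bcoefM //; apply/rowP => j; rewrite !mxE; rewrite /acoef.
set u := _%:R; set w := _%:R; move: (bcoef a b) => B.
by field; rewrite ba0 ab0.
Qed.

Lemma sn_comm i j : (i.+1 < n)%N -> (j.+1 < n)%N -> (i.+1 < j)%N ->
  sn i.+1 *m sn j.+1 = sn j.+1 *m sn i.+1.
Proof.
move=> hi hj ij; apply: row_matrixE => r; rewrite !mulmxA -/(E r) !(snE r).
set a := x r i; set b := x r i.+1; set a' := x r j; set b' := x r j.+1.
rewrite !mulmxDl -!scalemxAl !(snE r) -/a -/b -/a' -/b'.
rewrite (@guarded_step (bcoef a b) a' b'); last first.
  rewrite /bcoef; case: ifP => [ad _|]; last by rewrite eqxx.
  by rewrite !swx_o //; lia.
rewrite (@guarded_step (bcoef a' b') a b); last first.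
  rewrite /bcoef; case: ifP => [ad _|]; last by rewrite eqxx.
  by rewrite !swx_o //; lia.
have sws : (bcoef a b * bcoef a' b') *: E (sw j (sw i r)) =
           (bcoef a b * bcoef a' b') *: E (sw i (sw j r)).
  rewrite /bcoef; case: ifP => [ad|]; last by rewrite mul0r !scale0r.
  case: ifP => [ad'|]; last by rewrite mulr0 !scale0r.
  congr (_ *: E _); apply: xinj => k kn.
  have h1 : adm (x (sw i r) j) (x (sw i r) j.+1).
    by rewrite !swx_o //; lia.
  have h2 : adm (x (sw j r) i) (x (sw j r) i.+1).
    by rewrite !swx_o //; lia.
  rewrite swx // swx ?transp_lt // swx // swx ?transp_lt //.
  by rewrite transp_comm.
rewrite !scalerDr !scalerA sws; move: sws => _.
apply/rowP => k; rewrite !mxE; ring.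
Qed.

Lemma sn_comm0 j : (j.+2 < n)%N -> sn 0 *m sn j.+2 = sn j.+2 *m sn 0.
Proof.
move=> hj; apply: row_matrixE => r; rewrite !mulmxA -/(E r) sn0E (snE r).
rewrite mulmxDl -!scalemxAl !sn0E (snE r).
set c := bcoef _ _.
have -> : c *: (x (sw j.+1 r) 0%N *: E (sw j.+1 r)) = c *: (x r 0%N *: E (sw j.+1 r)).
  rewrite /c /bcoef; case: ifP => ad; last by rewrite !scale0r.
  by rewrite swx //; lia.
by apply/rowP => k; rewrite !mxE; ring.
Qed.

(** Both sides live on the tableaux obtained by permuting three consecutive entries, at most six,
    the two longest products of swaps giving the same one by [xinj]. Once the guards are absorbed,
    the coefficients agree as rational functions of the contents a, b, c. *)
Lemma sn_braid i : (i.+2 < n)%N ->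
  sn i.+1 *m sn i.+2 *m sn i.+1 = sn i.+2 *m sn i.+1 *m sn i.+2.
Proof.
move=> hi; have hi1 : (i.+1 < n)%N by lia.
apply: row_matrixE => r; rewrite !mulmxA -/(E r) !(snE r).
set a := x r i; set b := x r i.+1; set c := x r i.+2.
have ab : a != b by apply: xne.
have bc : b != c by apply: xne.
have ac : a != c by apply: xne2.
have S1 : adm a b -> [/\ x (sw i r) i = b, x (sw i r) i.+1 = a & x (sw i r) i.+2 = c].
  by move=> ad; rewrite swx_l // swx_r // swx_o //; lia.
have S2 : adm b c ->
    [/\ x (sw i.+1 r) i = a, x (sw i.+1 r) i.+1 = c & x (sw i.+1 r) i.+2 = b].
  by move=> ad; rewrite swx_l // swx_r // swx_o //; lia.
have S12 : adm a b -> adm a c -> [/\ x (sw i.+1 (sw i r)) i = b,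
    x (sw i.+1 (sw i r)) i.+1 = c & x (sw i.+1 (sw i r)) i.+2 = a].
  move=> ad ad'; have [h1 h2 h3] := S1 ad.
  have ad2 : adm (x (sw i r) i.+1) (x (sw i r) i.+2) by rewrite h2 h3.
  by rewrite swx_l // h3 swx_r // h2 swx_o // ?h1 //; lia.
have S21 : adm b c -> adm a c -> [/\ x (sw i (sw i.+1 r)) i = c,
    x (sw i (sw i.+1 r)) i.+1 = a & x (sw i (sw i.+1 r)) i.+2 = b].
  move=> ad ad'; have [h1 h2 h3] := S2 ad.
  have ad2 : adm (x (sw i.+1 r) i) (x (sw i.+1 r) i.+1) by rewrite h1 h2.
  by rewrite swx_l // h2 swx_r // h1 swx_o // ?h3 //; lia.
have S121 : adm a b -> adm a c -> adm b c ->
    sw i (sw i.+1 (sw i r)) = sw i.+1 (sw i (sw i.+1 r)).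
  move=> h1 h2 h3; have [p1 p2 p3] := S12 h1 h2; have [p4 p5 p6] := S21 h3 h2.
  have [p7 p8 p9] := S1 h1; have [p10 p11 p12] := S2 h3.
  apply: xinj => k kn.
  rewrite swx ?p1 ?p2 // swx ?transp_lt ?p8 ?p9 // swx ?transp_lt //.
  rewrite swx ?p5 ?p6 // swx ?transp_lt ?p10 ?p11 // swx ?transp_lt //.
  by rewrite transp_braid.
have L12 : (acoef a b *: E r + bcoef a b *: E (sw i r)) *m sn i.+2 =
    acoef a b *: (acoef b c *: E r + bcoef b c *: E (sw i.+1 r)) +
    bcoef a b *: (acoef a c *: E (sw i r) + bcoef a c *: E (sw i.+1 (sw i r))).
  rewrite mulmxDl -!scalemxAl (snE r) -/b -/c (@guarded_step (bcoef a b) a c) //.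
  by rewrite /bcoef; case: ifP => [/S1[]|]; last by rewrite eqxx.
have L21 : (acoef b c *: E r + bcoef b c *: E (sw i.+1 r)) *m sn i.+1 =
    acoef b c *: (acoef a b *: E r + bcoef a b *: E (sw i r)) +
    bcoef b c *: (acoef a c *: E (sw i.+1 r) + bcoef a c *: E (sw i (sw i.+1 r))).
  rewrite mulmxDl -!scalemxAl (snE r) -/a -/b (@guarded_step (bcoef b c) a c) //.
  by rewrite /bcoef; case: ifP => [/S2[]|]; last by rewrite eqxx.
rewrite L12 L21 !scalerDr !scalerA !mulmxDl -!scalemxAl !(snE r) -/a -/b -/c.
rewrite (@guarded_step (acoef a b * bcoef b c) a c); last first.
  by rewrite /bcoef; case: ifP => [/S2[]|]; last by rewrite mulr0 eqxx.
rewrite (@guarded_step (bcoef a b * acoef a c) b a); last first.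
  by rewrite /bcoef; case: ifP => [/S1[]|]; last by rewrite mul0r eqxx.
rewrite (@guarded_step (bcoef a b * bcoef a c) b c); last first.
  rewrite /bcoef; case: ifP => [ad|]; last by rewrite mul0r eqxx.
  by case: ifP => [/(S12 ad)[]|]; last by rewrite mulr0 eqxx.
rewrite (@guarded_step (acoef b c * bcoef a b) a c); last first.
  by rewrite /bcoef; case: ifP => [/S1[]|]; last by rewrite mulr0 eqxx.
rewrite (@guarded_step (bcoef b c * acoef a c) c b); last first.
  by rewrite /bcoef; case: ifP => [/S2[]|]; last by rewrite mul0r eqxx.
rewrite (@guarded_step (bcoef b c * bcoef a c) a b); last first.
  rewrite /bcoef; case: ifP => [ad|]; last by rewrite mul0r eqxx.
  by case: ifP => [/(S21 ad)[]|]; last by rewrite mulr0 eqxx.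
rewrite !scalerDr !scalerA.
clear L12 L21; have G1 u : (u * bcoef a b * bcoef b a) *: E (sw i (sw i r)) = (u * (bcoef a b * bcoef b a)) *: E r.
  by rewrite -mulrA /bcoef; case: (boolP (adm a b)) => ad; rewrite ?mul0r ?mulr0 ?scale0r // swK.
have G2 u : (u * bcoef b c * bcoef c b) *: E (sw i.+1 (sw i.+1 r)) = (u * (bcoef b c * bcoef c b)) *: E r.
  by rewrite -mulrA /bcoef; case: (boolP (adm b c)) => ad; rewrite ?mul0r ?mulr0 ?scale0r // swK.
have G3 : (bcoef a b * bcoef a c * bcoef b c) *: E (sw i (sw i.+1 (sw i r))) =
   (bcoef a b * bcoef a c * bcoef b c) *: E (sw i.+1 (sw i (sw i.+1 r))).
  rewrite /bcoef; case: (boolP (adm a b)) => h1; last by rewrite !mul0r !scale0r.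
  case: (boolP (adm a c)) => h2; last by rewrite mulr0 mul0r !scale0r.
  case: (boolP (adm b c)) => h3; last by rewrite mulr0 !scale0r.
  by rewrite S121.
rewrite (_ : bcoef a b * acoef a c * bcoef b a = acoef a c * bcoef a b * bcoef b a); last by ring.
rewrite (_ : bcoef b c * acoef a c * bcoef c b = acoef a c * bcoef b c * bcoef c b); last by ring.
rewrite G1 G2 G3 !bcoefM //.
have ba0 : b - a != 0 by rewrite subr_eq0 eq_sym.
have ab0 : a - b != 0 by rewrite subr_eq0.
have bc0 : b - c != 0 by rewrite subr_eq0.
have cb0 : c - b != 0 by rewrite subr_eq0 eq_sym.
have ca0 : c - a != 0 by rewrite subr_eq0 eq_sym.
clear G1 G2 G3 S1 S2 S12 S21 S121.
apply/rowP => j; rewrite !mxE /acoef.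
move: (bcoef a b) (bcoef a c) (bcoef b c) => B1 B2 B3.
move: (_%:R) (_%:R) (_%:R) (_%:R) (_%:R) (_%:R) => u1 u2 u3 u4 u5 u6.
by field; rewrite ba0 ab0 bc0 cb0 ca0.
Qed.

(** T_1 T_0 T_1 = q L_2 is diagonal in the seminormal basis, which is the fact [key], and so
    commutes with the diagonal T_0. *)
Lemma sn_quartic : (1 < n)%N ->
  sn 0 *m sn 1 *m sn 0 *m sn 1 = sn 1 *m sn 0 *m sn 1 *m sn 0.
Proof.
move=> hi; apply: row_matrixE => r; rewrite !mulmxA -/(E r) sn0E (snE r).
set a := x r 0%N; set b := x r 1%N.
have ab : a != b by apply: xne.
have S1 : adm a b -> x (sw 0 r) 0%N = b /\ x (sw 0 r) 1%N = a.
  by move=> ad; rewrite swx_l // swx_r.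
have S0 : bcoef a b *: (E (sw 0 r) *m sn 0) = bcoef a b *: (b *: E (sw 0 r)).
  by rewrite sn0E /bcoef; case: ifP => [/S1[-> _]|]; rewrite // !scale0r.
have G : (bcoef a b * bcoef b a) *: E (sw 0 (sw 0 r)) = (bcoef a b * bcoef b a) *: E r.
  by rewrite /bcoef; case: (boolP (adm a b)) => ad; rewrite ?mul0r ?scale0r // swK.
have GS : bcoef a b *: (E (sw 0 r) *m sn 1) =
    bcoef a b *: (acoef b a *: E (sw 0 r) + bcoef b a *: E (sw 0 (sw 0 r))).
  by apply: guarded_step; rewrite /bcoef; case: ifP => [/S1[]|]; last by rewrite eqxx.
have key : (acoef a b *: E r + bcoef a b *: E (sw 0 r)) *m sn 0 *m sn 1 =
   (acoef a b * acoef a b * a + bcoef a b * bcoef b a * b) *: E r.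
  rewrite mulmxDl -!scalemxAl sn0E S0 mulmxDl -!scalemxAl (snE r) -/a -/b.
  have -> : bcoef a b *: (b *: (E (sw 0 r) *m sn 1)) = b *: (bcoef a b *: (E (sw 0 r) *m sn 1)).
    by rewrite !scalerA mulrC.
  rewrite GS !scalerDr !scalerA -[b * bcoef a b * bcoef b a]mulrA -[(b * _) *: _]scalerA G.
  rewrite !scalerA addrAC !addrA.
  have ba0 : b - a != 0 by rewrite subr_eq0 eq_sym.
  have ab0 : a - b != 0 by rewrite subr_eq0.
  apply/rowP => j; rewrite !mxE /acoef.
  move: (bcoef a b) (bcoef b a) => B1 B2.
  move: (_%:R) (_%:R) => u1 u2.
  by field; rewrite ba0 ab0.
rewrite -!scalemxAl (snE r) -/a -/b key -!scalemxAl sn0E -/a.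
by rewrite !scalerA mulrC.
Qed.

(** Induction by wrapping T around the previous word: the two contributions to the swapped vector
    cancel, and those to r add up to the next eigenvalue. *)
Lemma sn_jm r k : (k < n)%N -> E r *m wprod sn (jm_word k) = (q ^+ k * x r k) *: E r.
Proof.
elim: k r => [|k IH] r kn; first by rewrite wprod_jm0 sn0E mul1r.
rewrite wprod_jmS !mulmxA (snE r); set a := x r k; set b := x r k.+1.
have ab : a != b by apply: xne.
rewrite mulmxDl -!scalemxAl !IH ?(ltnW kn) // mulmxDl -!scalemxAl (snE r) -/a -/b.
have S1 : adm a b -> x (sw k r) k = b /\ x (sw k r) k.+1 = a.
  by move=> ad; rewrite swx_l // swx_r.
have G : (bcoef a b * bcoef b a) *: E (sw k (sw k r)) = (bcoef a b * bcoef b a) *: E r.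
  by rewrite /bcoef; case: (boolP (adm a b)) => ad; rewrite ?mul0r ?scale0r // swK.
have -> : bcoef a b *: ((q ^+ k * x (sw k r) k) *: (E (sw k r) *m sn k.+1)) =
   (q ^+ k * b) *: (bcoef a b *: (E (sw k r) *m sn k.+1)).
  rewrite /bcoef; case: ifP => [/S1[-> _]|]; last by rewrite !scale0r scaler0.
  by rewrite !scalerA mulrC.
rewrite (@guarded_step (bcoef a b) b a); last first.
  by rewrite /bcoef; case: ifP => [/S1[]|]; last by rewrite eqxx.
rewrite !scalerDr !scalerA -[_ * bcoef a b * bcoef b a]mulrA -[(_ * (bcoef a b * _)) *: _]scalerA G.
rewrite scalerA bcoefM //.
have ba0 : b - a != 0 by rewrite subr_eq0 eq_sym.
have ab0 : a - b != 0 by rewrite subr_eq0.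
apply/rowP => j; rewrite !mxE /acoef exprS; move: (q ^+ k) => qk.
move: (bcoef a b) => B1.
move: (_%:R) (_%:R) => u1 u2.
by field; rewrite ba0 ab0.
Qed.

Variables Q : F * F.
Hypothesis xQ : forall r, (0 < n)%N -> x r 0%N = Q.1 \/ x r 0%N = Q.2.

Lemma sn_hecke : hecke_module q Q (fun i : 'I_n => sn i).
Proof.
split.
- move=> i ->; apply: row_matrixE => r.
  have n0 : (0 < n)%N by apply: leq_ltn_trans (ltn_ord i).
  rewrite mulmx0 mulmxA -/(E r) [E r *m _]mulmxBr sn0E mul_mx_scalar -scalerBl.
  rewrite -scalemxAl mulmxBr -/(E r) sn0E mul_mx_scalar -scalerBl scalerA.
  by case: (xQ r n0) => ->; rewrite subrr ?mul0r ?mulr0 scale0r.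
- by case=> -[|i] hi //= _; apply: sn_quadratic.
- by move=> i j -> E1; rewrite E1; apply: sn_quartic; rewrite -E1.
- by case=> -[|i] hi //= j _ E1; rewrite E1; apply: sn_braid; rewrite -E1.
- case=> -[|i] hi; case=> -[|[|j]] hj //= ij; first exact: sn_comm0.
  by apply: sn_comm => //; lia.
Qed.

End Seminormal.

(** * Enumeration and connectivity of standard tableaux *)

Section TableauEnumeration.

Local Open Scope nat_scope.

(** [adm] for the contents of two nodes, written without subtraction; [xK_adm] is the translation.
    For consecutive entries it permits the swap. *)
Definition node_adm (x y : node) : bool :=
  ~~ ((x.2 == y.2) && ((y.1.2 + x.1.1 == (x.1.2 + y.1.1).+1) ||
                       (x.1.2 + y.1.1 == (y.1.2 + x.1.1).+1))).

Lemma std_swap n la f i : std n la f -> i.+1 < n -> node_adm (f i) (f i.+1) ->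
  std n la (fun k => f (transp i k)).
Proof.
case=> inj D hrow hcol hi ad; have tl := transp_lt hi.
split.
- by move=> k k' kn k'n /(inj _ _ (tl _ kn) (tl _ k'n)) /(congr1 (transp i)); rewrite !transpK.
- move=> x; split=> [/D[k kn <-]|[k kn <-]]; last by apply/D; exists (transp i k); rewrite ?tl.
  by exists (transp i k); rewrite ?transpK ?tl.
- move=> k k' a b c kn k'n fk fk'; have := hrow _ _ _ _ _ (tl _ kn) (tl _ k'n) fk fk'.
  have : ~ (transp i k = i /\ transp i k' = i.+1).
    by case=> E E'; move: ad; rewrite -{1}E -E' fk fk' /node_adm /= eqxx; lia.
  by transp_lia.
- move=> k k' a b c kn k'n fk fk'; have := hcol _ _ _ _ _ (tl _ kn) (tl _ k'n) fk fk'.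
  have : ~ (transp i k = i /\ transp i k' = i.+1).
    by case=> E E'; move: ad; rewrite -{1}E -E' fk fk' /node_adm /= eqxx; lia.
  by transp_lia.
Qed.

Lemma std_ext n la f f' : (forall k, k < n -> f k = f' k) -> std n la f -> std n la f'.
Proof.
move=> E [inj D hrow hcol]; split.
- by move=> k k' kn k'n; rewrite -!E //; apply: inj.
- move=> x; split=> [/D[k kn <-]|[k kn <-]]; first by exists k; rewrite ?E.
  by apply/D; exists k; rewrite ?E.
- by move=> k k' a b c kn k'n; rewrite -!E //; apply: hrow.
- by move=> k k' a b c kn k'n; rewrite -!E //; apply: hcol.
Qed.

Definition nd n (u : {ffun 'I_n -> node}) (k : nat) : node :=
  if insub k is Some i then u i else (0, 0, false).

Lemma ndE n (u : {ffun 'I_n -> node}) (i : 'I_n) : nd u i = u i.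
Proof. by rewrite /nd valK. Qed.

Lemma ndE' n (u : {ffun 'I_n -> node}) k (kn : k < n) : nd u k = u (Ordinal kn).
Proof. by rewrite -ndE. Qed.

Lemma standardE n la (u : {ffun 'I_n -> node}) : standard la u <-> std n la (nd u).
Proof.
split=> [[inj D hrow hcol]|[inj D hrow hcol]]; split.
- by move=> k k' kn k'n; rewrite (ndE' _ kn) (ndE' _ k'n) => /inj /(congr1 val).
- move=> x; rewrite D; split=> [[k <-]|[k kn <-]]; first by exists k; rewrite ?ndE.
  by exists (Ordinal kn); rewrite ndE'.
- by move=> k k' a b c kn k'n; rewrite (ndE' _ kn) (ndE' _ k'n); apply: hrow.
- by move=> k k' a b c kn k'n; rewrite (ndE' _ kn) (ndE' _ k'n); apply: hcol.
- by move=> k k' E; apply: val_inj; apply: inj; rewrite ?ndE ?ltn_ord.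
- move=> x; rewrite D; split=> [[k kn <-]|[k <-]]; last by exists k; rewrite ?ndE.
  by exists (Ordinal kn); rewrite ndE'.
- by move=> k k' a b c h h'; apply: (hrow _ _ a b c); rewrite ?ndE ?ltn_ord.
- by move=> k k' a b c h h'; apply: (hcol _ _ a b c); rewrite ?ndE ?ltn_ord.
Qed.

Definition tableaux n la d (tab : 'I_d -> nat -> node) : Prop :=
  [/\ forall r, std n la (tab r),
      forall r r', (forall k, k < n -> tab r k = tab r' k) -> r = r'
    & forall f, std n la f -> exists r, forall k, k < n -> tab r k = f k].

Lemma tableaux_exist n la : is_part la.1 -> is_part la.2 ->
  exists d (tab : 'I_d -> nat -> node), tableaux n la tab.
Proof.
move=> la1 la2.
(* Rows and columns of a tableau of size n have indices below n, so finitely many codes suffice. *)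
pose dec (g : {ffun 'I_n -> 'I_n * 'I_n * bool}) (k : nat) : node :=
  if insub k is Some i then (val (g i).1.1, val (g i).1.2, (g i).2) else (0, 0, false).
have decE g (i : 'I_n) : dec g i = (val (g i).1.1, val (g i).1.2, (g i).2).
  by rewrite /dec valK.
pose A := [set g | `[< std n la (dec g) >]].
exists #|A|, (fun r => dec (enum_val r)); split.
- by move=> r; have := enum_valP r; rewrite inE => /asboolP.
- move=> r r' E; apply: enum_val_inj; apply/ffunP => i.
  have := E i (ltn_ord i); rewrite !decE.
  move: (enum_val r i) (enum_val r' i) => [[a b] c] [[a' b'] c'] /= [E1 E2 ->].
  by rewrite (val_inj E1) (val_inj E2).
- move=> f Hf.
  have bd k : k < n -> (f k).1.1 < n /\ (f k).1.2 < n.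
    move=> kn; case fk: (f k) => [[a b] c].
    by have := std_bound0 la1 la2 Hf kn fk => /=; lia.
  pose g : {ffun 'I_n -> 'I_n * 'I_n * bool} := [ffun i : 'I_n =>
    (Ordinal (bd i (ltn_ord i)).1, Ordinal (bd i (ltn_ord i)).2, (f i).2)].
  have E k : k < n -> dec g k = f k.
    move=> kn; rewrite (decE g (Ordinal kn)) ffunE /=.
    by case: (f k) => [[]].
  have gA : g \in A by rewrite inE; apply/asboolP; apply: std_ext Hf => k /E.
  by exists (enum_rank_in gA g) => k kn; rewrite enum_rankK_in ?E.
Qed.

Section Connectivity.

Variables (n : nat) (la : bipart) (d : nat) (tab : 'I_d -> nat -> node).
Hypotheses (la1 : is_part la.1) (la2 : is_part la.2).
Hypothesis Htab : tableaux n la tab.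

Lemma tab_std r : std n la (tab r). Proof. by case: Htab. Qed.

Lemma tab_inj r r' : (forall k, k < n -> tab r k = tab r' k) -> r = r'.
Proof. by case: Htab => _ h _; apply: h. Qed.

Lemma tab_surj f : std n la f -> exists r, forall k, k < n -> tab r k = f k.
Proof. by case: Htab => _ _ h; apply: h. Qed.

(** The default is reached only when the swapped filling is not standard, and there the coefficient
    [bcoef] of the swapped vector is zero. *)
Definition tab_swap (i : nat) (r : 'I_d) : 'I_d :=
  odflt r [pick r' | [forall k : 'I_n, tab r' k == tab r (transp i k)]].

Lemma tab_swapE i r k : i.+1 < n -> node_adm (tab r i) (tab r i.+1) -> k < n ->
  tab (tab_swap i r) k = tab r (transp i k).
Proof.
move=> hi ad kn; rewrite /tab_swap; case: pickP => [r' /forallP H|H] /=.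
  exact/eqP/(H (Ordinal kn)).
have [r' Hr'] := tab_surj (std_swap (tab_std r) hi ad).
by move: (H r') => /forallP; case=> k'; apply/eqP/Hr'.
Qed.

Lemma tab_swapK i r : i.+1 < n -> node_adm (tab r i) (tab r i.+1) ->
  tab_swap i (tab_swap i r) = r.
Proof.
move=> hi ad; apply: tab_inj => k kn.
have ad' : node_adm (tab (tab_swap i r) i) (tab (tab_swap i r) i.+1).
  rewrite !tab_swapE // ?(ltnW hi) // /transp eqxx.
  have -> : (i.+1 == i) = false by lia.
  by rewrite eqxx; move: ad; rewrite /node_adm; rewrite eq_sym orbC.
by rewrite (tab_swapE hi ad' kn) (tab_swapE hi ad (transp_lt hi kn)) transpK.
Qed.

(** Increasing in the reading order of nodes: first component first, row by row. On the nodes of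
    tableaux of size n it is injective. *)
Let code (x : node) : nat := (if x.2 then n * n else 0) + x.1.1 * n + x.1.2.

Lemma node_bound r k : k < n -> (tab r k).1.1 + (tab r k).1.2 <= k.
Proof.
move=> kn; case E: (tab r k) => [[a b] c].
by have := std_bound0 la1 la2 (tab_std r) kn E.
Qed.

Lemma code_inj r k r' k' : k < n -> k' < n -> code (tab r k) = code (tab r' k') ->
  tab r k = tab r' k'.
Proof.
move=> kn k'n; have := node_bound r kn; have := node_bound r' k'n.
move: (tab r k) (tab r' k') => [[a b] c] [[a' b'] c'] /=; rewrite /code /= => h h' E.
have [ac bc a'c b'c] : [/\ a < n, b < n, a' < n & b' < n] by split; lia.
have Ec : c = c' by move: E; case: (c); case: (c') => // E; exfalso; nia.
subst c'; have E' : a * n + b = a' * n + b' by lia.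
have Ea : a = a'.
  by case: (ltngtP a a') => // lt; clear - E' bc b'c lt; nia.
by subst a'; congr (_, _, _); lia.
Qed.

Let phi (r : 'I_d) : nat := \sum_(k <- iota 0 n) k * code (tab r k).

Lemma phi_swap i r : i.+1 < n -> node_adm (tab r i) (tab r i.+1) ->
  phi (tab_swap i r) + code (tab r i.+1) = phi r + code (tab r i).
Proof.
move=> hi ad; rewrite /phi.
have -> : iota 0 n = iota 0 i ++ (i :: i.+1 :: iota i.+2 (n - i.+2)).
  have -> : n = i + (2 + (n - i.+2)) by lia.
  by rewrite iotaD /= add0n; do 4 f_equal; lia.
rewrite !big_cat !big_cons /= !tab_swapE // ?(ltnW hi) //.
have -> : transp i i = i.+1 by rewrite /transp eqxx.
have -> : transp i i.+1 = i by transp_lia.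
rewrite (@eq_big_seq _ _ _ _ (iota 0 i) _ (fun k => k * code (tab r k))); last first.
  move=> k; rewrite mem_iota => hk; rewrite tab_swapE //; last lia.
  by have -> : transp i k = k by transp_lia.
rewrite (@eq_big_seq _ _ _ _ (iota i.+2 _) _ (fun k => k * code (tab r k))); last first.
  move=> k; rewrite mem_iota => hk; rewrite tab_swapE //; last lia.
  by have -> : transp i k = k by transp_lia.
move: (code (tab r i)) (code (tab r i.+1)) (\sum_(j <- _) _) (\sum_(j <- _) _).
by move=> c1 c2 s1 s2; rewrite !mulSn; lia.
Qed.

(** When consecutive entries cannot be swapped, the later node lies to the south-east, hence after
    the other in reading order; so a tableau maximal for [phi] has no descents. *)
Lemma code_lt_nonadm i r : i.+1 < n -> ~~ node_adm (tab r i) (tab r i.+1) ->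
  code (tab r i) < code (tab r i.+1).
Proof.
move=> hi; rewrite /node_adm negbK => /andP[/eqP Ec E].
have b1 := node_bound r (ltnW hi); have b2 := node_bound r hi.
case E1: (tab r i) Ec E b1 => [[a b] c]; case E2: (tab r i.+1) b2 => [[a' b'] c'] /= b2 Ec E b1.
subst c'.
have := std_adjacent la1 la2 (tab_std r) hi E1 E2.
rewrite [a' + b]addnC [a + b']addnC orbC => H.
have /andP[h1 h2] : (a <= a') && (b <= b') by apply: H; lia.
rewrite /code /=; have n0 : 0 < n by lia.
case: (eqVneq a a') => [aa|ne]; first by subst a'; lia.
have : a.+1 * n <= a' * n by rewrite leq_mul2r; lia.
by rewrite mulSn; lia.
Qed.

(** Past the first b entries the codes form increasing lists with the same underlying set, that of
    the nodes left free by the common beginning. *)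
Lemma sorted_codes_eq b r r' : (forall k, k < b -> k < n -> tab r k = tab r' k) ->
  (forall i, b <= i -> i.+1 < n -> code (tab r i) < code (tab r i.+1)) ->
  (forall i, b <= i -> i.+1 < n -> code (tab r' i) < code (tab r' i.+1)) -> r = r'.
Proof.
move=> Eb H H'.
have so s : (forall i, b <= i -> i.+1 < n -> code (tab s i) < code (tab s i.+1)) ->
    sorted ltn [seq code (tab s k) | k <- iota b (n - b)].
  move=> Hs; apply/(sortedP 0) => i; rewrite size_map size_iota => hi.
  by rewrite !(nth_map 0) ?size_iota ?(ltnW hi) // !nth_iota ?(ltnW hi) // addnS; apply: Hs; lia.
have sub s s' : (forall k, k < b -> k < n -> tab s k = tab s' k) ->
    {subset [seq code (tab s k) | k <- iota b (n - b)] <=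
            [seq code (tab s' k) | k <- iota b (n - b)]}.
  move=> Es y /mapP[k]; rewrite mem_iota => hk ->.
  have kn : k < n by lia.
  have [_ D _ _] := tab_std s; have [_ D' _ _] := tab_std s'.
  have [k' k'n E'] : exists2 k', k' < n & tab s' k' = tab s k by apply/D'/D; exists k.
  apply/mapP; exists k'; last by rewrite E'.
  rewrite mem_iota; case: (leqP b k') => bk; first lia.
  have := Es _ bk k'n; rewrite E'; have [inj _ _ _] := tab_std s.
  by move/(inj _ _ k'n kn); lia.
have E : [seq code (tab r k) | k <- iota b (n - b)] = [seq code (tab r' k) | k <- iota b (n - b)].
  apply: (irr_sorted_eq ltn_trans ltnn (so _ H) (so _ H')) => y.
  by apply/idP/idP; apply: sub => // k kb kn; rewrite Eb.
apply: tab_inj => k kn; case: (ltnP k b) => kb; first exact: Eb.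
apply: code_inj => //.
have := congr1 (fun s => nth 0 s (k - b)) E.
have hk : k - b < n - b by lia.
by rewrite !(nth_map 0) ?size_iota // !nth_iota // subnKC.
Qed.

(* The sum of k * code (t k) is maximal exactly when the entries follow the
   reading order of the nodes, so each class has a common representative. *)
Lemma swap_connected b (P : 'I_d -> Prop) :
  (forall r i, b <= i -> i.+1 < n -> node_adm (tab r i) (tab r i.+1) ->
     P r -> P (tab_swap i r)) ->
  forall r r', (forall k, k < b -> k < n -> tab r k = tab r' k) -> P r -> P r'.
Proof.
move=> HP r0 r0' E0 P0.
pose agree r := forall k, k < b -> k < n -> tab r k = tab r0 k.
have aswap r i : b <= i -> i.+1 < n -> node_adm (tab r i) (tab r i.+1) ->
    agree r -> agree (tab_swap i r).
  move=> bi hi ad ag k kb kn; rewrite tab_swapE // -ag //.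
  by have -> : transp i k = k by transp_lia.
(* Any swap-stable set that meets the class contains a reading-order tableau of it, found as a
   maximum of [phi]. *)
have top (S : 'I_d -> Prop) r1 : S r1 -> agree r1 ->
    (forall r i, b <= i -> i.+1 < n -> node_adm (tab r i) (tab r i.+1) ->
      S r -> S (tab_swap i r)) ->
    exists r, [/\ S r, agree r &
      forall i, b <= i -> i.+1 < n -> code (tab r i) < code (tab r i.+1)].
  move=> S1 a1 HS.
  pose p r := `[< S r /\ agree r >].
  have p1 : p r1 by apply/asboolP.
  case: (arg_maxnP phi p1) => r /asboolP[Sr ar] rmax.
  exists r; split => // i bi hi.
  case: (boolP (node_adm (tab r i) (tab r i.+1))) => ad; last exact: code_lt_nonadm.
  rewrite ltn_neqAle; apply/andP; split.
    apply/eqP => /code_inj; rewrite (ltnW hi) hi => /(_ isT isT).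
    have [inj _ _ _] := tab_std r.
    by move/(inj _ _ (ltnW hi) hi); lia.
  have : p (tab_swap i r) by apply/asboolP; split; [apply: HS|apply: aswap].
  by move/rmax; have := phi_swap hi ad; lia.
have [r1 [P1 a1 s1]] := top P r0 P0 (fun _ _ _ => erefl) HP.
(* As the swap is an involution, the r with [P r -> P r0'] also form a swap-stable set, and r0'
   belongs to it. *)
have [r2 [P2 a2 s2]] : exists r, [/\ P r -> P r0', agree r &
      forall i, b <= i -> i.+1 < n -> code (tab r i) < code (tab r i.+1)].
  apply: (top (fun r => P r -> P r0') r0') => // [k kb kn|r i bi hi ad Pr Ps].
    by rewrite E0.
  have ad' : node_adm (tab (tab_swap i r) i) (tab (tab_swap i r) i.+1).
    rewrite !tab_swapE // ?(ltnW hi) // /transp eqxx.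
    have -> : (i.+1 == i) = false by lia.
    by rewrite eqxx; move: ad; rewrite /node_adm; rewrite eq_sym orbC.
  by apply: Pr; rewrite -(tab_swapK hi ad); apply: HP.
have E : r1 = r2.
  by apply: (@sorted_codes_eq b) => // k kb kn; rewrite a1 // a2.
by apply: P2; rewrite -E.
Qed.

End Connectivity.

End TableauEnumeration.

(** * Products of differences of Jucys-Murphy elements *)

Section JMProducts.

Variables (R : comNzRingType) (d : nat).

Definition pjm (J : nat -> 'M[R]_d) (l : seq (nat * R)) : 'M[R]_d :=
  \big[mulmx/1%:M]_(p <- l) (J p.1 - p.2%:M).

Lemma pjm_cons J p l : pjm J (p :: l) = (J p.1 - p.2%:M) *m pjm J l.
Proof. by rewrite /pjm big_cons. Qed.

Lemma pjm_nil J : pjm J [::] = 1%:M.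
Proof. by rewrite /pjm big_nil. Qed.

Lemma pjm_rcons J l p : pjm J (rcons l p) = pjm J l *m (J p.1 - p.2%:M).
Proof. by rewrite /pjm -cats1 big_cat big_seq1. Qed.

Lemma pjm_eigen m (J : nat -> 'M[R]_d) (y : nat -> R) (u : 'M[R]_(m, d)) l :
  (forall p, p \in l -> u *m J p.1 = y p.1 *: u) ->
  u *m pjm J l = (\prod_(p <- l) (y p.1 - p.2)) *: u.
Proof.
elim: l => [|p l IH] H; first by rewrite pjm_nil big_nil mulmx1 scale1r.
rewrite pjm_cons mulmxA mulmxBr H ?mem_head // mul_mx_scalar -scalerBl -scalemxAl IH.
  by rewrite big_cons scalerA.
by move=> p' p'l; apply: H; rewrite in_cons p'l orbT.
Qed.

End JMProducts.

Lemma map_pjm (R S : comNzRingType) (f : {rmorphism R -> S}) d (J : nat -> 'M[R]_d) l :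
  map_mx f (pjm J l) = pjm (fun k => map_mx f (J k)) [seq (p.1, f p.2) | p <- l].
Proof.
elim: l => [|p l IH]; first by rewrite !pjm_nil map_mx1.
by rewrite /= !pjm_cons map_mxM IH map_mxB map_scalar_mx.
Qed.

(** Lagrange interpolation in commuting operators: the factor of s kills the eigenvector s, so the
    product kills all of them but r. The index kk s should be one at which the eigenvalues of s and
    r differ. *)
Definition separating (R : comNzRingType) d (y : 'I_d -> nat -> R) (kk : 'I_d -> nat)
    (r : 'I_d) : seq (nat * R) :=
  [seq (kk s, y s (kk s)) | s <- enum 'I_d & s != r].

Lemma separating_eigen (R : comNzRingType) d (J : nat -> 'M[R]_d) y kk r (s : 'I_d) :
  (forall s k, (exists s', k = kk s') -> delta_mx (0 : 'I_1) s *m J k = y s k *: delta_mx 0 s) ->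
  delta_mx (0 : 'I_1) s *m pjm J (separating y kk r) =
  (if s == r then \prod_(s' <- enum 'I_d | s' != r) (y r (kk s') - y s' (kk s')) else 0)
    *: delta_mx 0 s.
Proof.
move=> H; rewrite (@pjm_eigen _ _ _ _ (y s)); last first.
  by move=> p /mapP[s' _ ->]; apply: H; exists s'.
congr (_ *: _); rewrite /separating big_map; case: eqP => [->|/eqP sr].
  by rewrite big_filter.
have us : uniq [seq s' <- enum 'I_d | s' != r] by rewrite filter_uniq // enum_uniq.
have sl : s \in [seq s' <- enum 'I_d | s' != r] by rewrite mem_filter sr mem_enum.
by rewrite (bigD1_seq s sl us) /= subrr mul0r.
Qed.

Section StableWords.

Variables (F : fieldType) (d : nat) (T : nat -> 'M[F]_d).

Lemma stable_wprod m (U : 'M[F]_(m, d)) n l : (forall i, (i < n)%N -> stablemx U (T i)) ->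
  all (fun i => i < n)%N l -> stablemx U (wprod T l).
Proof.
move=> H; elim: l => [|i l IH] /=; first by rewrite wprod_nil mulmx1.
move=> /andP[hi hl]; rewrite wprod_cons mulmxA.
by apply: submx_trans (submxMr _ (H _ hi)) (IH hl).
Qed.

Lemma jm_word_lt n k : (k < n)%N -> all (fun i => i < n)%N (jm_word k).
Proof.
move=> kn; rewrite /jm_word all_cat all_rev; apply/andP; split; apply/allP => i;
  by rewrite mem_iota; lia.
Qed.

Lemma stable_pjm m (U : 'M[F]_(m, d)) n l : (forall i, (i < n)%N -> stablemx U (T i)) ->
  all (fun p : nat * F => p.1 < n)%N l -> stablemx U (pjm (fun k => wprod T (jm_word k)) l).
Proof.
move=> H; elim: l => [|p l IH] /=; first by rewrite pjm_nil mulmx1.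
move=> /andP[hi hl]; rewrite pjm_cons mulmxA.
apply: submx_trans (submxMr _ _) (IH hl).
rewrite mulmxBr mul_mx_scalar; apply: addmx_sub.
  by apply: (@stable_wprod _ _ n) => //; apply: jm_word_lt.
by rewrite eqmx_opp scalemx_sub.
Qed.

End StableWords.

(** * Seminormal modules for generic parameters *)

Section Contents.

Variables (K : fieldType) (q : K) (Q : K * K).

Definition generic_params : Prop := q != 0 /\
  forall c c' (z w : int), component Q c * q ^ z = component Q c' * q ^ w -> c = c' /\ z = w.

Hypothesis Hgen : generic_params.

Let q0 : q != 0. Proof. by case: Hgen. Qed.

Definition node_content (x : node) : int := x.1.2%:Z - x.1.1%:Z.

Definition xK (x : node) : K := component Q x.2 * q ^ node_content x.

Lemma xK_inj x y : xK x = xK y -> x.2 = y.2 /\ node_content x = node_content y.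
Proof. exact: (proj2 Hgen). Qed.

Lemma xK_shift x : q * xK x = component Q x.2 * q ^ (node_content x + 1).
Proof.
rewrite /xK mulrCA; congr (_ * _); rewrite addrC.
have := @expfzDr _ q 1 (node_content x) q0.
by rewrite expr1z.
Qed.

Lemma xK_adm x y : adm q (xK x) (xK y) = node_adm x y.
Proof.
have H u w : (xK w == q * xK u) = (u.2 == w.2) && (node_content w == node_content u + 1).
  rewrite xK_shift; apply/eqP/andP => [/(proj2 Hgen) [-> ->]|[/eqP E /eqP E']]; first by rewrite !eqxx.
  by rewrite /xK E E'.
rewrite /adm !H /node_adm /node_content [y.2 == x.2]eq_sym -negb_or -andb_orr.
by congr (~~ (_ && (_ || _))); lia.
Qed.

Section Instance.

Variables (n : nat) (la : bipart) (d : nat) (tab : 'I_d -> nat -> node).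
Hypotheses (la1 : is_part la.1) (la2 : is_part la.2).
Hypothesis Htab : tableaux n la tab.

Definition cK (r : 'I_d) (k : nat) : K := xK (tab r k).

Lemma cK_near r k k' : (k < k' < k + 3)%N -> (k' < n)%N -> cK r k != cK r k'.
Proof.
move=> kk k'n; apply/eqP => /xK_inj; rewrite /node_content.
case E: (tab r k) => [[a b] c]; case E': (tab r k') => [[a' b'] c'] /= [Ec Et].
subst c'; have kn : (k < n)%N by lia.
have := std_same_content la1 la2 (tab_std Htab r) kn k'n E E'; lia.
Qed.

Lemma cK_inj r r' : (forall k, (k < n)%N -> cK r k = cK r' k) -> r = r'.
Proof.
move=> H; apply: (tab_inj Htab) => k kn.
apply: (std_eq la1 la2 la1 la2 (tab_std Htab r) (tab_std Htab r')) kn => k' k'n.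
by have /xK_inj[E1 E2] := H _ k'n; split=> //; move: E2; rewrite /node_content; lia.
Qed.

Lemma cK_swap r i k : (i.+1 < n)%N -> (k < n)%N -> adm q (cK r i) (cK r i.+1) ->
  cK (tab_swap n tab i r) k = cK r (transp i k).
Proof. by move=> hi kn; rewrite /cK xK_adm => ad; rewrite (tab_swapE Htab). Qed.

Lemma cK0 r : (0 < n)%N -> cK r 0 = Q.1 \/ cK r 0 = Q.2.
Proof.
move=> n0; rewrite /cK /xK /node_content; have := node_bound la1 la2 Htab r n0.
case: (tab r 0%N) => [[a b] c] /=; rewrite leqn0 addn_eq0 => /andP[/eqP-> /eqP->].
by rewrite subrr expr0z mulr1; case: c; [right|left].
Qed.

Definition snK : nat -> 'M[K]_d := sn q cK (tab_swap n tab).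

Let ne r k : (k.+1 < n)%N -> cK r k != cK r k.+1.
Proof. by move=> h; apply: cK_near => //; lia. Qed.

Let ne2 r k : (k.+2 < n)%N -> cK r k != cK r k.+2.
Proof. by move=> h; apply: cK_near => //; lia. Qed.

Lemma snK_hecke : hecke_module q Q (fun i : 'I_n => snK i).
Proof. exact: (sn_hecke q0 ne ne2 cK_swap cK_inj cK0). Qed.

Lemma snK_jm r k : (k < n)%N ->
  delta_mx (0 : 'I_1) r *m wprod snK (jm_word k) = (q ^+ k * cK r k) *: delta_mx 0 r.
Proof. exact: (sn_jm ne cK_swap cK_inj). Qed.

Lemma snKE r i : delta_mx (0 : 'I_1) r *m snK i.+1 =
  acoef q (cK r i) (cK r i.+1) *: delta_mx 0 r +
  bcoef q (cK r i) (cK r i.+1) *: delta_mx 0 (tab_swap n tab i r).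
Proof. exact: snE. Qed.

Lemma bcK_neq0 r i : (i.+1 < n)%N -> node_adm (tab r i) (tab r i.+1) ->
  bcoef q (cK r i) (cK r i.+1) != 0.
Proof. by move=> hi ad; apply: bcoef_neq0; [rewrite /cK xK_adm|apply: ne]. Qed.

(* A submodule containing one seminormal basis vector contains all those that
   agree with it on the first b entries. *)
Lemma submodule_spread b m (U : 'M[K]_(m, d)) r r' :
  (forall i, (b < i < n)%N -> stablemx U (snK i)) ->
  (forall k, (k < b)%N -> (k < n)%N -> tab r k = tab r' k) ->
  (delta_mx (0 : 'I_1) r <= U)%MS -> (delta_mx (0 : 'I_1) r' <= U)%MS.
Proof.
move=> HU; apply: (swap_connected la1 la2 Htab (P := fun r => (delta_mx (0 : 'I_1) r <= U)%MS)).
move=> s i bi hi ad Us.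
have h : (delta_mx (0 : 'I_1) s *m snK i.+1 <= U)%MS.
  by apply: submx_trans (submxMr _ Us) (HU _ _); lia.
rewrite snKE in h; have b0 := bcK_neq0 hi ad.
set bc := bcoef _ _ _ in b0 h; set ac := acoef _ _ _ in h.
have -> : delta_mx (0 : 'I_1) (tab_swap n tab i s) =
    bc^-1 *: (ac *: delta_mx 0 s + bc *: delta_mx 0 (tab_swap n tab i s) - ac *: delta_mx 0 s).
  by rewrite addrAC subrr add0r scalerA mulVf // scale1r.
by rewrite scalemx_sub // addmx_sub // eqmx_opp scalemx_sub.
Qed.

Lemma sep_exists (r s : 'I_d) : s != r -> exists k : 'I_n, cK s k != cK r k.
Proof.
move=> sr; apply: contrapT => H; move/eqP: sr; apply; apply: cK_inj => k kn.
by apply/eqP/negPn/negP => h; apply: H; exists (Ordinal kn).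
Qed.

Definition sep_index (r s : 'I_d) : nat :=
  if [pick k : 'I_n | cK s k != cK r k] is Some k then val k else 0%N.

Lemma sep_indexP r s : s != r -> (sep_index r s < n)%N /\ cK s (sep_index r s) != cK r (sep_index r s).
Proof.
move=> sr; rewrite /sep_index; case: pickP => [k Hk|H]; first by rewrite ltn_ord.
by have [k] := sep_exists sr; rewrite H.
Qed.

(** A nonzero submodule has a vector with a nonzero coordinate r; the separating product projects it
    to a multiple of the basis vector r, and [submodule_spread] with b = 0 yields the other basis
    vectors. *)
Lemma snK_simple : (0 < n)%N -> (0 < d)%N -> simple_module (fun i : 'I_n => snK i).
Proof.
move=> n0 d0; split=> // U HU.
have HU' i : (i < n)%N -> stablemx U (snK i) by move=> hi; apply: (HU (Ordinal hi)).
case: (eqVneq U 0) => [->|Un0]; first by left.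
right; have [j [r Ujr]] : exists j r, U j r != 0.
  apply: contrapT => H; move/eqP: Un0; apply; apply/matrixP => j r; rewrite mxE.
  by apply/eqP/negPn/negP => h; apply: H; exists j, r.
pose kk s := sep_index r s.
pose y (s : 'I_d) k := q ^+ k * cK s k.
have kkn s : (kk s < n)%N.
  by rewrite /kk /sep_index; case: pickP => [k _|_] //=.
pose l := separating y kk r.
have lE s : delta_mx (0 : 'I_1) s *m pjm (fun k => wprod snK (jm_word k)) l =
    (if s == r then \prod_(s' <- enum 'I_d | s' != r) (y r (kk s') - y s' (kk s')) else 0)
    *: delta_mx 0 s.
  by apply: separating_eigen => s' k [s'' ->]; apply: snK_jm.
set M := pjm _ l in lE; set c := \prod_(s' <- enum 'I_d | _) _ in lE.
have c0 : c != 0.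
  rewrite prodf_seq_neq0; apply/allP => s _; apply/implyP => /sep_indexP[_ h].
  rewrite subr_eq0 /y -subr_eq0 -mulrBr mulf_neq0 ?expf_neq0 ?q0 // subr_eq0 eq_sym.
  exact: h.
have uM : row j U *m M = (U j r * c) *: delta_mx 0 r.
  rewrite [row j U]row_sum_delta mulmx_suml (bigD1 r) //= big1 ?addr0 => [|s sr].
    by rewrite -scalemxAl lE eqxx scalerA !mxE.
  by rewrite -scalemxAl lE (negbTE sr) scale0r scaler0.
have Er : (delta_mx (0 : 'I_1) r <= U)%MS.
  have h : (row j U *m M <= U)%MS.
    apply: submx_trans (submxMr _ (row_sub _ _)) _; apply: (@stable_pjm _ _ _ _ _ n) => //.
    by apply/allP => p /mapP[s _ ->] /=; apply: kkn.
  rewrite uM in h; rewrite -[delta_mx 0 r]scale1r -(@mulVf _ (U j r * c)) ?mulf_neq0 //.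
  by rewrite -scalerA scalemx_sub.
rewrite -sub1mx; apply/row_subP => s; rewrite row1.
apply: (@submodule_spread 0 _ _ r) => // i /andP[_ hi]; exact: HU'.
Qed.

End Instance.

End Contents.

(** * Residues of one-dimensional subquotients *)

Section LinearSubquotients.

Variables (C : fieldType) (n d : nat) (T : nat -> 'M[C]_d) (chi : nat -> C).

Let S (i : 'I_n) : 'M[C]_1 := (chi i)%:M.

Definition chiw (l : seq nat) : C := \prod_(j <- l) chi j.

Variables (U W : 'M[C]_d) (f : 'M[C]_(d, 1)).
Hypothesis HW : forall i, (i < n)%N -> stablemx W (T i).
Hypothesis Hf : forall i : 'I_n, W *m T i *m f = W *m f *m S i.

Lemma subquotient_word l : all (fun i => i < n)%N l ->
  W *m wprod T l *m f = chiw l *: (W *m f).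
Proof.
elim/last_ind: l => [|l i IH]; first by rewrite wprod_nil mulmx1 /chiw big_nil scale1r.
rewrite all_rcons => /andP[hi hl]; rewrite wprod_rcons mulmxA.
have /submxP[X HX] : (W *m wprod T l <= W)%MS by apply: (stable_wprod HW hl).
rewrite HX -!mulmxA [W *m (_ *m _)]mulmxA (Hf (Ordinal hi)) /= mul_mx_scalar.
rewrite -scalemxAr mulmxA -HX IH // scalerA /chiw big_rcons /=.
by congr (_ *: _); rewrite /= mulrC.
Qed.

Lemma subquotient_pjm l : all (fun p : nat * C => p.1 < n)%N l ->
  W *m pjm (fun k => wprod T (jm_word k)) l *m f =
  (\prod_(p <- l) (chiw (jm_word p.1) - p.2)) *: (W *m f).
Proof.
elim/last_ind: l => [|l p IH]; first by rewrite pjm_nil mulmx1 big_nil scale1r.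
rewrite all_rcons => /andP[hp hl]; rewrite pjm_rcons.
have /submxP[X HX] : (W *m pjm (fun k => wprod T (jm_word k)) l <= W)%MS.
  exact: (stable_pjm HW hl).
rewrite mulmxA HX -!mulmxA [W *m (_ *m _)]mulmxA mulmxBr mulmxBl.
rewrite subquotient_word ?jm_word_lt // mul_mx_scalar -scalemxAl -scalerBl.
rewrite -scalemxAr mulmxA -HX IH // scalerA big_rcons /=.
by congr (_ *: _); rewrite mulrC.
Qed.

End LinearSubquotients.

(** * Specializing Jucys-Murphy eigenvalues *)

Section Specializations.

Variables (K C : fieldType) (A : comNzRingType).
Variables (vA : {rmorphism A -> K}) (th : {rmorphism A -> C}) (qA : A) (QA : A * A).
Hypothesis vA_inj : injective vA.

Notation q := (vA qA).
Notation Q := (vA QA.1, vA QA.2).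

Hypothesis q0 : q != 0.

(** The eigenvalue of [jm_word k] as an element of A: entry k + 1 lies in a row of index at most k,
    so q^k times the content has a nonnegative exponent and the truncated subtraction is exact. *)
Definition cA (x : node) (k : nat) : A := component QA x.2 * qA ^+ (k + x.1.2 - x.1.1).

Lemma cA_val x k : (x.1.1 <= k)%N -> vA (cA x k) = q ^+ k * xK q Q x.
Proof.
case: x => [[a b] c] /= ak; rewrite /cA /xK /node_content rmorphM rmorphXn /=.
have -> : vA (component QA c) = component Q c by case: c.
rewrite mulrCA; congr (_ * _).
have := @expfzDr _ q k (b%:Z - a%:Z) q0; rewrite -exprnP => <-.
have -> : k%:Z + (b%:Z - a%:Z) = (k + b - a)%N%:Z by lia.
by rewrite -exprnP.
Qed.

Variables (n d : nat) (mu : bipart) (T : nat -> 'M[A]_d) (t : 'I_d -> nat -> node) (B : 'M[K]_d).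
Hypotheses (mu1 : is_part mu.1) (mu2 : is_part mu.2).
Hypothesis Ht : forall r, std n mu (t r).
Hypothesis HB : B \in unitmx.
Hypothesis Heig : forall r k, (k < n)%N ->
  row r B *m wprod (fun i => map_mx vA (T i)) (jm_word k) = (q ^+ k * xK q Q (t r k)) *: row r B.

Variable chi : nat -> C.

Let TC k := map_mx th (T k).
Let S (i : 'I_n) : 'M[C]_1 := (chi i)%:M.

Let row_bound r k : (k < n)%N -> ((t r k).1.1 <= k)%N.
Proof.
move=> kn; case E: (t r k) => [[a b] c] /=.
by have := std_bound0 mu1 mu2 (Ht r) kn E; lia.
Qed.

Let J k := wprod T (jm_word k).

Lemma pjm_row (kk : 'I_d -> nat) (s : seq 'I_d) r : (forall r, (kk r < n)%N) ->
  row r B *m map_mx vA (pjm J [seq (kk r', cA (t r' (kk r')) (kk r')) | r' <- s]) =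
  (\prod_(r' <- s) (vA (cA (t r (kk r')) (kk r')) - vA (cA (t r' (kk r')) (kk r')))) *: row r B.
Proof.
move=> kn; rewrite map_pjm (@pjm_eigen _ _ _ _ (fun k => vA (cA (t r k) k))).
  by rewrite -map_comp big_map.
move=> p; rewrite -map_comp => /mapP[r' _ ->] /=.
by rewrite /J map_wprod Heig ?kn // cA_val ?row_bound.
Qed.

Lemma subquotient_pjmC (U W : 'M[C]_d) f (kk : 'I_d -> nat) (s : seq 'I_d) :
  (forall i, (i < n)%N -> stablemx W (TC i)) ->
  (forall i : 'I_n, W *m TC i *m f = W *m f *m S i) -> (forall r, (kk r < n)%N) ->
  W *m map_mx th (pjm J [seq (kk r', cA (t r' (kk r')) (kk r')) | r' <- s]) *m f =
  (\prod_(r <- s) (chiw chi (jm_word (kk r)) - th (cA (t r (kk r)) (kk r)))) *: (W *m f).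
Proof.
move=> HW Hf kn; rewrite map_pjm -map_comp.
have -> : (fun k => map_mx th (J k)) = (fun k => wprod TC (jm_word k)).
  by apply/funext => k; rewrite /J map_wprod.
rewrite (subquotient_pjm HW Hf); first by rewrite big_map.
by apply/allP => p /mapP[r _ ->] /=.
Qed.

(* If no tableau had the residues of a one-dimensional subquotient, a product of
   differences of Jucys-Murphy elements would vanish on the module, but not on
   the subquotient. *)
Lemma subquotient_residues (U W : 'M[C]_d) :
  (forall i, (i < n)%N -> stablemx W (TC i)) ->
  subquotient_iso (fun i : 'I_n => TC i) U W S ->
  exists r, forall k, (k < n)%N -> th (cA (t r k) k) = chiw chi (jm_word k).
Proof.
move=> HW [f [Wf _ Hf]]; apply: contrapT => Hno.
have ex r : exists k : 'I_n, th (cA (t r k) k) != chiw chi (jm_word k).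
  apply: contrapT => H; apply: Hno; exists r => k kn.
  by apply/eqP/negPn/negP => h; apply: H; exists (Ordinal kn).
pose kk r : nat := xchoose (ex r).
have kn r : (kk r < n)%N by apply: ltn_ord.
have P0 : pjm J [seq (kk r', cA (t r' (kk r')) (kk r')) | r' <- enum 'I_d] = 0.
  have : map_mx vA (pjm J [seq (kk r', cA (t r' (kk r')) (kk r')) | r' <- enum 'I_d]) = 0.
    apply: (can_inj (mulKmx HB)); rewrite mulmx0; apply/row_matrixP => r.
    rewrite row_mul pjm_row // row0 (bigD1_seq r) ?mem_enum ?enum_uniq //=.
    by rewrite subrr mul0r scale0r.
  by move/matrixP => H; apply/matrixP => i j; apply: vA_inj; have := H i j; rewrite !mxE rmorph0.
have := @subquotient_pjmC U W f kk (enum 'I_d) HW Hf kn.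
rewrite P0 map_mx0 mulmx0 mul0mx => /esym/eqP; rewrite scaler_eq0 => /orP[|/eqP Wf0].
  rewrite prodf_seq_eq0 => /hasP[r _] /=; rewrite subr_eq0 eq_sym.
  by rewrite (negbTE (xchooseP (ex r))).
by move: Wf; rewrite Wf0 /row_full mxrank0.
Qed.

Lemma composition_mono (Us : seq 'M[C]_d) i j : composition_series (fun i : 'I_n => TC i) Us ->
  (i <= j <= size Us)%N -> (nth 0 (0 :: Us) i <= nth 0 (0 :: Us) j)%MS.
Proof.
move=> [_ _ H _]; elim: j => [|j IH] /andP[ij js].
  by have -> : i = 0%N by lia.
case: (ltngtP i j.+1) => [lt|gt|->]; [|lia|exact: submx_refl].
by apply: submx_trans (IH _) (ltmxW (H j js)); lia.
Qed.

(** The product P over the tableaux other than r0 has rank at most one and acts on each copy of the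
    character by a nonzero scalar c. With copies at stages i < j, their images under P are
    proportional; the image of the first lies in the submodule of stage j, which dies in the second
    copy, so c would be 0. *)
Lemma mult_le1 r0 Us : (0 < n)%N ->
  (forall r, (forall k, (k < n)%N -> th (cA (t r k) k) = chiw chi (jm_word k)) -> r = r0) ->
  composition_series (fun i : 'I_n => TC i) Us ->
  (count (fun i => `[< subquotient_iso (fun i : 'I_n => TC i) (nth 0%R (0%R :: Us) i)
                        (nth 0%R (0%R :: Us) i.+1) S >]) (iota 0 (size Us)) <= 1)%N.
Proof.
move=> n0 uniq0 HUs; have [_ Hst _ _] := HUs.
have ex r : r != r0 -> exists k : 'I_n, th (cA (t r k) k) != chiw chi (jm_word k).
  move=> /eqP rr0; apply: contrapT => H; apply: rr0; apply: uniq0 => k kn.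
  by apply/eqP/negPn/negP => h; apply: H; exists (Ordinal kn).
pose kk r : nat :=
  if [pick k : 'I_n | th (cA (t r k) k) != chiw chi (jm_word k)] is Some k then val k else 0%N.
have kn r : (kk r < n)%N.
  by rewrite /kk; case: pickP => [k _|_] //=.
have kkP r : r != r0 -> th (cA (t r (kk r)) (kk r)) != chiw chi (jm_word (kk r)).
  by move=> /ex[k Hk]; rewrite /kk; case: pickP => [k' //|/(_ k)]; rewrite Hk.
pose s := [seq r <- enum 'I_d | r != r0].
pose P := pjm J [seq (kk r', cA (t r' (kk r')) (kk r')) | r' <- s].
(* Rank at most one is expressed by 2 by 2 minors, which pass from K down to A and on to C. *)
have minors i j i' j' : P i j * P i' j' = P i j' * P i' j.
  pose c := \prod_(r' <- s) (vA (cA (t r0 (kk r')) (kk r')) - vA (cA (t r' (kk r')) (kk r'))).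
  have PE : map_mx vA P = col r0 (invmx B) *m (c *: row r0 B).
    apply: (can_inj (mulKmx HB)); apply/row_matrixP => r.
    rewrite row_mul pjm_row // mulmxA colE mulmxA mulmxV // mul1mx row_mul.
    case: (eqVneq r r0) => [->|rr0].
      by rewrite -/c; apply/rowP => k; rewrite !mxE big_ord1 !mxE !eqxx mul1r.
    have us : uniq s by rewrite filter_uniq // enum_uniq.
    have sl : r \in s by rewrite mem_filter rr0 mem_enum.
    rewrite (bigD1_seq r sl us) /= subrr mul0r scale0r.
    by apply/rowP => k; rewrite !mxE big_ord1 !mxE (negbTE rr0) mul0r.
  have E a b : vA (P a b) = invmx B a r0 * (c * B r0 b).
    by have := congr1 (fun M : 'M_d => M a b) PE; rewrite !mxE big_ord1 !mxE.
  by apply: vA_inj; rewrite !rmorphM !E; ring.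
pose PC := map_mx th P.
have minorsC m1 m2 (u : 'M_(m1, d)) (w : 'M_(m2, d)) a b j j' :
    (u *m PC) a j * (w *m PC) b j' = (u *m PC) a j' * (w *m PC) b j.
  rewrite !mxE !big_distrlr /=; apply: eq_bigr => i _; apply: eq_bigr => i' _.
  rewrite !mxE.
  have := congr1 th (minors i j i' j'); rewrite !rmorphM => E.
  by rewrite mulrACA E mulrACA.
pose c := \prod_(r <- s) (chiw chi (jm_word (kk r)) - th (cA (t r (kk r)) (kk r))).
have c0 : c != 0.
  rewrite /c prodf_seq_neq0; apply/allP => r; rewrite mem_filter => /andP[rr0 _] /=.
  by rewrite subr_eq0 eq_sym kkP.
rewrite leqNgt; apply/negP => cnt.
pose U i := nth 0 (0 :: Us) i.
have HU i k : (i <= size Us)%N -> (k < n)%N -> stablemx (U i) (TC k).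
  by move=> hi hk; apply: (Hst i hi (Ordinal hk)).
have [i [j [ij js Hi Hj]]] : exists i j, [/\ (i < j)%N, (j < size Us)%N,
    subquotient_iso (fun i : 'I_n => TC i) (U i) (U i.+1) S &
    subquotient_iso (fun i : 'I_n => TC i) (U j) (U j.+1) S].
  move: cnt; rewrite -size_filter; set l := [seq _ <- _ | _] => l1.
  have ul : uniq l by rewrite filter_uniq ?iota_uniq.
  have so : sorted ltn l.
    by apply: (sorted_filter ltn_trans); apply: iota_ltn_sorted.
  case el : l l1 so => [|i [|j l']] //= _ /andP[ij _].
  have : i \in l by rewrite el mem_head.
  have : j \in l by rewrite el !in_cons eqxx orbT.
  rewrite !mem_filter !mem_iota => /andP[/asboolP Hj hj] /andP[/asboolP Hi hi].
  by exists i, j; split => //; lia.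
have [f [Wf _ Hf]] := Hi; have [g [Wg /eqmxP Ug Hg]] := Hj.
have nz m (M : 'M[C]_(m, 1)) : row_full M -> exists a, M a 0 != 0.
  move=> fM; apply: contrapT => H; move: fM.
  have -> : M = 0.
    apply/matrixP => a b; rewrite [b]ord1 mxE; apply/eqP/negPn/negP => h.
    by apply: H; exists a.
  by rewrite /row_full mxrank0.
have [a Ha] := nz _ _ Wf; have [b Hb] := nz _ _ Wg.
have Ef := @subquotient_pjmC (U i) (U i.+1) f kk s (fun k => HU i.+1 k ltac:(lia)) Hf kn.
have Eg := @subquotient_pjmC (U j) (U j.+1) g kk s (fun k => HU j.+1 k ltac:(lia)) Hg kn.
rewrite -/c -/P -/PC in Ef Eg.
have u0 : row a (U i.+1 *m PC) != 0.
  apply/eqP => h; move/eqP: c0; apply; have := congr1 (fun M => row a M 0 0) Ef.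
  rewrite row_mul h mul0mx !mxE => /esym/eqP; rewrite mulf_eq0 => /orP[/eqP//|].
  by move: Ha; rewrite !mxE => /negbTE ->.
have [k0 Hk0] : exists k0, (U i.+1 *m PC) a k0 != 0.
  apply: contrapT => H; move/eqP: u0; apply; apply/rowP => k.
  by rewrite !mxE; apply/eqP/negPn/negP => h; apply: H; exists k; rewrite mxE.
have prop : row b (U j.+1 *m PC) =
    ((U j.+1 *m PC) b k0 / (U i.+1 *m PC) a k0) *: row a (U i.+1 *m PC).
  have rE m (M : 'M[C]_(m, d)) x k : row x M 0 k = M x k by rewrite mxE.
  apply/rowP => k; rewrite rE [RHS]mxE rE.
  apply: (mulfI Hk0); rewrite minorsC mulrA [_ * (_ / _)]mulrC divfK //.
  exact: mulrC.
have inU : (row a (U i.+1 *m PC) <= U j)%MS.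
  apply: submx_trans (row_sub _ _) _; apply: submx_trans (_ : U i.+1 <= U j)%MS.
    have -> : PC = pjm (fun k => wprod TC (jm_word k))
        [seq (p.1, th p.2) | p <- [seq (kk r', cA (t r' (kk r')) (kk r')) | r' <- s]].
      rewrite /PC map_pjm; congr pjm.
      by apply/funext => k; rewrite /J map_wprod.
    apply: (@stable_pjm _ _ _ _ _ n) => [k hk|]; first by apply: HU => //; lia.
    by apply/allP => p /mapP[p' /mapP[r _ ->] ->] /=.
  by apply: composition_mono => //; lia.
move/eqP: c0; apply; have := congr1 (fun M => row b M 0 0) Eg.
rewrite row_mul prop -scalemxAl.
have -> : row a (U i.+1 *m PC) *m g = 0.
  by apply/sub_kermxP; apply: submx_trans inU _; rewrite Ug capmxSr.
rewrite scaler0 !mxE => /esym/eqP; rewrite mulf_eq0 => /orP[/eqP//|].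
by move: Hb; rewrite !mxE => /negbTE ->.
Qed.

End Specializations.

(** * An integral form with a one-dimensional quotient *)

Section HeckeWords.

Variables (F : comNzRingType) (q : F) (n d : nat) (T : nat -> 'M[F]_d).

Definition hecke_rel : Prop :=
  [/\ forall i, (0 < i < n)%N -> T i *m T i = (q - 1) *: T i + q%:M,
      forall i, (0 < i)%N -> (i.+1 < n)%N ->
        T i *m T i.+1 *m T i = T i.+1 *m T i *m T i.+1
    & forall i j, (i.+1 < j)%N -> (j < n)%N -> T i *m T j = T j *m T i].

Hypothesis HT : hecke_rel.

Notation wp := (wprod T).

Lemma wprod_comm l i : (i < n)%N -> all (fun j => (j < n)%N && ((i.+1 < j) || (j.+1 < i))%N) l ->
  wp l *m T i = T i *m wp l.
Proof.
have [_ _ HC] := HT; move=> hi; elim: l => [|j l IH] /=; first by rewrite wprod_nil mulmx1 mul1mx.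
move=> /andP[/andP[hj hij] /IH E]; rewrite wprod_cons -mulmxA E !mulmxA; congr (_ *m _).
by case/orP: hij => h; [symmetry|]; apply: HC.
Qed.

Fixpoint desc_word (top j : nat) : seq nat :=
  if j is j'.+1 then top :: desc_word top.-1 j' else [::].

Lemma size_desc_word top j : size (desc_word top j) = j.
Proof. by elim: j top => //= j IH top; rewrite IH. Qed.

Lemma desc_word_rcons top j : (j < top)%N ->
  desc_word top j.+1 = rcons (desc_word top j) (top - j)%N.
Proof.
elim: j top => [|j IH] top h; first by rewrite /= subn0.
rewrite [LHS]/= -/(desc_word top.-1 j.+1) IH; last lia.
by rewrite /=; congr (_ :: rcons _ _); lia.
Qed.

Lemma mem_desc_word top j i : (j <= top)%N ->
  (i \in desc_word top j) = (top - j < i <= top)%N.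
Proof.
elim: j top => [|j IH] top h; first by rewrite in_nil; lia.
rewrite /= in_cons IH; lia.
Qed.

(** T_m passes the letters below m - 1, a braid move turns it into T_(m-1), and this passes the
    letters above m. *)
Lemma desc_word_shift top j m : (j <= top)%N -> (top < n)%N ->
  (top - j + 2 <= m <= top)%N ->
  wp (desc_word top j) *m T m = T m.-1 *m wp (desc_word top j).
Proof.
have [_ HB HC] := HT.
elim: j top => [|j IH] top jt tn /andP[h1 h2]; first lia.
rewrite /= wprod_cons; case: (ltngtP m top) h2 => [lt|//|eq] _.
  rewrite -mulmxA IH; try lia.
  by rewrite !mulmxA (HC m.-1 top) //; lia.
subst m; case: j IH jt h1 => [|j] IH jt h1; first lia.
rewrite /= wprod_cons -!mulmxA wprod_comm //; last first.
  by apply/allP => i; rewrite mem_desc_word; lia.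
rewrite !mulmxA; case: top tn jt h1 {IH} => [|top] tn jt h1; first lia.
by rewrite /= HB //; lia.
Qed.

Lemma asc_shift lo len k : (lo + len <= n)%N -> (0 < lo <= k)%N -> (k.+1 < lo + len)%N ->
  wp (iota lo len) *m T k = T k.+1 *m wp (iota lo len).
Proof.
have [_ HB HC] := HT.
elim: len lo => [|len IH] lo hn /andP[l0 lk] hk; first lia.
rewrite /= wprod_cons; case: (ltngtP lo k) lk => [lt|//|eq] _.
  rewrite -mulmxA IH; try lia.
  by rewrite !mulmxA HC //; lia.
subst k; case: len IH hn hk => [|len] IH hn hk; first lia.
rewrite /= wprod_cons -!mulmxA wprod_comm; [|lia|]; last first.
  by apply/allP => i; rewrite mem_iota; lia.
by rewrite !mulmxA HB //; lia.
Qed.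

Lemma asc_asc lo len m : (lo + len <= n)%N -> (0 < lo)%N -> (m < len)%N ->
  wp (iota lo.+1 m) *m wp (iota lo len) = wp (iota lo len) *m wp (iota lo m).
Proof.
elim: m => [|m IH] hn l0 hm; first by rewrite wprod_nil mul1mx mulmx1.
rewrite -[m.+1]addn1 !iotaD !wprod_cat /= !wprod1 -mulmxA.
have -> : T (lo.+1 + m)%N *m wp (iota lo len) = wp (iota lo len) *m T (lo + m)%N.
  by rewrite asc_shift //; lia.
by rewrite mulmxA IH ?mulmxA //; lia.
Qed.

(* v is a reversed word; the word moves the last true entry to its place first. *)
Fixpoint shuffle_word (v : seq bool) : seq nat :=
  if v is x :: v' then
    (if x then iota (count id v') .+1 (size v' - count id v') else [::]) ++ shuffle_word v'
  else [::].

Lemma shuffle_word_lt v : all (fun i => (0 < i < size v)%N) (shuffle_word v).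
Proof.
elim: v => //= x v IH; rewrite all_cat; apply/andP; split.
  case: x => //; apply/allP => i; rewrite mem_iota.
  by have := count_size id v; lia.
by apply: sub_all IH => i; lia.
Qed.

Lemma shuffle_comm v : (size v < n.-1)%N ->
  wp (shuffle_word v) *m T (size v).+1 = T (size v).+1 *m wp (shuffle_word v).
Proof.
move=> h; apply: wprod_comm; first lia.
by apply: sub_all (shuffle_word_lt v) => i; lia.
Qed.

(** With the next two lemmas, this is Deodhar's lemma for the minimal representatives w of the
    cosets of S_b x S_(n-b): for a simple reflection s, either w s is again one, or w s = s' w with
    s' in the subgroup. As words are reversed, s exchanges the two letters just before the tail
    v. *)
Lemma shuffle_swap u v : (size (u ++ false :: true :: v) <= n)%N ->
  wp (shuffle_word (u ++ false :: true :: v)) *m T (size v).+1 =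
  wp (shuffle_word (u ++ true :: false :: v)) /\
  size (shuffle_word (u ++ true :: false :: v)) =
  (size (shuffle_word (u ++ false :: true :: v))).+1.
Proof.
have cs := count_size id v.
elim: u => [|x u IH] /=.
  move=> h; have -> : ((size v).+1 - (0 + count id v) = size v - count id v + 1)%N by lia.
  rewrite add0n iotaD !wprod_cat /= wprod1 -!mulmxA shuffle_comm; last lia.
  split; last by rewrite !size_cat !size_iota /=; lia.
  have -> : ((count id v).+1 + (size v - count id v) = (size v).+1)%N by lia.
  by [].
move=> /ltnW /IH [E1 E2]; rewrite !wprod_cat -!mulmxA E1 !count_cat !size_cat /=.
split; last by rewrite E2; case: x; rewrite ?size_iota /=; lia.
by congr (wp _ *m _); case: x => //=; congr iota; lia.
Qed.

Lemma shuffle_same_true u v : (size (u ++ true :: true :: v) <= n)%N ->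
  wp (shuffle_word (u ++ true :: true :: v)) *m T (size v).+1 =
  T (count id v).+1 *m wp (shuffle_word (u ++ true :: true :: v)).
Proof.
have cs := count_size id v.
elim: u => [|x u IH] /=.
  move=> h; set c := count id v; set s := size v.
  have -> : (s.+1 - (1 + c) = s - c)%N by lia.
  rewrite add1n !wprod_cat -!mulmxA shuffle_comm ; last lia.
  rewrite !mulmxA; congr (_ *m _).
  have E : wp (iota c.+1 (s - c)) *m T s.+1 = wp (iota c.+1 (s - c).+1).
    rewrite -[(s - c).+1]addn1 iotaD wprod_cat /= wprod1; congr (_ *m T _).
    by rewrite /s /c; lia.
  rewrite -[_ *m wp (iota c.+1 (s - c)) *m T _]mulmxA E asc_asc; try (rewrite /s /c; lia).
  by rewrite /= wprod_cons.
move=> h; have E := IH (ltnW h); rewrite !wprod_cat -!mulmxA E !mulmxA; congr (_ *m _).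
case: x h => h; last by rewrite wprod_nil mul1mx mulmx1.
apply: wprod_comm; first by move: h; rewrite size_cat /=; lia.
apply/allP => i; rewrite mem_iota count_cat size_cat /=; move: h; rewrite size_cat /=.
by have := count_size id u; lia.
Qed.

Lemma shuffle_same_false u v : (size (u ++ false :: false :: v) <= n)%N ->
  wp (shuffle_word (u ++ false :: false :: v)) *m T (size v).+1 =
  T (count id (u ++ v) + (size v - count id v)).+1 *m
    wp (shuffle_word (u ++ false :: false :: v)).
Proof.
have cs := count_size id v.
elim: u => [|x u IH] /=.
  move=> h; rewrite shuffle_comm; last lia.
  by congr (T _ *m _); lia.
move=> h; have E := IH (ltnW h); rewrite !wprod_cat -!mulmxA E !mulmxA; congr (_ *m _).
case: x h => h; last by rewrite wprod_nil mul1mx mulmx1.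
move: h; rewrite !count_cat !size_cat /= => h; have := count_size id u => cu.
by rewrite asc_shift; try lia; congr (T _ *m _); lia.
Qed.

End HeckeWords.

(** * Elements regular at the specialization *)

Section Regular.

Variables (K C : fieldType) (A : comNzRingType).
Variables (vA : {rmorphism A -> K}) (th : {rmorphism A -> C}).
Hypothesis vA_inj : injective vA.

(* y lies in the localization of A at the kernel of th, with image c. *)
Definition reg (y : K) (c : C) : Prop :=
  exists a b : A, [/\ th b != 0, y = vA a / vA b & c = th a / th b].

Lemma vA_neq0 b : th b != 0 -> vA b != 0.
Proof.
move=> tb; apply/eqP => h; move/eqP: tb; apply.
by have -> : b = 0; rewrite ?rmorph0 //; apply: vA_inj; rewrite rmorph0.
Qed.

(** This will make the value of the functional independent of the way in which a vector of the orbit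
    span is written. *)
Lemma reg_uniq y c c' : reg y c -> reg y c' -> c = c'.
Proof.
move=> [a [b [tb -> ->]]] [a' [b' [tb' E ->]]].
apply/eqP; rewrite eqr_div //; apply/eqP; rewrite -!rmorphM; congr (th _).
apply: vA_inj; rewrite !rmorphM; apply/eqP; rewrite -eqr_div ?vA_neq0 //.
exact/eqP.
Qed.

Lemma reg_vA a : reg (vA a) (th a).
Proof. by exists a, 1; rewrite !rmorph1 !divr1 oner_eq0. Qed.

Lemma reg0 : reg 0 0. Proof. by have := reg_vA 0; rewrite !rmorph0. Qed.
Lemma reg1 : reg 1 1. Proof. by have := reg_vA 1; rewrite !rmorph1. Qed.

Lemma regD y c y' c' : reg y c -> reg y' c' -> reg (y + y') (c + c').
Proof.
move=> [a [b [tb -> ->]]] [a' [b' [tb' -> ->]]]; exists (a * b' + a' * b), (b * b').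
by split; rewrite ?addf_div ?vA_neq0 // !(rmorphD, rmorphM) //= mulf_neq0.
Qed.

Lemma regM y c y' c' : reg y c -> reg y' c' -> reg (y * y') (c * c').
Proof.
move=> [a [b [tb -> ->]]] [a' [b' [tb' -> ->]]]; exists (a * a'), (b * b').
by split; rewrite ?mulf_div // !rmorphM //= mulf_neq0.
Qed.

Lemma regN y c : reg y c -> reg (- y) (- c).
Proof.
by move=> [a [b [tb -> ->]]]; exists (- a), b; rewrite !rmorphN !mulNr.
Qed.

Lemma regB y c y' c' : reg y c -> reg y' c' -> reg (y - y') (c - c').
Proof. by move=> h h'; apply: regD h (regN h'). Qed.

Lemma regV y c : reg y c -> c != 0 -> reg y^-1 c^-1.
Proof.
move=> [a [b [tb -> ->]]]; rewrite mulf_eq0 invr_eq0 (negbTE tb) orbF => ta.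
by exists b, a; rewrite !invf_div.
Qed.

Lemma regX y c k : reg y c -> reg (y ^+ k) (c ^+ k).
Proof.
move=> h; elim: k => [|k IH]; first by rewrite !expr0; apply: reg1.
by rewrite !exprS; apply: regM.
Qed.

Lemma reg_exprz y c (z : int) : reg y c -> c != 0 -> reg (y ^ z) (c ^ z).
Proof.
case: z => k h c0; first exact: regX.
by rewrite !NegzE -!exprnN; apply: regV; [apply: regX|rewrite expf_neq0].
Qed.

Lemma reg_sum (I : Type) (s : seq I) (f : I -> K) (g : I -> C) :
  (forall i, reg (f i) (g i)) -> reg (\sum_(i <- s) f i) (\sum_(i <- s) g i).
Proof.
move=> H; elim: s => [|i s IH]; first by rewrite !big_nil; apply: reg0.
by rewrite !big_cons; apply: regD.
Qed.

End Regular.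

Lemma hecke_module_rel (F : comNzRingType) (q : F) (Q : F * F) n d (T : nat -> 'M[F]_d) :
  hecke_module q Q (fun i : 'I_n => T i) -> hecke_rel q n T.
Proof.
case=> _ HQ _ HB HC; split.
- move=> i /andP[i0 hi]; have := HQ (Ordinal hi) i0.
  rewrite mulmxBl !mulmxDr !mulmx1 !mul_scalar_mx => /eqP.
  rewrite subr_eq0 => /eqP E.
  have -> : T i *m T i = (q *: T i + q%:M) - T i by rewrite -E addrK.
  by rewrite scalerBl scale1r addrAC.
- by move=> i i0 hi; apply: (HB (Ordinal (ltnW hi)) (Ordinal hi)).
- move=> i j ij hj; have hi : (i < n)%N by lia.
  exact: (HC (Ordinal hi) (Ordinal hj)).
Qed.

Lemma congr_gap (e : nat) (z : int) (m : nat) (c : int) : 0 < m%:Z + 1 + c < e%:Z ->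
  ~ congr_mod e (z - (e%:Z - 1)) (z - m%:Z - c).
Proof.
move=> hc [y hy]; have ye : (y + 1) * e%:Z = m%:Z + 1 + c by lia.
have : (y <= -1) || (0 <= y) by lia.
by case/orP => h; clear - hc ye h; nia.
Qed.

Lemma height_gt1 (sg : bool) (e m : nat) : (0 < m < height sg e)%N ->
  sg = true /\ (height sg e)%:Z = e%:Z - 1 /\ (m.+1 < e)%N.
Proof. by rewrite /height; case: sg; lia. Qed.

(** * The orbit lattice *)

Section Lattice.

Variables (K C : fieldType) (A : comNzRingType).
Variables (vA : {rmorphism A -> K}) (th : {rmorphism A -> C}) (iA : {rmorphism {poly C} -> A}).
Variables (eta : C) (qA qAi : A) (QA : A * A).
Hypotheses (vA_inj : injective vA) (iA_inj : injective iA).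
Hypothesis thiA : forall p, th (iA p) = p.[eta].
Hypothesis iAX : iA 'X = qA.
Hypothesis qAV : qA * qAi = 1.

Notation q := (vA qA).
Notation Q := (vA QA.1, vA QA.2).
Notation iK := (fun p => vA (iA p)).

Hypothesis Hgen : generic_params q Q.
Variable e : nat.
Hypotheses (he : (2 <= e)%N) (heta : e.-primitive_root eta).

Lemma th_qA : th qA = eta. Proof. by rewrite -iAX thiA hornerX. Qed.

Lemma eta_neq0 : eta != 0.
Proof.
apply/eqP => h; have := prim_expr_order heta; rewrite h expr0n.
have -> : (e == 0)%N = false by lia.
by move/esym/eqP; rewrite oner_eq0.
Qed.

Lemma eta_exprz_congr (z w : int) : congr_mod e z w <-> eta ^ z = eta ^ w.
Proof.
have eta_e k : eta ^ (k * e%:Z) = 1.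
  by rewrite mulrC -exprz_exp -exprnP (prim_expr_order heta) exp1rz.
split=> [[k ->]|E]; first by rewrite expfzDr ?eta_neq0 // eta_e mulr1.
have e0 : e%:Z != 0 by lia.
exists ((z - w) %/ e%:Z)%Z; have dE := divz_eq (z - w) e%:Z.
have m0 := modz_ge0 (z - w) e0.
suff : ((z - w) %% e%:Z)%Z = 0 by move=> h; rewrite h addr0 in dE; rewrite -dE; ring.
have [m Em] : exists m : nat, ((z - w) %% e%:Z)%Z = m%:Z.
  by exists (absz ((z - w) %% e%:Z)%Z); lia.
have me : (m < e)%N.
  by have := @ltz_pmod (z - w) e%:Z ltac:(lia); rewrite Em; lia.
have : eta ^+ m = 1.
  have : eta ^ (z - w) = 1.
    by rewrite expfzDr ?eta_neq0 // E -expfzDr ?eta_neq0 // subrr expr0z.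
  by rewrite {1}dE expfzDr ?eta_neq0 // eta_e mul1r Em -exprnP.
move/eqP; rewrite -(prim_order_dvd heta) => /dvdnP[k mk].
by rewrite Em; case: k mk => [|k] mk; lia.
Qed.

Variables (sg : bool) (b n : nat).
Notation p := (height sg e).
Hypothesis bn : (b <= n)%N.
Variables (d : nat) (tab : 'I_d -> nat -> node).
Hypothesis Htab : tableaux n (label_shape sg p b n) tab.
Variable r0 : 'I_d.
Hypothesis Hr0 : forall k, (k < n)%N -> tab r0 k = label_tab sg p b k.

Definition chi : C := if sg then -1 else eta.

Lemma chi_quad : chi * chi = (eta - 1) * chi + eta.
Proof. by rewrite /chi; case: (sg); ring. Qed.

Let p0 : (0 < p)%N. Proof. exact: height_gt0 he. Qed.
Let la1 : is_part (label_shape sg p b n).1. Proof. exact: mull_row_is_part. Qed.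
Let la2 : is_part (label_shape sg p b n).2. Proof. exact: line_is_part. Qed.

Let T : nat -> 'M[K]_d := snK q Q n tab.
Let E (r : 'I_d) : 'rV[K]_d := delta_mx 0 r.
Let x (r : 'I_d) (k : nat) : K := cK q Q tab r k.

Let HT : hecke_rel q n T.
Proof. by apply: hecke_module_rel; apply: (snK_hecke Hgen la1 la2 Htab). Qed.

Definition base (r : 'I_d) : Prop := forall k, (k < b)%N -> tab r k = tab r0 k.

Lemma base_line r k : base r -> (k < b)%N -> tab r k = line_node sg k.
Proof. by move=> hr kb; rewrite hr // Hr0 ?(leq_trans kb) // /label_tab kb. Qed.

(** The second component has only b nodes, all taken by the first b entries. *)
Lemma base_comp r k : base r -> (b <= k < n)%N -> (tab r k).2 = false.
Proof.
move=> hr /andP[bk kn]; case Ek: (tab r k) => [[a c] [|]] //=.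
have [_ D0 _ _] := label_std sg p0 bn.
have [inj D _ _] := tab_std Htab r.
have /D0[k' k'n] : in_diagram (label_shape sg p b n) (a, c, true) by apply/D; exists k.
rewrite /label_tab; case: ltnP => // k'b Ek'.
have := inj k' k k'n kn; rewrite (base_line hr k'b) Ek' Ek => /(_ erefl).
by lia.
Qed.

Lemma base_bound r k a c : base r -> (b <= k < n)%N -> tab r k = (a, c, false) ->
  (b + a + c <= k)%N.
Proof.
move=> hr /andP[bk kn]; apply: (std_bound la1 la2 (tab_std Htab r)) => // i ib ni.
by rewrite (base_line hr ib) /line_node; case: (sg).
Qed.

Lemma base_first r : base r -> (b < n)%N -> tab r b = (0%N, 0%N, false).
Proof.
move=> hr hbn; case Eb: (tab r b) => [[a c] cc].
have h : (b <= b < n)%N by rewrite leqnn.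
have := base_comp hr h; rewrite Eb /= => Ecc; subst cc.
have := base_bound hr h Eb => h'.
by congr (_, _, _); lia.
Qed.

Definition jmd (k : nat) : 'M[K]_d := diag_mx (\row_r x r k).

Lemma jmdE r k : E r *m jmd k = x r k *: E r.
Proof.
rewrite /E -rowE; apply/rowP => j; rewrite !mxE eqxx /= [j == r]eq_sym.
case: (eqVneq r j) => [->|ne]; first by rewrite mulr1n mulr1.
by rewrite mulr0n mulr0.
Qed.

Lemma wprod_jm k : (k < n)%N -> wprod T (jm_word k) = q ^+ k *: jmd k.
Proof.
move=> kn; apply: row_matrixE => r; rewrite (snK_jm Hgen la1 la2 Htab) //.
by rewrite -scalemxAr jmdE scalerA.
Qed.

Let q0 : q != 0. Proof. by case: Hgen. Qed.

Lemma T_jmd_T k : (k.+1 < n)%N -> T k.+1 *m jmd k *m T k.+1 = q *: jmd k.+1.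
Proof.
move=> kn; have := wprod_jmS T k; rewrite !wprod_jm ?(ltnW kn) // -scalemxAr -scalemxAl.
rewrite exprSr -scalerA => H; have qk : q ^+ k != 0 by rewrite expf_neq0.
exact/esym/(scalerI qk).
Qed.

Lemma T_0 : T 0 = jmd 0.
Proof. by apply: row_matrixE => r; rewrite jmdE; apply: sn0E. Qed.

Lemma T_entry i r r' : T i.+1 r r' != 0 -> (i.+1 < n)%N ->
  r' = r \/ r' = tab_swap n tab i r /\ node_adm (tab r i) (tab r i.+1).
Proof.
rewrite /T /snK /= mxE => h hi.
case: (eqVneq r' r) h => [->|_]; first by left.
rewrite mulr0 add0r; case: (eqVneq r' (tab_swap n tab i r)) => [-> h|_]; last first.
  by rewrite mulr0 eqxx.
right; split=> //; move: h; rewrite /bcoef /cK (xK_adm Hgen); case: ifP => //.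
by rewrite mul0r eqxx.
Qed.

Definition supported (P : 'I_d -> Prop) (y : 'rV[K]_d) := forall r, y 0 r != 0 -> P r.

Lemma supported_T P i y : (i.+1 < n)%N ->
  (forall r, P r -> node_adm (tab r i) (tab r i.+1) -> P (tab_swap n tab i r)) ->
  supported P y -> supported P (y *m T i.+1).
Proof.
move=> hi HP Hy r'; rewrite mxE => h.
have [r hr] : exists r, y 0 r * T i.+1 r r' != 0.
  apply: contrapT => H; move/eqP: h; apply; apply: big1 => r _.
  by apply/eqP/negPn/negP => h; apply: H; exists r.
have /andP[yr Tr] : (y 0 r != 0) && (T i.+1 r r' != 0).
  by rewrite -negb_or -mulf_eq0.
case: (T_entry Tr hi) => [->|[-> ad]]; first exact: Hy.
by apply: HP => //; apply: Hy.
Qed.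

(* y lies in the C[q]-span of the orbit of E r0 under T_(b+1), ..., T_(b+k), and c
   is the value at y, modulo th, of the functional sending E r0 to 1 on which
   every T_m acts by chi. *)
Fixpoint orbit_span (k : nat) (y : 'rV[K]_d) (c : C) : Prop :=
  if k is k'.+1 then
    exists (f : nat -> 'rV[K]_d) (g : nat -> C),
      [/\ forall j, (j < k'.+2)%N -> orbit_span k' (f j) (g j),
          y = \sum_(j < k'.+2) f j *m wprod T (desc_word (b + k) j)
        & c = \sum_(j < k'.+2) g j * chi ^+ j]
  else exists p : {poly C}, y = iK p *: E r0 /\ c = p.[eta].

Lemma orbit_span0 k : orbit_span k 0 0.
Proof.
elim: k => [|k IH] /=; first by exists 0; rewrite !rmorph0 scale0r horner0.
exists (fun=> 0), (fun=> 0); split=> //; rewrite big1 // => j _; first by rewrite mul0mx.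
by rewrite mul0r.
Qed.

Lemma orbit_spanD k y c y' c' :
  orbit_span k y c -> orbit_span k y' c' -> orbit_span k (y + y') (c + c').
Proof.
elim: k y c y' c' => [|k IH] y c y' c' /=.
  by move=> [u [-> ->]] [u' [-> ->]]; exists (u + u'); rewrite !rmorphD scalerDl hornerD.
move=> [f [g [H -> ->]]] [f' [g' [H' -> ->]]]; exists (fun j => f j + f' j), (fun j => g j + g' j).
split; first by move=> j hj; apply: IH; [apply: H|apply: H'].
  by rewrite -big_split; apply: eq_bigr => j _; rewrite mulmxDl.
by rewrite -big_split; apply: eq_bigr => j _; rewrite mulrDl.
Qed.

Lemma orbit_spanZ k u y c : orbit_span k y c -> orbit_span k (iK u *: y) (u.[eta] * c).
Proof.
elim: k y c => [|k IH] y c /=.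
  by move=> [u' [-> ->]]; exists (u * u'); rewrite !rmorphM scalerA hornerM.
move=> [f [g [H -> ->]]]; exists (fun j => iK u *: f j), (fun j => u.[eta] * g j).
split; first by move=> j hj; apply: IH; apply: H.
  by rewrite scaler_sumr; apply: eq_bigr => j _; rewrite -scalemxAl.
by rewrite mulr_sumr; apply: eq_bigr => j _; rewrite mulrA.
Qed.

Lemma orbit_span_sum k m (f : nat -> 'rV[K]_d) (g : nat -> C) :
  (forall j, (j < m)%N -> orbit_span k (f j) (g j)) ->
  orbit_span k (\sum_(j < m) f j) (\sum_(j < m) g j).
Proof.
elim: m => [|m IH] H; first by rewrite !big_ord0; apply: orbit_span0.
rewrite !big_ord_recr /=; apply: orbit_spanD; last exact: H.
by apply: IH => j hj; apply: H; lia.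
Qed.

Lemma orbit_span_desc k j y c : (j < k.+2)%N -> orbit_span k y c ->
  orbit_span k.+1 (y *m wprod T (desc_word (b + k.+1) j)) (c * chi ^+ j).
Proof.
move=> hj H; exists (fun i => if i == j then y else 0), (fun i => if i == j then c else 0).
split.
- by move=> i _; case: eqP => // _; apply: orbit_span0.
- rewrite (bigD1 (Ordinal hj)) //= eqxx big1 ?addr0 // => i.
  by rewrite -val_eqE /= => /negbTE ->; rewrite mul0mx.
- rewrite (bigD1 (Ordinal hj)) //= eqxx big1 ?addr0 // => i.
  by rewrite -val_eqE /= => /negbTE ->; rewrite mul0r.
Qed.

(** The descending word has the letters b + k + 1 down to b + k + 2 - j, where k is the inductive
    one. If m is smaller by more than one it commutes, just below it lengthens the word, at the last
    letter the quadratic relation applies, and above it braid moves shift m to m - 1. The values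
    follow since chi satisfies the quadratic relation. *)
Lemma orbit_span_T k m y c : (b + k < n)%N -> (b < m <= b + k)%N ->
  orbit_span k y c -> orbit_span k (y *m T m) (c * chi).
Proof.
elim: k m y c => [|k IH] m y c hk hm; first lia.
move=> [f [g [H -> ->]]]; rewrite mulmx_suml mulr_suml.
apply: (@orbit_span_sum _ _ (fun j => f j *m wprod T (desc_word (b + k.+1) j) *m T m)
  (fun j => g j * chi ^+ j * chi)) => j hj.
have Hj := H _ hj; have [HQ _ HC] := HT.
case: (ltngtP m (b + k.+1 - j)%N) => [lt|gt|eq].
- rewrite -mulmxA (wprod_comm HT); [|lia|]; last first.
    by apply/allP => i; rewrite mem_desc_word; lia.
  rewrite mulmxA -mulrA [chi ^+ j * _]mulrC mulrA; apply: orbit_span_desc => //.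
  by apply: IH => //; lia.
- case: (eqVneq m (b + k.+1 - j).+1) => [eq|ne].
    case: j hj Hj gt eq => [|j] hj Hj gt eq; first lia.
    have em : m = (b + k.+1 - j)%N by lia.
    rewrite desc_word_rcons; last lia.
    rewrite wprod_rcons -em -!mulmxA HQ; last lia.
    rewrite !mulmxDr mul_mx_scalar -!scalemxAr.
    have -> : g j.+1 * chi ^+ j.+1 * chi =
        (eta - 1) * (g j.+1 * chi ^+ j.+1) + eta * (g j.+1 * chi ^+ j).
      rewrite exprS; transitivity (g j.+1 * chi ^+ j * (chi * chi)); first by ring.
      by rewrite chi_quad; ring.
    apply: orbit_spanD.
      have -> : q - 1 = iK ('X - 1) by rewrite !rmorphB !rmorph1 iAX.
      have -> : eta - 1 = ('X - 1).[eta] by rewrite hornerD hornerN hornerX hornerC.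
      apply: orbit_spanZ; rewrite em -wprod_rcons -desc_word_rcons; last lia.
      exact: orbit_span_desc.
    have -> : q = iK 'X by rewrite iAX.
    have {1}-> : eta = 'X.[eta] by rewrite hornerX.
    by apply: orbit_spanZ; apply: orbit_span_desc => //; lia.
  rewrite -mulmxA (desc_word_shift HT) ?mulmxA; try lia.
  rewrite -mulrA [chi ^+ j * _]mulrC mulrA; apply: orbit_span_desc => //.
  by apply: IH => //; lia.
- rewrite eq -mulmxA -wprod_rcons -desc_word_rcons; last lia.
  rewrite -mulrA -exprSr; apply: orbit_span_desc => //; lia.
Qed.

Lemma orbit_span_word k l y c : (b + k < n)%N -> all (fun m => b < m <= b + k)%N l ->
  orbit_span k y c -> orbit_span k (y *m wprod T l) (c * chi ^+ size l).
Proof.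
move=> hk; elim: l y c => [|m l IH] y c /=; first by rewrite wprod_nil mulmx1 mulr1.
move=> /andP[hm hl] H; rewrite wprod_cons mulmxA exprS mulrA.
by apply: IH => //; apply: orbit_span_T.
Qed.

Lemma label_node r k : base r -> (b + k < n)%N ->
  exists a c, [/\ tab r (b + k) = (a, c, false), (a < p)%N & (c * p + a < n - b)%N].
Proof.
move=> hr hk; case Ek: (tab r (b + k)) => [[a c] cc].
have h : (b <= b + k < n)%N by lia.
have := base_comp hr h; rewrite Ek /= => Ecc; subst cc.
exists a, c; have [_ D _ _] := tab_std Htab r.
have : in_diagram (label_shape sg p b n) (a, c, false) by apply/D; exists (b + k)%N.
by rewrite /in_diagram /= in_mull_row // => /andP[].
Qed.

Lemma tab_r0_comp1 k : (b + k < n)%N -> tab r0 (b + k) = ((k %% p)%N, (k %/ p)%N, false).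
Proof. by move=> hk; rewrite Hr0 // /label_tab ltnNge leq_addr /= addKn. Qed.

Lemma base_r0 : base r0. Proof. by []. Qed.

(* The node removed last from a union of full columns and one partial column is
   the bottom of the partial column or the bottom of the last full one. *)
Lemma removable_content r k : base r -> (b + k < n)%N ->
  (forall i, (b + k < i < n)%N -> tab r i = tab r0 i) ->
  node_content (tab r (b + k)) = node_content (tab r0 (b + k)) \/
  (k.+1 %% p != 0)%N /\ node_content (tab r (b + k)) = (k.+1 %/ p)%N%:Z - p%:Z.
Proof.
move=> hr hk Hlate; have [a [c [Ek ap hac]]] := label_node hr hk.
have [inj D hrow hcol] := tab_std Htab r.
have in_la y z : (y < p)%N -> (z * p + y < n - b)%N ->
    exists2 i, (i < n)%N & tab r i = (y, z, false).
  by move=> yp h; apply/D; rewrite /in_diagram /= in_mull_row // yp.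
have late y z i : (b + k < i < n)%N -> tab r i = (y, z, false) -> i = (b + (z * p + y))%N.
  move=> hi Ei; have /andP[hi1 hi2] := hi; have := Hlate _ hi; rewrite Ei.
  have -> : i = (b + (i - b))%N by lia.
  rewrite tab_r0_comp1; last lia.
  by move=> [-> ->]; rewrite -divn_eq.
have hack : (c * p + a <= k)%N.
  rewrite leqNgt; apply/negP => lt.
  have hi : (b + k < b + (c * p + a) < n)%N by lia.
  have := Hlate _ hi; rewrite tab_r0_comp1; last lia.
  rewrite modnMDl modn_small // divnMDl // divn_small // addn0 -Ek => /inj; lia.
have right : (k < c.+1 * p + a)%N.
  rewrite ltnNge; apply/negP => le.
  have [i ni Ei] := in_la a c.+1 ap ltac:(lia).
  have lt := hrow _ _ _ _ _ hk ni Ek Ei.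
  by have := late a c.+1 i ltac:(lia) Ei; lia.
have below : (a.+1 < p)%N -> (k < c * p + a.+1)%N.
  move=> ap1; rewrite ltnNge; apply/negP => le.
  have [i ni Ei] := in_la a.+1 c ap1 ltac:(lia).
  have lt := hcol _ _ _ _ _ hk ni Ek Ei.
  by have := late a.+1 c i ltac:(lia) Ei; lia.
case: (eqVneq k (c * p + a)%N) => [kE|kne].
  left; rewrite Ek tab_r0_comp1 // kE.
  by rewrite modnMDl modn_small // divnMDl // divn_small // addn0.
right.
have aE : a = p.-1 by lia.
have [i ip kE] : exists2 i, (0 < i < p)%N & k.+1 = (c.+1 * p + i)%N.
  exists (k.+1 - c.+1 * p)%N; nia.
rewrite kE modnMDl modn_small; last lia.
rewrite divnMDl // divn_small; last lia.
by rewrite Ek /node_content /=; split; lia.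
Qed.

(** In the sign case, going from the foot of a column to the head of the next adds p = e - 1 to the
    content, that is, -1 modulo e, like a step down a column. *)
Lemma eta_label_content k : (b + k < n)%N ->
  eta ^ node_content (tab r0 (b + k)) = eta ^ (dsign sg * k%:Z).
Proof.
move=> hk; apply/eta_exprz_congr; rewrite tab_r0_comp1 // /node_content /= /congr_mod /dsign.
have := divn_eq k p; have := ltn_pmod k p0; rewrite /height; case: (sg) => h1 h2.
  exists (k %/ e.-1)%N%:Z; rewrite {3}h2.
  have eE : e%:Z = (e.-1)%:Z + 1 by lia.
  by rewrite eE PoszD PoszM; ring.
by exists 0; rewrite mul0r addr0 mul1r divn1 modn1; lia.
Qed.

Hypothesis thQ1 : th QA.1 != 0.

Let eta0 : eta != 0. Proof. exact: eta_neq0. Qed.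

Lemma reg_q : reg vA th q eta.
Proof. by rewrite -[X in reg _ _ _ X]th_qA; apply: reg_vA. Qed.

Lemma reg_x r k : base r -> (b + k < n)%N ->
  reg vA th (x r (b + k)) (th QA.1 * eta ^ node_content (tab r (b + k))).
Proof.
move=> hr hk; rewrite /x /cK /xK; have -> := @base_comp r (b + k) hr ltac:(lia).
apply: regM; first exact: reg_vA.
by apply: reg_exprz => //; apply: reg_q.
Qed.

Lemma eta_neq1 : eta != 1.
Proof.
apply/eqP => h; have := eta_exprz_congr 1 0; rewrite expr1z expr0z => H.
have [_ /(_ h)[z hz]] := H.
have ze : z * e%:Z = 1 by rewrite hz add0r.
have : (z <= 0) || (1 <= z) by lia.
by case/orP => hz'; clear - ze hz' he; nia.
Qed.

Lemma chi_eta : chi * chi = eta * eta ^ dsign sg.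
Proof.
rewrite /chi /dsign; case: (sg); last by rewrite expr1z.
by rewrite exprN1 divff // mulrNN mulr1.
Qed.

(* With at most two removable nodes the coefficient takes at most two values, so
   it is affine in the content; the point is that the slope has no pole at th. *)
Lemma acoef_linear k : (b + k.+1 < n)%N -> exists al ga g,
  [/\ reg vA th al chi, reg vA th ga g & forall r, base r ->
     (forall i, (b + k < i < n)%N -> tab r i = tab r0 i) ->
     acoef q (x r (b + k)) (x r (b + k.+1)) = al + ga * (x r (b + k) - x r0 (b + k))].
Proof.
move=> hk1; have hk : (b + k < n)%N by lia.
have hbk : (b <= b + k < n)%N by lia.
have hkk : (b + k < b + k.+1 < n)%N by lia.
set w := node_content (tab r0 (b + k.+1)).
set u := node_content (tab r0 (b + k)).
have etaw : eta ^ w = eta ^ (dsign sg * k.+1%:Z) by apply: eta_label_content.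
have etau : eta ^ u = eta ^ (dsign sg * k%:Z) by apply: eta_label_content.
have ewu : eta ^ w = eta ^ u * eta ^ dsign sg.
  rewrite etaw etau -expfzDr //; congr (_ ^ _).
  have -> : k.+1%:Z = k%:Z + 1 by lia.
  by rewrite mulrDr mulr1.
have eu0 : eta ^ u != 0 by rewrite expfz_neq0.
have dchi : eta ^ dsign sg != 1.
  rewrite /dsign; case: (sg); rewrite ?expr1z ?eta_neq1 // exprN1.
  by rewrite invr_eq1 eta_neq1.
have wu : th QA.1 * eta ^ w - th QA.1 * eta ^ u != 0.
  rewrite -mulrBr mulf_neq0 // ewu -[X in _ - X]mulr1 -mulrBr mulf_neq0 //.
  by rewrite subr_eq0.
have rA := reg_x base_r0 hk1; have rB := reg_x base_r0 hk; rewrite -/w -/u in rA rB.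
have regA1 y c : reg vA th y c -> th QA.1 * eta ^ w - c != 0 ->
    reg vA th (acoef q y (x r0 (b + k.+1))) ((eta - 1) * (th QA.1 * eta ^ w) / (th QA.1 * eta ^ w - c)).
  move=> ry cn; apply: regM; last first.
    by apply: (regV _); [apply: (regB vA_inj)|].
  apply: regM => //; apply: (regB vA_inj); [exact: reg_q|exact: reg1].
set al := acoef q (x r0 (b + k)) (x r0 (b + k.+1)).
(* The specialized contents of r0 at the two entries differ by the factor eta or its inverse, which
   makes the coefficient specialize to chi. *)
have ral : reg vA th al chi.
  have := regA1 _ _ rB wu; rewrite -/al.
  have key : (eta - 1) * eta ^ dsign sg = chi * (eta ^ dsign sg - 1).
    rewrite /chi /dsign; case: (sg); last by rewrite expr1z mulrC.
    by rewrite exprN1 mulrBl divff // mul1r mulN1r opprB.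
  have -> : (eta - 1) * (th QA.1 * eta ^ w) = chi * (th QA.1 * eta ^ w - th QA.1 * eta ^ u).
    rewrite ewu; transitivity (th QA.1 * eta ^ u * ((eta - 1) * eta ^ dsign sg)); first by ring.
    by rewrite key; ring.
  by rewrite mulfK.
have xr r : base r -> (forall i, (b + k < i < n)%N -> tab r i = tab r0 i) ->
    x r (b + k.+1) = x r0 (b + k.+1).
  by move=> hr Hl; rewrite /x /cK Hl.
have xB r s : base r -> base s -> node_content (tab r (b + k)) = node_content (tab s (b + k)) ->
    x r (b + k) = x s (b + k).
  move=> hr hs Ec; rewrite /x /cK /xK Ec.
  by rewrite !(base_comp _ hbk).
(* If all columns are full, only one node is removable: the coefficient is constant and the slope is
   0. *)
case: (eqVneq (k.+1 %% p)%N 0%N) => [k0|kn0].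
  exists al, 0, 0; split => //; first exact: reg0.
  move=> r hr Hl; rewrite mul0r addr0 xr // (xB r r0) //.
  by case: (removable_content hr hk Hl) => // -[]; rewrite k0.
set z1 := (k.+1 %/ p)%N%:Z - p%:Z.
set y1 := Q.1 * q ^ z1.
have ry1 : reg vA th y1 (th QA.1 * eta ^ z1).
  by apply: regM; [exact: reg_vA|apply: reg_exprz => //; apply: reg_q].
set m := (k.+1 %% p)%N in kn0.
have mE : (0 < m < p)%N by rewrite ltn_pmod // lt0n kn0.
have [sgE [pE me]] := height_gt1 mE.
have cE : node_content (tab r0 (b + k.+1)) = (k.+1 %/ p)%N%:Z - m%:Z.
  by rewrite tab_r0_comp1.
(* The specialized content of the other removable node differs from those of r0 at positions b + k +
   1 (c = 0) and b + k (c = -1); this excludes the poles. *)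
have ez (c : int) : 0 < m%:Z + 1 + c < e%:Z ->
    eta ^ z1 != eta ^ ((k.+1 %/ p)%N%:Z - m%:Z - c).
  by move=> hc; apply/eqP => /eta_exprz_congr; rewrite /z1 pE; apply: congr_gap.
have c0 : 0 < m%:Z + 1 + 0 < e%:Z by clear - me; lia.
have c1 : 0 < m%:Z + 1 + (-1) < e%:Z by clear - me mE; lia.
have wz : th QA.1 * eta ^ w - th QA.1 * eta ^ z1 != 0.
  rewrite -mulrBr mulf_neq0 // subr_eq0 eq_sym /w cE.
  by have := ez 0 c0; rewrite subr0.
have uz : th QA.1 * eta ^ z1 - th QA.1 * eta ^ u != 0.
  rewrite -mulrBr mulf_neq0 // subr_eq0.
  have -> : eta ^ u = eta ^ ((k.+1 %/ p)%N%:Z - m%:Z - (-1)).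
    have : eta ^ w = eta ^ u * eta ^ (-1) by rewrite ewu sgE.
    rewrite /w cE => E1; rewrite expfzDr // E1 -mulrA -expfzDr //.
    by rewrite addNr expr0z mulr1.
  exact: ez.
(* Affine interpolation between the two possible contents [x r0 (b + k)] and y1. *)
exists al, ((acoef q y1 (x r0 (b + k.+1)) - al) / (y1 - x r0 (b + k))).
exists (((eta - 1) * (th QA.1 * eta ^ w) / (th QA.1 * eta ^ w - th QA.1 * eta ^ z1) - chi) /
        (th QA.1 * eta ^ z1 - th QA.1 * eta ^ u)).
split => //.
  apply: regM; first by apply: (regB vA_inj) => //; apply: regA1.
  by apply: regV => //; apply: (regB vA_inj).
move=> r hr Hl; rewrite xr //; case: (removable_content hr hk Hl) => [Ec|[_ Ec]].
  by rewrite (xB r r0) // subrr mulr0 addr0.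
have -> : x r (b + k) = y1.
  by rewrite /x /cK /xK Ec /y1 (base_comp hr hbk).
rewrite divfK; first by rewrite addrC subrK.
have rd : reg vA th (y1 - x r0 (b + k)) (th QA.1 * eta ^ z1 - th QA.1 * eta ^ u).
  exact: (regB vA_inj).
apply/eqP => h0; rewrite h0 in rd.
by move/eqP: uz; apply; apply: (reg_uniq vA_inj rd); apply: reg0.
Qed.

Definition late (k : nat) (r : 'I_d) : Prop :=
  base r /\ forall i, (b + k < i < n)%N -> tab r i = tab r0 i.

Lemma supported_word (P : 'I_d -> Prop) l y :
  (forall i r, i.+1 \in l -> P r -> node_adm (tab r i) (tab r i.+1) -> P (tab_swap n tab i r)) ->
  all (fun m => 0 < m < n)%N l -> supported P y -> supported P (y *m wprod T l).
Proof.
elim: l y => [|m l IH] y H /=; first by rewrite wprod_nil mulmx1.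
move=> /andP[/andP[m0 mn] hl] Hy; rewrite wprod_cons mulmxA; apply: IH => //.
  by move=> i r il; apply: H; rewrite in_cons il orbT.
case: m m0 mn H => // i _ hi H; apply: supported_T => // r; apply: H.
by rewrite mem_head.
Qed.

Lemma swap_fix r i k : (i.+1 < n)%N -> node_adm (tab r i) (tab r i.+1) -> (k < n)%N ->
  k != i -> k != i.+1 -> tab (tab_swap n tab i r) k = tab r k.
Proof. by move=> hi ad kn k1 k2; rewrite (tab_swapE Htab) // transp_o. Qed.

Lemma base_swap r i : (b <= i)%N -> (i.+1 < n)%N -> node_adm (tab r i) (tab r i.+1) ->
  base r -> base (tab_swap n tab i r).
Proof.
move=> bi hi ad hr k kb.
have kn := leq_trans kb bn; have ki := leq_trans kb bi.
have k1 : k != i by rewrite ltn_eqF.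
have k2 : k != i.+1 by rewrite ltn_eqF // leqW.
by rewrite swap_fix // hr.
Qed.

Lemma late_swap k r i : (b <= i)%N -> (i.+1 <= b + k)%N -> (i.+1 < n)%N ->
  node_adm (tab r i) (tab r i.+1) -> late k r -> late k (tab_swap n tab i r).
Proof.
move=> bi ik hi ad [hr Hl]; split; first exact: base_swap.
move=> j /andP[j1 j2]; have ij := leq_ltn_trans ik j1.
have k1 : j != i by rewrite gtn_eqF // ltnW.
have k2 : j != i.+1 by rewrite gtn_eqF.
by rewrite swap_fix // Hl // j1.
Qed.

Lemma supportedD (P : 'I_d -> Prop) y y' : supported P y -> supported P y' -> supported P (y + y').
Proof.
move=> H H' r; rewrite mxE => h; case: (eqVneq (y 0 r) 0) => [y0|]; last exact: H.
by apply: H'; apply: contraNneq h => y0'; rewrite y0 y0' addr0.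
Qed.

Lemma supported_sum (P : 'I_d -> Prop) m (f : 'I_m -> 'rV[K]_d) :
  (forall j, supported P (f j)) -> supported P (\sum_j f j).
Proof.
move=> H; apply: (big_ind (supported P)) => // [r|]; last exact: supportedD.
by rewrite mxE eqxx.
Qed.

Lemma orbit_supported k y c : (b + k < n)%N \/ k = 0%N -> orbit_span k y c ->
  supported (late k) y.
Proof.
elim: k y c => [|k IH] y c hk.
  move=> [u [-> _]] r; rewrite !mxE eqxx /=; case: (eqVneq r r0) => [->|_]; last by rewrite mulr0 eqxx.
  by split.
have {}hk : (b + k.+1 < n)%N by case: hk.
have hk' : (b + k < n)%N by rewrite (leq_trans _ hk) // ltnS addnS ltnW.
move=> [f [g [H -> _]]]; apply: supported_sum => j.
apply: supported_word.
- move=> i r; rewrite mem_desc_word; last by have := ltn_ord j; rewrite addnS; clear; lia.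
  move=> hi hr ad; have jk := ltn_ord j.
  by apply: late_swap => //; clear - hi hk jk; lia.
- apply/allP => i; rewrite mem_desc_word; last by have := ltn_ord j; rewrite addnS; clear; lia.
  by clear - hk; lia.
move=> r hr; have [h1 h2] := IH _ _ (or_introl hk') (H j (ltn_ord j)) r hr.
by split=> // i /andP[h3 h4]; apply: h2; rewrite h4 andbT (leq_trans _ h3) // ltnS leq_add2l ltnW.
Qed.

Lemma row_sum (y : 'rV[K]_d) : y = \sum_r y 0 r *: E r.
Proof. exact: row_sum_delta. Qed.

(** Base tableaux all have the corner of the first component at position b, so the Jucys-Murphy
    element there is the scalar Q_1. Wrapping it in T_(b+1), ..., T_(b+k) gives the one at position
    b + k, up to a power of q; hence it preserves the orbit span up to a scalar. *)
Lemma jmd_comp1 k y : (b + k < n)%N -> supported base y ->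
  exists l, [/\ all (fun m => b < m <= b + k)%N l, size l = (k + k)%N &
    y *m jmd (b + k) = (q ^- k * Q.1) *: (y *m wprod T l)].
Proof.
elim: k y => [|k IH] y hk Hy.
  exists [::]; split => //; rewrite addn0 expr0 invr1 mul1r wprod_nil mulmx1.
  rewrite [in LHS](row_sum y) [in RHS](row_sum y) mulmx_suml scaler_sumr.
  apply: eq_bigr => r _; case: (eqVneq (y 0 r) 0) => [->|yr].
    by rewrite !scale0r mul0mx scaler0.
  rewrite -scalemxAl jmdE !scalerA mulrC; congr (_ * _ *: _).
  rewrite addn0 in hk.
  by rewrite /x /cK (base_first (Hy _ yr) hk) /xK /node_content /= subrr expr0z mulr1.
have hk1 : (b + k < n)%N by rewrite (leq_trans _ hk) // ltnS addnS ltnW.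
have hk2 : ((b + k).+1 < n)%N by rewrite -addnS.
have Hy' : supported base (y *m T (b + k).+1).
  by apply: supported_T => // r hr ad; apply: base_swap; rewrite ?leq_addr.
have [l [hl sl El]] := IH _ hk1 Hy'.
exists ((b + k).+1 :: rcons l (b + k).+1); split.
- rewrite /= all_rcons addnS leqnn andbT ltnS leq_addr /=.
  by apply: sub_all hl => m /andP[-> h] /=; rewrite leqW.
- by rewrite /= size_rcons sl; clear; lia.
have := T_jmd_T hk2 => ET.
have -> : jmd (b + k.+1) = q^-1 *: (T (b + k).+1 *m jmd (b + k) *m T (b + k).+1).
  by rewrite ET scalerA mulVf // scale1r addnS.
rewrite -scalemxAr !mulmxA El -scalemxAl wprod_cons wprod_rcons !mulmxA scalerA.
by rewrite exprS invfM mulrA.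
Qed.

(** Write a term as f T_m D with m = b + k + 1. After T_m, the swapped vectors cannot reach r0: they
    have the wrong node at position m, and D does not move it. So only [acoef] counts; it is al + ga
    (L - x r0), with L the Jucys-Murphy element at b + k, which [jmd_comp1] replaces by a word in
    smaller T_i, and the induction hypothesis applies to each term. The term with ga specializes to
    0, because the value of L is the residue of r0, and al specializes to chi. *)
Lemma orbit_reg k y c : (b + k < n)%N \/ k = 0%N -> orbit_span k y c -> reg vA th (y 0 r0) c.
Proof.
elim: k y c => [|k IH] y c hk.
  move=> [u [-> ->]]; rewrite !mxE !eqxx mulr1 -thiA; exact: reg_vA.
have {}hk : (b + k.+1 < n)%N by case: hk.
have hk' : (b + k < n)%N by rewrite (leq_trans _ hk) // ltnS addnS ltnW.
have {}IH y' c' : orbit_span k y' c' -> reg vA th (y' 0 r0) c' by apply: IH; left.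
move=> [f [g [H -> ->]]]; rewrite summxE; apply: (reg_sum vA_inj) => -[j hj] /=.
have Hj := H _ hj; have Sj := orbit_supported (or_introl hk') Hj.
case: j hj Hj Sj => [|j] hj Hj Sj /=.
  by rewrite wprod_nil mulmx1 mulr1; apply: IH.
move: (f j.+1) (g j.+1) Hj Sj => {H f g y c}f g Hf Sf.
have [al [ga [gg [ral rga Hac]]]] := acoef_linear hk.
rewrite addnS wprod_cons /=.
have hD : all (fun m => b < m <= b + k)%N (desc_word (b + k) j).
  apply/allP => i; rewrite mem_desc_word; clear - hj; lia.
set D := wprod T (desc_word (b + k) j).
have HfD : orbit_span k (f *m D) (g * chi ^+ j).
  have := orbit_span_word hk' hD Hf; rewrite size_desc_word; exact.
have [l [hl sl El]] := jmd_comp1 hk' (fun r hr => (Sf r hr).1).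
have HfL : orbit_span k (f *m wprod T l *m D) (g * chi ^+ (k + k) * chi ^+ j).
  rewrite -sl; have := orbit_span_word hk' hD (orbit_span_word hk' hl Hf).
  by rewrite size_desc_word.
have key r : f 0 r != 0 -> (E r *m (T (b + k).+1 *m D)) 0 r0 =
    (al + ga * (x r (b + k) - x r0 (b + k))) * (E r *m D) 0 r0.
  move=> fr; have [hr Hl] := Sf _ fr.
  rewrite mulmxA /T snKE mulmxDl -!scalemxAl mxE [X in X + _]mxE [X in _ + X]mxE.
  have := Hac r hr Hl; rewrite /x addnS => ->.
  rewrite -[RHS]addr0; congr (_ + _).
  rewrite /bcoef /cK (xK_adm Hgen); case: ifP => ad; last by rewrite mul0r.
  suff -> : (delta_mx 0 (tab_swap n tab (b + k) r) *m D) (0 : 'I_1) r0 = 0 by rewrite mulr0.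
  apply/eqP; apply: contraT => h.
  pose P s := tab s (b + k).+1 = tab r (b + k).
  have hk2 : ((b + k).+1 < n)%N by rewrite -addnS.
  have : supported P (delta_mx 0 (tab_swap n tab (b + k) r) *m D).
    apply: supported_word.
    - move=> i s; rewrite mem_desc_word; last by clear - hj; lia.
      move=> hi Ps ads; rewrite /P swap_fix //; clear - hi hk2; lia.
    - apply/allP => i /(allP hD); clear - hk'; lia.
    move=> s; rewrite mxE eqxx /=; case: (eqVneq s) => [-> _|_]; last by rewrite eqxx.
    by rewrite /P (tab_swapE Htab) // transp_r.
  move=> /(_ _ h); rewrite /P.
  have hl2 : (b + k < (b + k).+1 < n)%N by rewrite ltnSn.
  rewrite -(Hl _ hl2); have [inj _ _ _] := tab_std Htab r.
  by move/(inj _ _ hk2 hk'); clear; lia.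
have -> : (f *m (T (b + k).+1 *m D)) 0 r0 =
    al * (f *m D) 0 r0 + ga * (((q ^- k * Q.1) *: (f *m wprod T l *m D)) 0 r0 - x r0 (b + k) * (f *m D) 0 r0).
  have lin (M : 'M[K]_d) : (f *m M) 0 r0 = \sum_r f 0 r * (E r *m M) 0 r0.
    by rewrite {1}(row_sum f) mulmx_suml summxE; apply: eq_bigr => r _; rewrite -scalemxAl mxE.
  rewrite scalemxAl -El -mulmxA !lin.
  rewrite 2!mulr_sumr -sumrB mulr_sumr -big_split; apply: eq_bigr => r _ /=.
  case: (eqVneq (f 0 r) 0) => [->|fr]; first by rewrite !(mul0r, mulr0) subrr mulr0 addr0.
  have jE : (E r *m (jmd (b + k) *m D)) 0 r0 = x r (b + k) * (E r *m D) 0 r0.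
    by rewrite mulmxA jmdE -scalemxAl mxE.
  by rewrite key // jE; ring.
have -> : g * chi ^+ j.+1 = chi * (g * chi ^+ j) + gg *
   ((eta ^- k * th QA.1) * (g * chi ^+ (k + k) * chi ^+ j) -
     th QA.1 * eta ^ node_content (tab r0 (b + k)) * (g * chi ^+ j)).
  have -> : eta ^ node_content (tab r0 (b + k)) = eta ^- k * chi ^+ (k + k).
    rewrite eta_label_content // exprD -exprMn chi_eta exprMn mulrA mulVf ?expf_neq0 // mul1r.
    by rewrite -exprz_exp -exprnP.
  by rewrite exprS; ring.
apply: (regD vA_inj); first by apply: regM => //; apply: IH.
apply: regM => //; apply: (regB vA_inj).
  rewrite mxE; apply: regM; last exact: IH.
  apply: regM; last exact: reg_vA.
  by apply: regV; [apply: regX; exact: reg_q|rewrite expf_neq0].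
by apply: regM; [apply: reg_x|apply: IH].
Qed.

Notation iKm := (vA \o iA).

Lemma iK_neq0 u : u != 0 -> iK u != 0.
Proof.
move=> u0; rewrite -(rmorph0 vA) (inj_eq vA_inj) -(rmorph0 iA) (inj_eq iA_inj).
exact: u0.
Qed.

(** The subfield C(q) of K, in which Q_1 and Q_2 do not occur. *)
Definition ratp (y : K) : Prop := exists u w : {poly C}, w != 0 /\ y = iK u / iK w.

Lemma ratpM y y' : ratp y -> ratp y' -> ratp (y * y').
Proof.
move=> [u [w [w0 ->]]] [u' [w' [w0' ->]]]; exists (u * u'), (w * w').
by rewrite mulf_neq0 // !rmorphM mulf_div.
Qed.

Lemma ratpB y y' : ratp y -> ratp y' -> ratp (y - y').
Proof.
move=> [u [w [w0 ->]]] [u' [w' [w0' ->]]]; exists (u * w' - u' * w), (w * w').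
by rewrite mulf_neq0 // -mulNr addf_div ?iK_neq0 // !(rmorphB, rmorphM) mulNr.
Qed.

Lemma ratpV y : ratp y -> ratp y^-1.
Proof.
move=> [u [w [w0 ->]]]; rewrite invf_div.
case: (eqVneq u 0) => [->|u0]; last by exists w, u.
by exists 0, 1; rewrite oner_eq0 !rmorph0 invr0 mulr0 mul0r.
Qed.

Lemma ratp_iK u : ratp (iK u).
Proof. by exists u, 1; rewrite oner_eq0 !rmorph1 divr1. Qed.

Lemma ratp_q (z : int) : ratp (q ^ z).
Proof.
have rX k : ratp (q ^+ k) by rewrite -iAX -!rmorphXn; apply: ratp_iK.
by case: z => k; rewrite ?NegzE -?exprnN -?exprnP; [|apply: ratpV].
Qed.

Let Q1n0 : Q.1 != 0. Proof. exact: (vA_neq0 vA_inj thQ1). Qed.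

(** From position b on, contents are Q_1 times a power of q, and the coefficients are homogeneous of
    degree zero in the contents; so Q_1 cancels. *)
Lemma ratp_coef r i : base r -> (b <= i)%N -> (i.+1 < n)%N ->
  ratp (acoef q (x r i) (x r i.+1)) /\ ratp (bcoef q (x r i) (x r i.+1)).
Proof.
move=> hr bi hi.
have xE k : (b <= k < n)%N -> x r k = Q.1 * q ^ node_content (tab r k).
  by move=> hk; rewrite /x /cK /xK (base_comp hr hk).
have h1 : (b <= i < n)%N by rewrite bi ltnW.
have h2 : (b <= i.+1 < n)%N by rewrite leqW.
rewrite !xE //; move: (node_content _) (node_content _) => u w.
have rq : ratp (q - 1) by apply: ratpB; [have := ratp_q 1|have := ratp_q 0].
have rr (u' w' : int) : ratp (q * q ^ w' - q ^ u').
  by apply: ratpB; [apply: ratpM; [have := ratp_q 1|]|]; try exact: ratp_q.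
have rd (u' w' : int) : ratp (q ^ w' - q ^ u') by apply: ratpB; apply: ratp_q.
split.
  rewrite /acoef -mulrBr [q - 1]lock mulrCA -lock invfM mulrACA divff // mul1r.
  by apply: ratpM; [apply: ratpM => //; apply: ratp_q|apply: ratpV].
rewrite /bcoef; case: ifP => _; last by have := ratp_iK 0; rewrite !rmorph0.
rewrite mulrCA -!mulrBr invfM mulrACA divff // mul1r.
by apply: ratpM => //; apply: ratpV.
Qed.

Definition in_base (r : 'I_d) : bool := [forall k : 'I_n, (k < b)%N ==> (tab r k == tab r0 k)].

Lemma in_baseP r : reflect (base r) (in_base r).
Proof.
apply: (iffP forallP) => [H k kb|H k].
  have kn := leq_trans kb bn.
  by have /implyP /(_ kb) /eqP := H (Ordinal kn).
by apply/implyP => kb; apply/eqP/H.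
Qed.

Notation d0 := #|in_base|.

Definition bs (i : 'I_d0) : 'I_d := enum_val i.

Lemma bs_base i : base (bs i). Proof. exact/in_baseP/(enum_valP i). Qed.

Lemma bs_onto r : base r -> exists i, bs i = r.
Proof. by move/in_baseP => hr; exists (enum_rank_in hr r); rewrite /bs enum_rankK_in. Qed.

Definition Bs : 'M[K]_(d0, d) := \matrix_(i, j) (bs i == j)%:R.

Lemma row_Bs i : row i Bs = E (bs i).
Proof. by apply/rowP => j; rewrite !mxE eqxx eq_sym. Qed.

(** D is a common denominator for the coordinates of y on the base tableaux. *)
Definition polyvec (D : {poly C}) (y : 'rV[K]_d) : Prop :=
  exists u : 'rV[{poly C}]_d0, iK D *: y = map_mx iKm u *m Bs.

Lemma polyvec_mull D D' y : polyvec D y -> polyvec (D' * D) y.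
Proof.
move=> [u Hu]; exists (D' *: u).
by rewrite !rmorphM -scalerA Hu scalemxAl map_mxZ.
Qed.

Lemma polyvec0 D : polyvec D 0.
Proof. by exists 0; rewrite scaler0 map_mx0 mul0mx. Qed.

Lemma polyvecD D y y' : polyvec D y -> polyvec D y' -> polyvec D (y + y').
Proof.
by move=> [u Hu] [u' Hu']; exists (u + u'); rewrite scalerDr Hu Hu' map_mxD mulmxDl.
Qed.

Lemma polyvecZ D a y : polyvec D y -> polyvec D (iK a *: y).
Proof.
move=> [u Hu]; exists (a *: u).
by rewrite scalerA mulrC -scalerA Hu scalemxAl map_mxZ.
Qed.

Lemma polyvec_sum D (I : finType) (f : I -> 'rV[K]_d) :
  (forall i, polyvec D (f i)) -> polyvec D (\sum_i f i).
Proof. by move=> H; apply: (big_ind (polyvec D)) => //; [apply: polyvec0|apply: polyvecD]. Qed.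

Lemma polyvec_rat y r : ratp y -> base r -> exists D, D != 0 /\ polyvec D (y *: E r).
Proof.
move=> [u [w [w0 ->]]] /bs_onto[i <-]; exists w; split=> //.
exists (u *: delta_mx 0 i); rewrite map_mxZ map_delta_mx -scalemxAl -rowE row_Bs scalerA.
by rewrite mulrC divfK // iK_neq0.
Qed.

Lemma common_multiple (I : finType) (P : I -> {poly C} -> Prop) :
  (forall i D D', P i D -> P i (D' * D)) -> (forall i, exists D, D != 0 /\ P i D) ->
  exists D, D != 0 /\ forall i, P i D.
Proof.
move=> mono ex; have [D HD] := choice ex.
exists (\prod_i D i); split; first by apply/prodf_neq0 => i _; case: (HD i).
move=> i; rewrite (bigD1 i) //= mulrC; apply: mono.
by case: (HD i).
Qed.

Lemma T_denominator : exists D, D != 0 /\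
  forall i m, (b < m < n)%N -> polyvec D (E (bs i) *m T m).
Proof.
have [|[i m]|D [D0 H]] := @common_multiple ('I_d0 * 'I_n)%type
  (fun im D => (b < im.2)%N -> polyvec D (E (bs im.1) *m T im.2)).
- by move=> i D D' H h; apply: polyvec_mull; apply: H.
- case: m => -[|m] hm /=; first by exists 1; split; [exact: oner_neq0|].
  case: (ltnP b m.+1) => bm; last by exists 1; split; [exact: oner_neq0|].
  have hr := bs_base i; have [ra rb] := ratp_coef hr bm hm.
  have [D1 [D10 H1]] := polyvec_rat ra hr.
  have [D2 [D20 H2]] : exists D, D != 0 /\
      polyvec D (bcoef q (x (bs i) m) (x (bs i) m.+1) *: E (tab_swap n tab m (bs i))).
    case: (boolP (node_adm (tab (bs i) m) (tab (bs i) m.+1))) => ad.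
      by apply: polyvec_rat => //; apply: base_swap.
    exists 1; split; first exact: oner_neq0.
    by rewrite /bcoef /x /cK (xK_adm Hgen) (negbTE ad) scale0r; apply: polyvec0.
  exists (D1 * D2); split; first by rewrite mulf_neq0.
  move=> _; rewrite /T snKE; apply: polyvecD; last exact: polyvec_mull.
  by rewrite mulrC; apply: polyvec_mull.
- exists D; split=> // i m /andP[bm mn].
  exact: (H (i, Ordinal mn)).
Qed.

Lemma polyvec_T DT D y m : (forall i m, (b < m < n)%N -> polyvec DT (E (bs i) *m T m)) ->
  (b < m < n)%N -> polyvec D y -> polyvec (DT * D) (y *m T m).
Proof.
move=> HD hm [u Hu].
suff : polyvec DT (iK D *: (y *m T m)).
  by move=> [v Hv]; exists v; rewrite !rmorphM -scalerA.
rewrite scalemxAl Hu -mulmxA.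
have -> : map_mx iKm u *m (Bs *m T m) = \sum_i iK (u 0 i) *: (E (bs i) *m T m).
  rewrite {1}[map_mx _ u]row_sum_delta mulmx_suml; apply: eq_bigr => i _.
  by rewrite mxE -scalemxAl mulmxA -rowE row_Bs.
by apply: polyvec_sum => i; apply: polyvecZ; apply: HD.
Qed.

Lemma polyvec_word DT D y l : (forall i m, (b < m < n)%N -> polyvec DT (E (bs i) *m T m)) ->
  all (fun m => b < m < n)%N l -> polyvec D y -> polyvec (DT ^+ size l * D) (y *m wprod T l).
Proof.
move=> HD; elim: l D y => [|m l IH] D y /=; first by rewrite wprod_nil mulmx1 mul1r.
move=> /andP[hm hl] Hy; rewrite wprod_cons mulmxA exprSr -mulrA.
by apply: IH => //; apply: polyvec_T.
Qed.

(** A single denominator for the whole span embeds it into a free C[q]-module of finite rank, as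
    [poly_lattice_basis] requires. *)
Lemma orbit_denominator k : (b + k < n)%N \/ k = 0%N ->
  exists D, D != 0 /\ forall y c, orbit_span k y c -> polyvec D y.
Proof.
have [DT [DT0 HDT]] := T_denominator.
elim: k => [|k IH] hk.
  exists 1; split; first exact: oner_neq0.
  move=> y c [u [-> _]]; apply: polyvecZ; have [i <-] := bs_onto base_r0.
  by exists (delta_mx 0 i); rewrite !rmorph1 scale1r map_delta_mx -rowE row_Bs.
have {}hk : (b + k.+1 < n)%N by case: hk.
have hk' : (b + k < n)%N by rewrite (leq_trans _ hk) // ltnS addnS ltnW.
have [D [D0 HD]] := IH (or_introl hk').
(* Each letter of a descending word costs a factor [DT], and these words have fewer than k + 2
   letters. *)
exists (DT ^+ k.+2 * D); split; first by rewrite mulf_neq0 // expf_neq0.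
move=> y c [f [g [H -> _]]]; apply: polyvec_sum => j.
have h := polyvec_word HDT _ (HD _ _ (H j (ltn_ord j))).
have := h (desc_word (b + k.+1) j); rewrite size_desc_word.
have -> : DT ^+ k.+2 = DT ^+ (k.+2 - j) * DT ^+ j.
  by rewrite -exprD subnK // ltnW.
rewrite -mulrA => h'; apply: polyvec_mull; apply: h'.
apply/allP => i; rewrite mem_desc_word; have := ltn_ord j; clear - hk; lia.
Qed.

Lemma orbit_start k : orbit_span k (E r0) 1.
Proof.
elim: k => [|k IH]; first by exists 1; rewrite !rmorph1 scale1r hornerC.
have := @orbit_span_desc k 0 _ _ (ltn0Sn _) IH.
by rewrite /= wprod_nil mulmx1 mulr1.
Qed.

(** The T_i with b < i < n are those with b < i <= b + kk; for b = n there are none, and kk = 0. *)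
Let kk := (n - b).-1.

Let kk_ok : (b + kk < n)%N \/ kk = 0%N.
Proof. by rewrite /kk; clear - bn; lia. Qed.

(** T_(i+1) applied to a basis vector, minus a multiple of this vector, gives the swapped one up to
    a nonzero factor; with denominators cleared this stays in the span, and connectivity reaches all
    base tableaux. So the lattice has full rank. *)
Lemma orbit_full r : base r -> exists u c, u != 0 /\ orbit_span kk (iK u *: E r) c.
Proof.
move=> hr; pose P r := base r -> exists u c, u != 0 /\ orbit_span kk (iK u *: E r) c.
suff : P r by apply.
have sc := @swap_connected _ _ _ _ la1 la2 Htab b P.
apply: (sc _ r0); last first.
- by move=> _; exists 1, 1; rewrite oner_eq0 !rmorph1 scale1r; split; [|apply: orbit_start].
- by move=> k kb kn; rewrite hr.
move=> s i bi hi ad Ps hs'.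
have ad' : node_adm (tab (tab_swap n tab i s) i) (tab (tab_swap n tab i s) i.+1).
  rewrite !(tab_swapE Htab) // ?(ltnW hi) // transp_l transp_r.
  by move: ad; rewrite /node_adm eq_sym orbC.
have hs : base s by rewrite -(tab_swapK la1 la2 Htab hi ad); apply: base_swap.
have [u [c [u0 Hu]]] := Ps hs.
have [[u1 [w1 [w10 E1]]] [u2 [w2 [w20 E2]]]] := ratp_coef hs bi hi.
have u20 : u2 != 0.
  apply/eqP => u20; have := bcK_neq0 Hgen la1 la2 Htab hi ad.
  by rewrite -/(x s i) -/(x s i.+1) E2 u20 !rmorph0 mul0r eqxx.
have hm : (b < i.+1 <= b + kk)%N by rewrite /kk; clear - bi hi; lia.
have hbk : (b + kk < n)%N by rewrite /kk; clear - bi hi; lia.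
have HT1 := orbit_span_T hbk hm Hu.
have H1 := orbit_spanZ (w1 * w2) HT1.
have H2 := orbit_spanZ (- (w2 * u1)) Hu.
have := orbit_spanD H1 H2.
set c' := (_ + _ in X in orbit_span _ _ X -> _).
have -> : iK (w1 * w2) *: (iK u *: E s *m T i.+1) + iK (- (w2 * u1)) *: (iK u *: E s) =
    iK (u * w1 * u2) *: E (tab_swap n tab i s).
  rewrite -scalemxAl /T snKE -/(x s i) -/(x s i.+1) E1 E2.
  have w1n := iK_neq0 w10; have w2n := iK_neq0 w20.
  rewrite !rmorphN !rmorphM.
  apply/rowP => j; rewrite !mxE.
  by field; rewrite w1n w2n.
by move=> H; exists (u * w1 * u2), c'; split=> //; rewrite !mulf_neq0.
Qed.

Lemma orbit_lattice : exists (Zm : 'M[K]_(d0, d)) (ga : 'cV[C]_d0),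
  [/\ forall m, (b < m < n)%N -> exists X : 'M[A]_d0,
        Zm *m T m = map_mx vA X *m Zm /\ map_mx th X *m ga = chi *: ga,
      forall i, supported base (row i Zm),
      forall r, base r -> (E r <= Zm)%MS
    & ga != 0].
Proof.
have [D [D0 HD]] := orbit_denominator kk_ok.
have iD0 := iK_neq0 D0.
pose L u := exists c, orbit_span kk ((iK D)^-1 *: (map_mx iKm u *m Bs)) c.
have [uf Huf] := choice (fun i => orbit_full (bs_base i)).
pose M0 : 'M[{poly C}]_d0 := diag_mx (\row_i (D * uf i)).
have [||||P [LP dP HP]] := @poly_lattice_basis C d0 L M0.
- move=> u u' [c Hc] [c' Hc']; exists (c + c').
  by rewrite map_mxD mulmxDl scalerDr; apply: orbit_spanD.
- move=> v u [c Hc]; exists (v.[eta] * c).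
  by rewrite map_mxZ -scalemxAl scalerA mulrC -scalerA; apply: orbit_spanZ.
- move=> i; have [c [_ Hc]] := Huf i; exists c.
  have -> : row i M0 = (D * uf i) *: delta_mx 0 i.
    apply/rowP => j; rewrite !mxE eqxx /= [j == i]eq_sym.
    by case: (eqVneq i j) => [->|_]; rewrite ?mulr1n ?mulr1 ?mulr0n ?mulr0.
  rewrite map_mxZ map_delta_mx -scalemxAl -rowE row_Bs scalerA /= !rmorphM mulKf //.
- rewrite det_diag; apply/prodf_neq0 => i _; rewrite mxE mulf_neq0 //.
  by have [c []] := Huf i.
pose Zm : 'M[K]_(d0, d) := (iK D)^-1 *: (map_mx iKm P *m Bs).
have rowZ i : row i Zm = (iK D)^-1 *: (map_mx iKm (row i P) *m Bs).
  by rewrite /Zm linearZ /= row_mul map_row.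
have mulZ v : (iK D)^-1 *: (map_mx iKm (v *m P) *m Bs) = map_mx iKm v *m Zm.
  by rewrite map_mxM /Zm -scalemxAr mulmxA.
clearbody Zm; have [cf Hcf] := choice LP.
have Hrow i : orbit_span kk (row i Zm) (cf i) by rewrite rowZ.
pose ga : 'cV[C]_d0 := \col_i cf i.
(* By uniqueness of regular values, c is a linear form in the coordinates of y, whatever
   presentation of y produced it. *)
have key y c : orbit_span kk y c -> exists v : 'rV[{poly C}]_d0,
    y = map_mx iKm v *m Zm /\ c = (map_mx (fun p : {poly C} => p.[eta]) v *m ga) 0 0.
  move=> Hy; have [u Hu] := HD _ _ Hy.
  have yE : y = (iK D)^-1 *: (map_mx iKm u *m Bs).
    by rewrite -Hu scalerA mulVf // scale1r.
  have [|v Hv] := HP u; first by exists c; rewrite -yE.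
  have yZ : y = map_mx iKm v *m Zm.
    by rewrite yE Hv mulZ.
  exists v; split=> //.
  apply: (reg_uniq vA_inj (orbit_reg kk_ok Hy)).
  rewrite yZ !mxE; apply: (reg_sum vA_inj) => i; rewrite !mxE.
  apply: regM; first by rewrite -thiA; apply: reg_vA.
  by have := orbit_reg kk_ok (Hrow i); rewrite mxE.
exists Zm, ga; split.
- move=> m hm.
  have hm' : (b < m <= b + kk)%N by rewrite /kk; clear - hm; lia.
  have hbk : (b + kk < n)%N by rewrite /kk; clear - hm; lia.
  have [X HX] := choice (fun i => key _ _ (orbit_span_T hbk hm' (Hrow i))).
  exists (\matrix_(i, j) iA (X i 0 j)); split.
    apply/row_matrixP => i; rewrite !row_mul; have [-> _] := HX i.
    by congr (_ *m _); apply/rowP => j; rewrite !mxE.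
  apply/matrixP => i j; rewrite [j]ord1 mxE [RHS]mxE mulrC.
  have [_] := HX i; rewrite [ga i 0]mxE => ->; rewrite mxE.
  by apply: eq_bigr => l _; rewrite !mxE thiA.
- move=> i r hr; exact: (orbit_supported kk_ok (Hrow i) hr).1.
- move=> r hr; have [u [c [u0 Hu]]] := orbit_full hr.
  have [v [Ev _]] := key _ _ Hu.
  rewrite -[E r]scale1r -(mulVf (iK_neq0 u0)) -scalerA Ev.
  by rewrite scalemx_sub // submxMl.
- apply/eqP => g0; have [v [_]] := key _ _ (orbit_start kk).
  by rewrite g0 mulmx0 mxE => /eqP; rewrite oner_eq0.
Qed.

Variable c0 : bool.
Hypothesis hc0 : (0 < b)%N -> c0 = true.
Hypothesis hQ : (b < n)%N -> th (component QA c0) * eta ^ (dsign sg * b%:Z) = th QA.1.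

Definition jm_value (k : nat) : C := th (component QA c0) * eta ^ (dsign sg * k%:Z).

Lemma jm_valueS k : jm_value k.+1 = jm_value k * eta ^ dsign sg.
Proof.
rewrite /jm_value -mulrA -expfzDr //; congr (_ * _ ^ _).
have -> : k.+1%:Z = k%:Z + 1 by clear; lia.
by rewrite mulrDr mulr1.
Qed.

Lemma chi_jm_value k : chi * jm_value k + (eta - 1) * jm_value k.+1 = chi * jm_value k.+1.
Proof.
rewrite jm_valueS /chi /dsign; case: (sg).
  by rewrite exprN1; field.
by rewrite expr1z; ring.
Qed.

Definition chiA : A := if sg then -1 else qA.

Lemma th_chiA : th chiA = chi.
Proof. by rewrite /chiA /chi; case: (sg); rewrite ?rmorphN ?rmorph1 // th_qA. Qed.

Lemma chi_neq0 : chi != 0.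
Proof. by rewrite /chi; case: (sg); rewrite ?oppr_eq0 ?oner_eq0. Qed.

Lemma q_neq1 : q != 1.
Proof.
apply/eqP => h; have [_ /(_ false false 1 0)] := Hgen.
by rewrite expr1z expr0z h => /(_ erefl)[].
Qed.

(** Neighbours in a line cannot be swapped, and [acoef] is q or -1 when the contents differ by a
    factor q. *)
Lemma T_line r m : base r -> (0 < m < b)%N -> E r *m T m = vA chiA *: E r.
Proof.
case: m => // m hr /andP[_ mb]; rewrite /T snKE.
have mn : (m.+1 < n)%N by apply: leq_trans bn.
rewrite /bcoef -/(x r m) -/(x r m.+1).
have x0 : x r m.+1 != 0 /\ x r m != 0.
  have thQ k : (k < b)%N -> x r k != 0.
    move=> kb; rewrite /x /cK (base_line hr kb) /xK mulf_neq0 ?expfz_neq0 //.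
    have -> : (line_node sg k).2 = true by rewrite /line_node; case: (sg).
    apply/eqP => /= h; have [_ /(_ true true 0 1)] := Hgen.
    by rewrite /= h !mul0r => /(_ erefl)[].
  by rewrite !thQ // ltnW.
have q1 : q - 1 != 0 by rewrite subr_eq0 q_neq1.
have q1' : 1 - q != 0 by rewrite subr_eq0 eq_sym q_neq1.
have H : if sg then x r m = q * x r m.+1 else x r m.+1 = q * x r m.
  rewrite /x /cK !(base_line hr) // ?(ltnW mb) // /xK.
  rewrite /line_node /node_content; case: (sg) => /=; rewrite mulrCA; congr (_ * _).
    have := @expfzDr _ q 1 (0%:Z - m.+1%:Z) q0; rewrite expr1z => <-.
    by congr (_ ^ _); clear; lia.
  have := @expfzDr _ q 1 (m%:Z - 0%:Z) q0; rewrite expr1z => <-.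
  by congr (_ ^ _); clear; lia.
have ad : adm q (x r m) (x r m.+1) = false.
  by move: H; rewrite /adm; case: (sg) => ->; rewrite eqxx ?andbF.
rewrite ad scale0r addr0; congr (_ *: _); rewrite /chiA /acoef; case: x0 H => xa xb.
case: (sg) => H.
  have d1 : x r m.+1 - q * x r m.+1 != 0 by rewrite -{1}[x r m.+1]mul1r -mulrBl mulf_neq0.
  by rewrite rmorphN rmorph1 H; field.
have d1 : q * x r m - x r m != 0 by rewrite -{2}[x r m]mul1r -mulrBl mulf_neq0.
by rewrite H; field.
Qed.

(** * Inducing the lattice by shuffles *)

Section WordLattice.

Variables (Zm : 'M[K]_(d0, d)) (ga : 'cV[C]_d0).
Hypothesis ZT : forall m, (b < m < n)%N -> exists X : 'M[A]_d0,
  Zm *m T m = map_mx vA X *m Zm /\ map_mx th X *m ga = chi *: ga.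
Hypothesis Zbase : forall i, supported base (row i Zm).
Hypothesis Zfull : forall r, base r -> (E r <= Zm)%MS.
Hypothesis ga0 : ga != 0.

Lemma supported_mul M a (y : 'rV[K]_d) : (forall r, base r -> E r *m M = a *: E r) ->
  supported base y -> y *m M = a *: y.
Proof.
move=> H Hy; rewrite [in LHS](row_sum y) [in RHS](row_sum y) mulmx_suml scaler_sumr.
apply: eq_bigr => r _; case: (eqVneq (y 0 r) 0) => [->|yr].
  by rewrite !scale0r mul0mx scaler0.
by rewrite -scalemxAl H ?scalerA 1?mulrC //; exact: Hy.
Qed.

Lemma Zm_mul M a : (forall r, base r -> E r *m M = a *: E r) -> Zm *m M = a *: Zm.
Proof.
move=> H; apply/row_matrixP => i; rewrite row_mul linearZ /=.
exact: supported_mul.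
Qed.

Definition in_Z (z : 'rV[K]_d) (g : C) : Prop :=
  exists c : 'rV[A]_d0, z = map_mx vA c *m Zm /\ g = (map_mx th c *m ga) 0 0.

Lemma in_ZZ a z g : in_Z z g -> in_Z (vA a *: z) (th a * g).
Proof.
move=> [c [-> ->]]; exists (a *: c).
by rewrite !map_mxZ -!scalemxAl; split=> //; rewrite [RHS]mxE.
Qed.

Lemma in_Z_row i : in_Z (row i Zm) (ga i 0).
Proof.
exists (delta_mx 0 i); rewrite !map_delta_mx -!rowE; split=> //.
by rewrite mxE.
Qed.

Lemma in_Z_T z g m : (0 < m < n)%N -> m != b -> in_Z z g -> in_Z (z *m T m) (chi * g).
Proof.
move=> /andP[m0 mn] mb [c [-> ->]].
have [X [HX HX']] : exists X : 'M[A]_d0,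
    Zm *m T m = map_mx vA X *m Zm /\ map_mx th X *m ga = chi *: ga.
  case: (ltngtP m b) mb => // lt _; last by apply: ZT; rewrite lt.
  exists chiA%:M; rewrite !map_scalar_mx !mul_scalar_mx th_chiA; split=> //.
  by apply: Zm_mul => r hr; apply: T_line => //; rewrite m0.
exists (c *m X); rewrite !map_mxM -!mulmxA HX HX'; split=> //.
by rewrite -scalemxAr [RHS]mxE.
Qed.

Lemma thqAi : th qAi = eta^-1.
Proof.
have := congr1 th qAV; rewrite rmorphM rmorph1 th_qA => h.
by apply: (mulfI eta0); rewrite h divff.
Qed.

Lemma vAqAi : vA qAi = q^-1.
Proof. by apply: (mulfI q0); rewrite -rmorphM qAV rmorph1 divff. Qed.

(** Each Jucys-Murphy element is q^-1 T L T for the previous one L, and T_m with m <> b preserves Z.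
    The recursion would need T_b only at k = b, where all base tableaux have the corner of the first
    component and the operator is the scalar Q_1. *)
Lemma in_Z_jm z g k : (k < n)%N -> in_Z z g -> in_Z (z *m jmd k) (jm_value k * g).
Proof.
have scalar c0' i : (i < n)%N -> (forall r, base r -> x r i = vA (component QA c0')) ->
    forall z' g', in_Z z' g' -> in_Z (z' *m jmd i) (th (component QA c0') * g').
  move=> hi H z' g' [c [-> ->]].
  have -> : map_mx vA c *m Zm *m jmd i = vA (component QA c0') *: (map_mx vA c *m Zm).
    rewrite -mulmxA (@Zm_mul (jmd i) (vA (component QA c0'))) ?scalemxAr //.
    by move=> r hr; rewrite jmdE H.
  by apply: in_ZZ; exists c.
elim: k z g => [|k IH] z g kn Hz.
  have -> : jm_value 0 = th (component QA c0) by rewrite /jm_value mulr0 expr0z mulr1.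
  case: (posnP b) => b0.
    have bn' : (b < n)%N by rewrite b0.
    have -> : th (component QA c0) = th (component QA false).
      by rewrite /= -(hQ bn') b0 mulr0 expr0z mulr1.
    apply: scalar => // r hr; have := base_first hr bn'; rewrite b0 /x /cK => ->.
    by rewrite /xK /node_content /= subrr expr0z mulr1.
  rewrite (hc0 b0); apply: scalar => // r hr; rewrite /x /cK (base_line hr b0) /xK.
  by rewrite /line_node /node_content; case: (sg); rewrite /= subrr expr0z mulr1.
case: (eqVneq k.+1 b) => [kb|kb].
  have bn' : (b < n)%N by rewrite -kb.
  have -> : jm_value k.+1 = th (component QA false) by rewrite /jm_value kb (hQ bn').
  apply: scalar => // r hr; rewrite kb /x /cK (base_first hr bn').
  by rewrite /xK /node_content /= subrr expr0z mulr1.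
have -> : z *m jmd k.+1 = vA qAi *: (z *m T k.+1 *m jmd k *m T k.+1).
  have -> : jmd k.+1 = q^-1 *: (T k.+1 *m jmd k *m T k.+1).
    by rewrite T_jmd_T // scalerA mulVf // scale1r.
  by rewrite vAqAi -scalemxAr !mulmxA.
have -> : jm_value k.+1 * g = th qAi * (chi * (jm_value k * (chi * g))).
  rewrite jm_valueS thqAi; transitivity (jm_value k * (eta^-1 * (chi * chi)) * g); last by ring.
  by rewrite chi_eta mulKf.
apply: in_ZZ; apply: in_Z_T => //; apply: IH; first exact: ltnW.
by apply: in_Z_T.
Qed.

Definition words : Type := {v : n.-tuple bool | count id v == b}.

Notation J := ('I_d0 * words)%type.

(* The words of the minimal representatives of the cosets of S_b x S_(n-b) in S_n. *)
Definition wordw (w : words) : seq nat := shuffle_word (val (val w)).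

Definition lat_vec (j : J) : 'rV[K]_d := row j.1 Zm *m wprod T (wordw j.2).

Definition lat_val (j : J) : C := chi ^+ size (wordw j.2) * ga j.1 0.

Definition in_L (y : 'rV[K]_d) (g : C) : Prop :=
  exists c : J -> A, y = \sum_j vA (c j) *: lat_vec j /\ g = \sum_j th (c j) * lat_val j.

Lemma in_LD y g y' g' : in_L y g -> in_L y' g' -> in_L (y + y') (g + g').
Proof.
move=> [c [-> ->]] [c' [-> ->]]; exists (fun j => c j + c' j).
by split; rewrite -big_split; apply: eq_bigr => j _; rewrite rmorphD (scalerDl, mulrDl).
Qed.

Lemma in_LZ a y g : in_L y g -> in_L (vA a *: y) (th a * g).
Proof.
move=> [c [-> ->]]; exists (fun j => a * c j).
split; first by rewrite scaler_sumr; apply: eq_bigr => j _; rewrite rmorphM scalerA.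
by rewrite mulr_sumr; apply: eq_bigr => j _; rewrite rmorphM mulrA.
Qed.

Lemma in_L0 : in_L 0 0.
Proof.
exists (fun=> 0); split; rewrite big1 // => j _; rewrite rmorph0 ?scale0r ?mul0r //.
Qed.

Lemma in_L_sum (I : finType) (f : I -> 'rV[K]_d) (g : I -> C) :
  (forall i, in_L (f i) (g i)) -> in_L (\sum_i f i) (\sum_i g i).
Proof.
move=> H; elim: (index_enum I) => [|i s IH]; first by rewrite !big_nil; apply: in_L0.
by rewrite !big_cons; apply: in_LD.
Qed.

Lemma in_L_vec j : in_L (lat_vec j) (lat_val j).
Proof.
exists (fun j' => (j' == j)%:R); split.
  rewrite (bigD1 j) //= eqxx rmorph1 scale1r big1 ?addr0 // => j' /negbTE ->.
  by rewrite rmorph0 scale0r.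
rewrite (bigD1 j) //= eqxx rmorph1 mul1r big1 ?addr0 // => j' /negbTE ->.
by rewrite rmorph0 mul0r.
Qed.

Lemma in_L_word z g (w : words) : in_Z z g ->
  in_L (z *m wprod T (wordw w)) (chi ^+ size (wordw w) * g).
Proof.
move=> [c [-> ->]].
have -> : map_mx vA c *m Zm *m wprod T (wordw w) = \sum_i vA (c 0 i) *: lat_vec (i, w).
  rewrite {1}[map_mx _ c]row_sum_delta !mulmx_suml; apply: eq_bigr => i _.
  by rewrite mxE -!scalemxAl -rowE.
have -> : chi ^+ size (wordw w) * (map_mx th c *m ga) 0 0 = \sum_i th (c 0 i) * lat_val (i, w).
  rewrite mxE mulr_sumr; apply: eq_bigr => i _; rewrite mxE /lat_val /=.
  by rewrite mulrCA.
by apply: in_L_sum => i; apply: in_LZ; apply: in_L_vec.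
Qed.

Lemma in_L_seq z g (v : seq bool) : size v = n -> count id v = b -> in_Z z g ->
  in_L (z *m wprod T (shuffle_word v)) (chi ^+ size (shuffle_word v) * g).
Proof.
move=> /eqP sv /eqP cv Hz.
have := @in_L_word z g (exist _ (Tuple sv) cv) Hz.
by rewrite /wordw.
Qed.

Lemma split_word (v : seq bool) m : (0 < m < size v)%N ->
  exists u y y' v', v = u ++ y :: y' :: v' /\ (size v').+1 = m.
Proof.
move=> hm; set k := (size v - m.+1)%N.
have hk : (k.+1 < size v)%N by rewrite /k; clear - hm; lia.
exists (take k v), (nth false v k), (nth false v k.+1), (drop k.+2 v); split.
  by rewrite -!drop_nth ?cat_take_drop // ltnW.
by rewrite size_drop /k; clear - hm; lia.
Qed.

(** By Deodhar's lemma, T_m either passes to the left of the shuffle and acts on Z as some T_i with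
    i <> b, or changes the shuffle into another one, through the quadratic relation if the length
    drops. *)
Lemma in_L_T y g m : (0 < m < n)%N -> in_L y g -> in_L (y *m T m) (chi * g).
Proof.
move=> hm [c [-> ->]]; rewrite mulmx_suml mulr_sumr.
apply: in_L_sum => -[i [v hv]]; rewrite -scalemxAl mulrCA; apply: in_LZ.
rewrite /lat_vec /lat_val /= /wordw /=.
have sv := size_tuple v; move: (tval v) sv (eqP hv) => {hv v c} v sv cv.
have hz := in_Z_row i; move: (row i Zm) (ga i 0) hz => z h hz.
have hm' : (0 < m < size v)%N by rewrite sv.
have [u [a [a' [v' [vE sE]]]]] := split_word hm'.
have [HQ _ _] := HT; have cu := count_size id u; have cv' := count_size id v'.
rewrite -mulmxA -sE.
have svn : (size v <= n)%N by rewrite sv.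
rewrite vE in sv cv svn *.
case: a sv cv svn {vE hm'} => [|]; case: a' => [|] sv cv svn.
- rewrite (shuffle_same_true HT svn) mulmxA mulrCA.
  apply: in_L_seq => //; apply: in_Z_T => //.
    by move: cv sv; rewrite count_cat size_cat /=; clear - bn cu cv'; lia.
  by move: cv sv; rewrite count_cat size_cat /=; clear - bn cu cv'; lia.
- have svn' : (size (u ++ [:: false, true & v']) <= n)%N by move: svn; rewrite !size_cat.
  have [E1 E2] := shuffle_swap HT svn'.
  rewrite -E1 E2 -[wprod _ _ *m T _ *m T _]mulmxA HQ ?sE // mulmxDr mul_mx_scalar -scalemxAr.
  rewrite -sE E1 mulmxDr -!scalemxAr.
  have -> : chi * (chi ^+ (size (shuffle_word (u ++ [:: false, true & v']))).+1 * h) =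
      th (qA - 1) * (chi ^+ (size (shuffle_word (u ++ [:: false, true & v']))).+1 * h) +
      th qA * (chi ^+ (size (shuffle_word (u ++ [:: false, true & v']))) * h).
    rewrite rmorphB rmorph1 th_qA exprS.
    set l := chi ^+ _; transitivity (l * h * (chi * chi)); first by ring.
    by rewrite chi_quad; ring.
  have -> : q - 1 = vA (qA - 1) by rewrite rmorphB rmorph1.
  apply: in_LD; apply: in_LZ.
    rewrite -E2; apply: in_L_seq => //.
  apply: in_L_seq => //; first by move: sv; rewrite !size_cat.
  by move: cv; rewrite !count_cat.
- have [E1 E2] := shuffle_swap HT svn.
  rewrite E1 mulrA -exprS -E2; apply: in_L_seq => //; first by move: sv; rewrite !size_cat.
  by move: cv; rewrite !count_cat.
- rewrite (shuffle_same_false HT svn) mulmxA mulrCA.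
  apply: in_L_seq => //; apply: in_Z_T => //.
    by move: cv sv; rewrite !count_cat size_cat /=; clear - bn cu cv'; lia.
  by move: cv sv; rewrite !count_cat size_cat /=; clear - bn cu cv'; lia.
Qed.

(** This and the next two lemmas are the Bernstein relations between the T_i and the Jucys-Murphy
    elements. *)
Lemma T_jmd_same i : (i.+1 < n)%N ->
  T i.+1 *m jmd i.+1 = jmd i *m T i.+1 + (q - 1) *: jmd i.+1.
Proof.
move=> hi; apply: row_matrixE => r.
rewrite mulmxDr !mulmxA jmdE -scalemxAr -scalemxAl jmdE /T snKE mulmxDl -!scalemxAl !jmdE.
have ne : x r i.+1 - x r i != 0.
  rewrite subr_eq0 eq_sym; apply: (cK_near Hgen la1 la2 Htab) => //; clear; lia.
have -> : bcoef q (cK q Q tab r i) (cK q Q tab r i.+1) *: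
    (x (tab_swap n tab i r) i.+1 *: E (tab_swap n tab i r)) =
    (bcoef q (x r i) (x r i.+1) * x r i) *: E (tab_swap n tab i r).
  rewrite scalerA /bcoef /x /cK; case: ifP => ad; last by rewrite !mul0r.
  by rewrite (tab_swapE Htab) ?transp_r -?(xK_adm Hgen).
rewrite -/(x r i) -/(x r i.+1); move: (bcoef _ _ _) => B.
rewrite /acoef; apply/rowP => j; rewrite !mxE.
by field.
Qed.

Lemma T_jmd_pred i : (i.+1 < n)%N ->
  T i.+1 *m jmd i = jmd i.+1 *m T i.+1 - (q - 1) *: jmd i.+1.
Proof.
move=> hi; apply: row_matrixE => r.
rewrite mulmxBr !mulmxA jmdE -scalemxAr -scalemxAl jmdE /T snKE mulmxDl -!scalemxAl !jmdE.
have ne : x r i.+1 - x r i != 0.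
  rewrite subr_eq0 eq_sym; apply: (cK_near Hgen la1 la2 Htab) => //; clear; lia.
have -> : bcoef q (cK q Q tab r i) (cK q Q tab r i.+1) *:
    (x (tab_swap n tab i r) i *: E (tab_swap n tab i r)) =
    (bcoef q (x r i) (x r i.+1) * x r i.+1) *: E (tab_swap n tab i r).
  rewrite scalerA /bcoef /x /cK; case: ifP => ad; last by rewrite !mul0r.
  by rewrite (tab_swapE Htab) ?transp_l -?(xK_adm Hgen) ?(ltnW hi).
rewrite -/(x r i) -/(x r i.+1); move: (bcoef _ _ _) => B.
rewrite /acoef; apply/rowP => j; rewrite !mxE.
by field.
Qed.

Lemma T_jmd_comm i k : (i.+1 < n)%N -> (k < n)%N -> k != i -> k != i.+1 ->
  T i.+1 *m jmd k = jmd k *m T i.+1.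
Proof.
move=> hi kn k1 k2; apply: row_matrixE => r.
rewrite !mulmxA jmdE -scalemxAl /T snKE mulmxDl -!scalemxAl !jmdE scalerDr.
congr (_ + _); first by rewrite !scalerA mulrC.
rewrite /bcoef /x /cK; case: ifP => ad; last by rewrite !scale0r scaler0.
by rewrite (tab_swapE Htab) -?(xK_adm Hgen) // transp_o // !scalerA mulrC.
Qed.

Definition base_word : seq bool := nseq (n - b) false ++ nseq b true.

Lemma size_base_word : size base_word = n.
Proof. by rewrite size_cat !size_nseq subnK. Qed.

Lemma count_base_word : count id base_word = b.
Proof. by rewrite count_cat !count_nseq /= mul0n mul1n. Qed.

Lemma shuffle_base_word : shuffle_word base_word = [::].
Proof.
rewrite /base_word; elim: (n - b)%N => //=.
suff H m : shuffle_word (nseq m true) = [::] by [].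
by elim: m => //= m ->; rewrite cats0 count_nseq size_nseq mul1n subnn.
Qed.

(** Meant for T_0 = L_1, which cannot be moved through the shuffles by itself: the Bernstein
    relations carry it leftwards, producing other Jucys-Murphy elements on the way, until each meets
    Z. Hence the statement for all k at once. *)
Lemma in_L_jm l z g k : all (fun m => 0 < m < n)%N l -> in_Z z g -> (k < n)%N ->
  in_L (z *m wprod T l *m jmd k) (chi ^+ size l * (jm_value k * g)).
Proof.
elim/last_ind: l k => [|l i IH] k.
  move=> _ Hz kn; rewrite wprod_nil mulmx1 mul1r.
  have := in_L_seq size_base_word count_base_word (in_Z_jm kn Hz).
  by rewrite shuffle_base_word wprod_nil mulmx1 mul1r.
rewrite all_rcons => /andP[/andP[i0 hi] hl] Hz kn.
rewrite wprod_rcons size_rcons exprSr; case: i i0 hi => // i _ hi.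
have hi1 : (0 < i.+1 < n)%N by [].
have q1 : q - 1 = vA (qA - 1) by rewrite rmorphB rmorph1.
have e1 : eta - 1 = th (qA - 1) by rewrite rmorphB rmorph1 th_qA.
have cj := chi_jm_value i.
case: (eqVneq k i.+1) => [->|k1].
  have -> : z *m (wprod T l *m T i.+1) *m jmd i.+1 =
      z *m wprod T l *m jmd i *m T i.+1 + vA (qA - 1) *: (z *m wprod T l *m jmd i.+1).
    by rewrite mulmxA -[LHS]mulmxA T_jmd_same // mulmxDr mulmxA -scalemxAr -q1.
  have -> : chi ^+ size l * chi * (jm_value i.+1 * g) =
      chi * (chi ^+ size l * (jm_value i * g)) +
      th (qA - 1) * (chi ^+ size l * (jm_value i.+1 * g)).
    rewrite -e1; transitivity (chi ^+ size l * (chi * jm_value i.+1) * g); first by ring.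
    by rewrite -cj; ring.
  apply: in_LD; first by apply: in_L_T => //; apply: IH => //; exact: ltnW.
  by apply: in_LZ; apply: IH.
case: (eqVneq k i) => [->|k2].
  have -> : z *m (wprod T l *m T i.+1) *m jmd i =
      z *m wprod T l *m jmd i.+1 *m T i.+1 + vA (1 - qA) *: (z *m wprod T l *m jmd i.+1).
    rewrite mulmxA -[LHS]mulmxA T_jmd_pred // mulmxBr mulmxA -scalemxAr.
    by congr (_ + _); rewrite -scaleNr opprB rmorphB rmorph1.
  have -> : chi ^+ size l * chi * (jm_value i * g) =
      chi * (chi ^+ size l * (jm_value i.+1 * g)) +
      th (1 - qA) * (chi ^+ size l * (jm_value i.+1 * g)).
    rewrite rmorphB rmorph1 th_qA.
    transitivity (chi ^+ size l * (chi * jm_value i.+1 - (eta - 1) * jm_value i.+1) * g); last by ring.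
    by rewrite -cj; ring.
  apply: in_LD; first by apply: in_L_T => //; apply: IH.
  by apply: in_LZ; apply: IH.
have -> : z *m (wprod T l *m T i.+1) *m jmd k = z *m wprod T l *m jmd k *m T i.+1.
  by rewrite mulmxA -[LHS]mulmxA T_jmd_comm // mulmxA.
have -> : chi ^+ size l * chi * (jm_value k * g) = chi * (chi ^+ size l * (jm_value k * g)).
  by ring.
by apply: in_L_T => //; apply: IH.
Qed.

Lemma wordw_lt (w : words) : all (fun m => 0 < m < n)%N (wordw w).
Proof. by have := shuffle_word_lt (val (val w)); rewrite size_tuple. Qed.

Lemma in_L_T0 y g : (0 < n)%N -> in_L y g -> in_L (y *m T 0) (jm_value 0 * g).
Proof.
move=> n0 [c [-> ->]]; rewrite mulmx_suml mulr_sumr.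
rewrite T_0; apply: in_L_sum => -[i w]; rewrite -scalemxAl mulrCA; apply: in_LZ.
rewrite /lat_vec /lat_val [(i, w).1]/= [(i, w).2]/= mulrCA.
by apply: in_L_jm => //; [exact: wordw_lt|exact: in_Z_row].
Qed.

Definition chis (i : nat) : C := if i is 0%N then jm_value 0 else chi.

Lemma in_L_gen y g i : (i < n)%N -> in_L y g -> in_L (y *m T i) (chis i * g).
Proof. by case: i => [|i] hi; [apply: in_L_T0|apply: in_L_T]. Qed.

Definition lat_mx : 'M[K]_(#|{: J}|, d) := \matrix_(j < #|{: J}|) lat_vec (enum_val j).

Lemma in_L_sub y g : in_L y g -> (y <= lat_mx)%MS.
Proof.
move=> [c [-> _]]; apply: summx_sub => j _; apply: scalemx_sub.
have -> : lat_vec j = row (enum_rank j) lat_mx by rewrite rowK enum_rankK.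
exact: row_sub.
Qed.

(** Over K the span is a nonzero submodule of a simple module. *)
Lemma lat_full : (0 < n)%N -> row_full lat_mx.
Proof.
move=> n0.
have d_gt0 : (0 < d)%N by case: (r0) => ? h; apply: leq_ltn_trans h.
have [_ Hs] := snK_simple Hgen la1 la2 Htab n0 d_gt0.
have [|/eqP E0|full] := Hs (genmx lat_mx).
- move=> i; rewrite (eqmx_stable _ (genmxE _)); apply/row_subP => j.
  rewrite row_mul rowK; apply: in_L_sub (chis i * lat_val (enum_val j)) _.
  by apply: in_L_gen => //; apply: in_L_vec.
- have h : (E r0 <= lat_mx)%MS.
    apply: submx_trans (Zfull base_r0) _; apply/row_subP => i.
    have := in_L_seq size_base_word count_base_word (in_Z_row i).
    by rewrite shuffle_base_word wprod_nil mulmx1; apply: in_L_sub.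
  have : (E r0 <= (0 : 'M[K]_d))%MS by rewrite -E0 genmxE.
  rewrite submx0 => /eqP /rowP /(_ r0); rewrite !mxE !eqxx => /eqP.
  by rewrite oner_eq0.
- by rewrite /row_full -mxrank_gen; exact: full.
Qed.

(** A base tableau and a word give a tableau by unshuffling, and both can be recovered from it, the
    word being read off from the components of the entries. *)
Lemma card_lat_le : (#|{: J}| <= d)%N.
Proof.
pose w (j : J) := nth false (rev (val (val j.2))).
have wn j : count (w j) (iota 0 n) = b.
  by rewrite -[in iota 0 n](size_tuple (val j.2)) count_nth_rev; apply/eqP/(valP j.2).
have comp i k : (k < n)%N -> (tab (bs i) k).2 = (k < b)%N.
  move=> kn; case: (ltnP k b) => kb; last by apply: base_comp (bs_base i) _; rewrite kb.
  by rewrite (base_line (bs_base i) kb) /line_node; case: (sg).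
have ex j : exists r, forall k, (k < n)%N -> tab r k = tab (bs j.1) (unshuffle b (w j) k).
  by apply: (tab_surj Htab); apply: std_unshuffle (tab_std Htab _) (comp _); apply: wn.
have [f Hf] := choice ex.
rewrite -[X in (_ <= X)%N]card_ord; apply: (@leq_card _ _ f) => -[i v] [i' v'] Ef.
have Ew k : (k < n)%N -> w (i, v) k = w (i', v') k.
  move=> kn; have := Hf (i, v) _ kn; rewrite Ef Hf // => /(congr1 (fun x => x.2)).
  rewrite !comp ?(unshuffle_lt (wn _)) //.
  by rewrite !(unshuffle_comp (wn _)).
have Ev : v = v'.
  apply: val_inj; apply: val_inj; apply: (can_inj revK).
  apply: (@eq_from_nth _ false) => [|k]; rewrite size_rev size_tuple ?size_rev ?size_tuple //.
  exact: Ew.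
congr (_, _) => //; apply: enum_val_inj; apply: (tab_inj Htab) => k kn.
have [k' k'n k'E] := unshuffle_onto (wn (i, v)) kn.
have := Hf (i, v) _ k'n; rewrite Ef Hf //= k'E -Ev.
by rewrite -[unshuffle _ _ k']/(unshuffle b (w (i, v)) k') k'E.
Qed.

(** As many vectors as the dimension, and they span: the shuffled vectors form a basis, so their
    A-span is free. *)
Lemma card_lat : (0 < n)%N -> #|{: J}| = d.
Proof.
move=> n0; apply/eqP; rewrite eqn_leq card_lat_le /=.
by move: (rank_leq_row lat_mx); rewrite (eqP (lat_full n0)).
Qed.

End WordLattice.

Lemma integral_form : (0 < n)%N ->
  exists (TA : nat -> 'M[A]_d) (B : 'M[K]_d) (Ga : 'cV[C]_d),
    [/\ B \in unitmx,
        forall i, (i < n)%N -> B *m T i = map_mx vA (TA i) *m B,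
        forall i, (i < n)%N -> map_mx th (TA i) *m Ga = chis i *: Ga
      & Ga != 0].
Proof.
move=> n0; have [Zm [ga [ZT Zbase Zfull ga0]]] := orbit_lattice.
have cJ := card_lat ZT Zbase Zfull n0.
pose J := ('I_d0 * words)%type.
pose en (i : 'I_d) : J := enum_val (cast_ord (esym cJ) i).
have en_inj : injective en by move=> i j /enum_val_inj /cast_ord_inj.
pose rk (j : J) : 'I_d := cast_ord cJ (enum_rank j).
have enK i : rk (en i) = i by rewrite /rk /en enum_valK cast_ordKV.
have rkK j : en (rk j) = j by rewrite /rk /en cast_ordK enum_rankK.
pose B : 'M[K]_d := \matrix_i lat_vec Zm (en i).
pose Ga : 'cV[C]_d := \col_i lat_val ga (en i).
have ex (ii : 'I_n * 'I_d) : exists c : J -> A,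
    row ii.2 B *m T ii.1 = \sum_j vA (c j) *: lat_vec Zm j /\
    chis ii.1 * lat_val ga (en ii.2) = \sum_j th (c j) * lat_val ga j.
  by rewrite rowK; apply: (in_L_gen ZT Zbase) => //; apply: in_L_vec.
have [cf Hcf] := choice ex.
pose TA (k : nat) : 'M[A]_d :=
  if insub k is Some k' then \matrix_(i, j) cf (k', i) (en j) else 0.
have TAE (k : 'I_n) : TA k = \matrix_(i, j) cf (k, i) (en j) by rewrite /TA valK.
exists TA, B, Ga; split.
- rewrite -row_full_unit; have := lat_full ZT Zbase Zfull n0; rewrite -!sub1mx => h.
  apply: submx_trans h _; apply/row_subP => j.
  have -> : row j (lat_mx Zm) = row (cast_ord cJ j) B by rewrite !rowK /en cast_ordK.
  exact: row_sub.
- move=> k kn; rewrite (TAE (Ordinal kn)); apply/row_matrixP => i.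
  have [/= h _] := Hcf (Ordinal kn, i).
  rewrite row_mul h.
  rewrite row_mul [row i (map_mx _ _)]row_sum_delta mulmx_suml.
  rewrite (reindex en) /=; last by exists rk => j _.
  by apply: eq_bigr => j _; rewrite -scalemxAl -rowE rowK !mxE.
- move=> k kn; rewrite (TAE (Ordinal kn)); apply/matrixP => i j.
  rewrite [j]ord1 [RHS]mxE [Ga i 0]mxE.
  have [/= _ ->] := Hcf (Ordinal kn, i).
  rewrite mxE (reindex en) /=; last by exists rk => l _.
  by apply: eq_bigr => l _; rewrite !mxE.
- have [i gi] : exists i, ga i 0 != 0.
    apply: contrapT => H; move/eqP: ga0; apply; apply/matrixP => i j; rewrite [j]ord1 mxE.
    by apply/eqP/negPn/negP => h; apply: H; exists i.
  have cb : count id (tval (in_tuple base_word)) == b by rewrite count_base_word.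
  have sb : size base_word == n by rewrite size_base_word.
  have cb' : count id (Tuple sb) == b by rewrite /= count_base_word.
  pose j0 : J := (i, exist _ (Tuple sb) cb').
  apply/eqP => /matrixP /(_ (rk j0) 0); rewrite !mxE rkK /lat_val /= => /eqP.
  by rewrite mulf_eq0 (negbTE gi) orbF expf_eq0 (negbTE chi_neq0) andbF.
Qed.

End Lattice.

(** * Transport to the integral form *)

Section Conjugation.

Variables (K : fieldType) (n d : nat) (B : 'M[K]_d).
Hypothesis HB : B \in unitmx.

Lemma hecke_module_conj q Q (T M : 'I_n -> 'M[K]_d) :
  (forall i, B *m T i = M i *m B) -> hecke_module q Q T -> hecke_module q Q M.
Proof.
move=> E [h1 h2 h3 h4 h5].
have ME i : M i = B *m T i *m invmx B by rewrite E mulmxK.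
have MX X Y : B *m X *m invmx B *m (B *m Y *m invmx B) = B *m (X *m Y) *m invmx B.
  by rewrite !mulmxA mulmxKV.
have MB i a : M i - a%:M = B *m (T i - a%:M) *m invmx B.
  by rewrite ME mulmxBr mulmxBl mul_mx_scalar -scalemxAl mulmxV // scalemx1.
have MD i a : M i + a%:M = B *m (T i + a%:M) *m invmx B.
  by rewrite ME mulmxDr mulmxDl mul_mx_scalar -scalemxAl mulmxV // scalemx1.
split=> *.
- by rewrite !MB MX h1 // mulmx0 mul0mx.
- by rewrite MB MD MX h2 // mulmx0 mul0mx.
- by rewrite !ME !MX h3.
- by rewrite !ME !MX h4.
- by rewrite !ME !MX h5.
Qed.

Lemma simple_module_conj (T M : 'I_n -> 'M[K]_d) :
  (forall i, B *m T i = M i *m B) -> simple_module T -> simple_module M.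
Proof.
move=> E [d0 H]; split=> // U hU.
have [|/eqP E0|full] := H (U *m B).
- move=> i; rewrite -mulmxA E mulmxA; apply: submxMr; exact: hU.
- left; move/(congr1 (mulmx^~ (invmx B))): E0.
  by rewrite mulmxK // mul0mx => ->.
- right; have : (row_full (U *m B *m invmx B)).
    by rewrite /row_full mxrankMfree ?row_free_unit ?unitmx_inv.
  by rewrite mulmxK.
Qed.

Lemma wprod_conj (T M : nat -> 'M[K]_d) l : (forall i, (i < n)%N -> B *m T i = M i *m B) ->
  all (fun i => i < n)%N l -> B *m wprod T l = wprod M l *m B.
Proof.
move=> E; elim/last_ind: l => [|l i IH]; first by rewrite !wprod_nil mulmx1 mul1mx.
rewrite all_rcons => /andP[hi hl]; rewrite !wprod_rcons mulmxA IH //.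
by rewrite -!mulmxA E.
Qed.

End Conjugation.

Lemma hecke_module_map_inj (A : comNzRingType) (K : fieldType) (vA : {rmorphism A -> K})
    n d (q : A) (Q : A * A) (T : 'I_n -> 'M[A]_d) : injective vA ->
  hecke_module (vA q) (vA Q.1, vA Q.2) (fun i => map_mx vA (T i)) -> hecke_module q Q T.
Proof.
move=> vA_inj [h1 h2 h3 h4 h5].
have inj (X Y : 'M[A]_d) : map_mx vA X = map_mx vA Y -> X = Y.
  by move=> /matrixP E; apply/matrixP => i j; apply: vA_inj; have := E i j; rewrite !mxE.
split=> *; apply: inj; rewrite !map_mxM ?map_mx0.
- by rewrite !map_mxB !map_scalar_mx; apply: h1.
- by rewrite !map_mxB !map_mxD !map_scalar_mx rmorph1; apply: h2.
- exact: h3.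
- exact: h4.
- exact: h5.
Qed.

(** * The label over an abstract base ring *)

Section Integral.

Variables (K C : fieldType) (A : comNzRingType).
Variables (vA : {rmorphism A -> K}) (th : {rmorphism A -> C}).
Variables (qA : A) (QA : A * A).
Hypothesis vA_inj : injective vA.

Notation q := (vA qA).
Notation Q := (vA QA.1, vA QA.2).

Hypothesis Hgen : generic_params q Q.
Variable n : nat.
Hypothesis n0 : (0 < n)%N.

Let q0 : q != 0. Proof. by case: Hgen. Qed.

Section SeminormalForm.

Variables (d : nat) (la : bipart) (tab : 'I_d -> nat -> node).
Hypotheses (la1 : is_part la.1) (la2 : is_part la.2) (Htab : tableaux n la tab) (d0 : (0 < d)%N).
Variables (TA : nat -> 'M[A]_d) (B : 'M[K]_d).
Hypothesis HB : B \in unitmx.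
Hypothesis HT : forall i, (i < n)%N -> B *m snK q Q n tab i = map_mx vA (TA i) *m B.

Lemma integral_form_eigen r k : (k < n)%N ->
  row r (invmx B) *m wprod (fun i => map_mx vA (TA i)) (jm_word k) =
  (q ^+ k * xK q Q (tab r k)) *: row r (invmx B).
Proof.
move=> kn; rewrite -[X in _ *m X](mulmxK HB) -(wprod_conj HT) ?jm_word_lt //.
rewrite mulmxA -row_mul mulmxA mulVmx // mul1mx rowE.
by rewrite (snK_jm Hgen la1 la2 Htab) // -scalemxAl -rowE.
Qed.

Lemma integral_form_hecke : hecke_module qA QA (fun i : 'I_n => TA i).
Proof.
apply: (hecke_module_map_inj vA_inj); apply: (hecke_module_conj HB _ (snK_hecke Hgen la1 la2 Htab)).
by move=> i; apply: HT.
Qed.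

Lemma integral_form_KV : is_KV (fun i : 'I_n => map_mx vA (TA i)) q Q la.
Proof.
have HT' (i : 'I_n) : B *m snK q Q n tab i = map_mx vA (TA i) *m B by apply: HT.
split.
- by apply: (hecke_module_conj HB HT'); apply: (snK_hecke Hgen la1 la2 Htab).
- by apply: (simple_module_conj HB HT'); apply: (snK_simple Hgen la1 la2 Htab).
exists (fun r => [ffun k : 'I_n => tab r k]), (invmx B).
have [t1 t2 t3] := Htab.
have tE r k : (k < n)%N -> nd [ffun k : 'I_n => tab r k] k = tab r k.
  by move=> kn; rewrite -[k]/(val (Ordinal kn)) ndE ffunE.
split; rewrite ?unitmx_inv //.
- by move=> r r' E; apply: t2 => k kn; rewrite -!tE // E.
- move=> u; rewrite standardE; split=> [/t3[r Hr]|[r <-]].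
    by exists r; apply/ffunP => k; rewrite ffunE Hr ?ndE.
  by apply: std_ext (t1 r) => k kn; rewrite tE.
- move=> r k; rewrite ffunE; have := @integral_form_eigen r k (ltn_ord k).
  case: (tab r k) => [[a b] c]; rewrite /xK /node_content /= => E.
  rewrite (jucys_murphyE (fun i => map_mx vA (TA i))) -scalemxAr E scalerA.
  by rewrite mulKf // expf_neq0.
Qed.

End SeminormalForm.

Section Eigenbasis.

Variables (d : nat) (mu : bipart) (T : 'I_n -> 'M[A]_d).
Hypotheses (mu1 : is_part mu.1) (mu2 : is_part mu.2).
Hypothesis HKV : is_KV (fun i => map_mx vA (T i)) q Q mu.

Lemma KV_subquotient_residues (chi : nat -> C) (U W : 'M[C]_d) :
  (forall i, stablemx W (map_mx th (T i))) ->
  subquotient_iso (fun i => map_mx th (T i)) U W (fun i => (chi i)%:M : 'M[C]_1) ->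
  exists2 f, std n mu f & forall k, (k < n)%N -> th (cA qA QA (f k) k) = chiw chi (jm_word k).
Proof.
move=> HW Hiso; have [_ _ [t [B [t1 t2 HB eig]]]] := HKV.
pose T' k : 'M[A]_d := if insub k is Some i then T i else 0.
have TE (i : 'I_n) : T' i = T i by rewrite /T' valK.
have TE' (D : Type) (g : A -> D) : (fun i : 'I_n => map_mx g (T i)) = (fun i => map_mx g (T' i)).
  by apply/funext => i; rewrite TE.
have st r : std n mu (nd (t r)) by apply/standardE/t2; exists r.
have heig r k : (k < n)%N ->
    row r B *m wprod (fun i => map_mx vA (T' i)) (jm_word k) =
    (q ^+ k * xK q Q (nd (t r) k)) *: row r B.
  move=> kn; have := eig r (Ordinal kn); rewrite -(ndE (t r)) /=.
  case: (nd (t r) k) => [[a b] c]; rewrite TE' (jucys_murphyE (fun i => map_mx vA (T' i))) /=.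
  rewrite -scalemxAr => /(congr1 (fun X => q ^+ k *: X)).
  by rewrite !scalerA divff ?expf_neq0 // scale1r.
have HW' i : (i < n)%N -> stablemx W (map_mx th (T' i)).
  by move=> kn; have := HW (Ordinal kn); rewrite -TE.
rewrite TE' in Hiso.
have [r Hr] := subquotient_residues vA_inj q0 mu1 mu2 st HB heig HW' Hiso.
by exists (nd (t r)).
Qed.

End Eigenbasis.

Section Label.

Variables (iA : {rmorphism {poly C} -> A}) (eta : C) (qAi : A) (e : nat).
Hypothesis iA_inj : injective iA.
Hypothesis thiA : forall p, th (iA p) = p.[eta].
Hypothesis iAX : iA 'X = qA.
Hypothesis qAV : qA * qAi = 1.
Hypotheses (he : (2 <= e)%N) (heta : e.-primitive_root eta).

Variable s : int * int.
Hypotheses (hs : s.2 < s.1) (thQ : forall c, th (component QA c) = eta ^ component s c).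

Variables (sg : bool) (b : nat) (c0 : bool).
Let p := height sg e.
Hypothesis bn : (b <= n)%N.
Hypothesis hc0 : (0 < b)%N -> c0 = true.
Hypothesis hb : (b < e)%N.
Hypothesis hres : forall k, (k < b)%N -> ~ congr_mod e s.1 (s.2 + dsign sg * k%:Z).
Hypothesis hres' : (b < n)%N -> congr_mod e (component s c0 + dsign sg * b%:Z) s.1.
Hypothesis hgap : b%:Z <= p%:Z * (s.1 - s.2).
Variable v : rat * rat.
Hypothesis hv : v.1 < v.2.

Let eta0 : eta != 0. Proof. exact: eta_neq0 he heta. Qed.
Let p0 : (0 < p)%N. Proof. exact: height_gt0. Qed.

Definition line_character (i : nat) : C :=
  if i is 0%N then eta ^ component s c0 else if sg then -1 else eta.

Let th_qA : th qA = eta. Proof. by rewrite -iAX thiA hornerX. Qed.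

Lemma line_character_jm k :
  chiw line_character (jm_word k) = eta ^ (component s c0 + k%:Z + dsign sg * k%:Z).
Proof.
have E : \prod_(j <- iota 1 k) line_character j = chi eta sg ^+ k.
  rewrite big_seq_cond (eq_bigr (fun=> chi eta sg)) => [|[|j]]; last 2 first.
  - by rewrite mem_iota.
  - by [].
  by rewrite -big_seq_cond big_const_seq count_predT size_iota -iter_mulr_1.
rewrite /chiw /jm_word big_cat big_cons /= (perm_big (iota 1 k)) ?perm_rev //= E.
rewrite mulrCA -exprMn (chi_eta he heta) exprMn !exprnP expfzDr // expfzDr //.
by rewrite -mulrA exprz_exp.
Qed.

Lemma residues_congr mu f : is_part mu.1 -> is_part mu.2 -> std n mu f ->
  (forall k, (k < n)%N -> th (cA qA QA (f k) k) = chiw line_character (jm_word k)) ->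
  forall k, (k < n)%N -> congr_mod e (content s (f k)) (component s c0 + dsign sg * k%:Z).
Proof.
move=> mu1 mu2 Hf H k kn; have := H k kn; rewrite line_character_jm /cA rmorphM rmorphXn /=.
case fk: (f k) => [[x y] c] /=; have xk := std_bound0 mu1 mu2 Hf kn fk.
rewrite th_qA thQ exprnP -expfzDr // => /(eta_exprz_congr he heta)[z Hz].
by exists z; rewrite /content /=; lia.
Qed.

(** The integral form is arbitrary here, as [is_label] quantifies over all of them; only the
    eigenbasis over K provided by [is_KV] enters. *)
Lemma subquotient_dominated mu d (T : 'I_n -> 'M[A]_d) k :
  is_part mu.1 -> is_part mu.2 -> is_KV (fun i => map_mx vA (T i)) q Q mu ->
  comp_mult (fun i => map_mx th (T i)) (fun i => (line_character i)%:M : 'M[C]_1) k ->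
  k <> 0%N -> bip_le (charge s v) mu (label_shape sg p b n).
Proof.
move=> mu1 mu2 HKV [Us HUs ->] /eqP; rewrite -lt0n -has_count => hs'.
have [i + /asboolP Hiso] := hasP hs'; rewrite mem_iota => /andP[_ iUs]; have [_ Hst _ _] := HUs.
have [f Hf Hr] := KV_subquotient_residues mu1 mu2 HKV (Hst i.+1 iUs) Hiso.
exact: (label_dominates he bn hs hc0 hb hres hres' hgap mu1 mu2 Hf
  (residues_congr mu1 mu2 Hf Hr) hv).
Qed.

(** At least one by the quotient map Ga of the lattice, at most one because the residues single out
    one tableau of the label shape, by [label_tab_unique]. *)
Lemma label_multiplicity : exists d (T : 'I_n -> 'M[A]_d),
  [/\ hecke_module qA QA T,
      is_KV (fun i => map_mx vA (T i)) q Q (label_shape sg p b n)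
    & comp_mult (fun i => map_mx th (T i)) (fun i => (line_character i)%:M : 'M[C]_1) 1].
Proof.
have /and3P[la1 la2 _] := label_is_bipart sg p0 bn.
have [d [tab Htab]] := tableaux_exist n la1 la2.
have [t1 _ t3] := Htab; have [r0 Hr0] := t3 _ (label_std sg p0 bn).
have d0 : (0 < d)%N by case: (r0) => ? h; apply: leq_ltn_trans h.
have thQ1 : th QA.1 != 0 by rewrite (thQ false) expfz_neq0.
have hQ : (b < n)%N -> th (component QA c0) * eta ^ (dsign sg * b%:Z) = th QA.1.
  move=> bn'; rewrite thQ (thQ false) -expfzDr //.
  by apply/(eta_exprz_congr he heta); apply: hres'.
have [TA [B [Ga [HB HT HGa Ga0]]]] := integral_form vA_inj iA_inj thiA iAX qAV Hgen he heta bn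
  Htab Hr0 thQ1 hc0 hQ n0.
have chisE i : chis th eta QA sg c0 i = line_character i.
  by case: i => [|i] //=; rewrite /jm_value mulr0 expr0z mulr1 thQ.
exists d, (fun i : 'I_n => TA i); split.
- by apply: (integral_form_hecke la1 la2 Htab HB HT).
- by apply: (integral_form_KV la1 la2 Htab d0 HB HT).
have HGa' (i : 'I_n) : map_mx th (TA i) *m Ga = line_character i *: Ga by rewrite -chisE HGa.
have [Us HUs cnt] := composition_series_quotient Ga0 HGa'.
exists Us => //; apply/eqP; rewrite eq_sym eqn_leq cnt andbT.
apply: (mult_le1 vA_inj q0 la1 la2 t1 (B := invmx B) _ _ n0 (r0 := r0)) => //.
- by rewrite unitmx_inv.
- by move=> r k kn; apply: (integral_form_eigen la1 la2 Htab HB HT).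
move=> r Hr; have [_ t2 _] := Htab; apply: t2 => k kn; rewrite Hr0 //.
exact: (label_tab_unique he bn hs hc0 hb hres hres' hgap la1 la2 (t1 r)
  (residues_congr la1 la2 (t1 r) Hr) hv (erefl _)).
Qed.

End Label.

End Integral.

(** * One-dimensional modules and the labels *)

Definition line_shape (sg c0 : bool) (n : nat) : bipart :=
  if c0 then ([::], line sg n) else (line sg n, [::]).

Definition line_coef (R : comNzRingType) (q : R) (Q : R * R) (sg c0 : bool) (i : nat) : R :=
  if i is 0%N then component Q c0 else if sg then -1 else q.

Lemma in_line_shape sg c0 n x : in_diagram (line_shape sg c0 n) x <->
  exists2 k, (k < n)%N & ((line_node sg k).1, c0) = x.
Proof.
case: x => [[a b] c]; rewrite /in_diagram /line_shape /line_node /=; split.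
- case: c0; case: c => /=; rewrite ?nth_nil // nth_line; case: sg => h.
  + by exists a; [|congr (_, _, _)]; lia.
  + by exists b; [|congr (_, _, _)]; case: eqP h; lia.
  + by exists a; [|congr (_, _, _)]; lia.
  + by exists b; [|congr (_, _, _)]; case: eqP h; lia.
- move=> [k kn] E; have -> : c = c0 by case: sg E => -[].
  have -> : component (if c0 then ([::], line sg n) else (line sg n, [::])) c0 = line sg n.
    by case: c0 {E}.
  by rewrite nth_line; case: sg E => -[<- <- _]; rewrite ?kn ?eqxx.
Qed.

Lemma line_std sg c0 n : std n (line_shape sg c0 n) (fun k => ((line_node sg k).1, c0)).
Proof.
split=> [k k' _ _|x|k k' a b c _ _|k k' a b c _ _]; first by rewrite /line_node; case: sg => -[].
- exact: in_line_shape.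
- by rewrite /line_node; case: sg => -[? ? _] [? ? _]; lia.
- by rewrite /line_node; case: sg => -[? ? _] [? ? _]; lia.
Qed.

Lemma line_std_unique sg c0 n f : std n (line_shape sg c0 n) f ->
  forall k, (k < n)%N -> f k = ((line_node sg k).1, c0).
Proof.
move=> Hf; have la1 : is_part (line_shape sg c0 n).1.
  by rewrite /line_shape; case: c0 {Hf} => //; apply: line_is_part.
have la2 : is_part (line_shape sg c0 n).2.
  by rewrite /line_shape; case: c0 {Hf la1} => //; apply: line_is_part.
move=> k; elim/ltn_ind: k => k IH kn.
have [inj D _ _] := Hf.
have [k' k'n E] : exists2 k', (k' < n)%N & ((line_node sg k').1, c0) = f k.
  by apply/in_line_shape/D; exists k.
have lek : (k' <= k)%N.
  move: (esym E); rewrite /line_node; case: (sg) => /= fk;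
    by have := std_bound0 la1 la2 Hf kn fk; lia.
rewrite -E; move: lek; rewrite leq_eqVlt => /orP[/eqP -> //|lt].
by have := IH _ lt k'n; rewrite E => /(inj _ _ k'n kn); lia.
Qed.

Lemma line_hecke (R : comNzRingType) (q : R) (Q : R * R) sg c0 n :
  hecke_module q Q (fun i : 'I_n => (line_coef q Q sg c0 i)%:M : 'M[R]_1).
Proof.
split=> [i i0|i i0|i j i0 j1|i j i0 j1|i j ij].
- rewrite -!raddfB -scalar_mxM /line_coef i0 /=; case: c0 => /=; first by rewrite subrr mulr0 raddf0.
  by rewrite subrr mul0r raddf0.
- rewrite -raddfB -raddfD -scalar_mxM /line_coef; case: (val i) i0 => //= m _.
  by case: sg; rewrite ?addNr ?subrr ?mulr0 ?mul0r raddf0.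
- by rewrite -!scalar_mxM; congr (_ %:M); ring.
- rewrite j1; case: (val i) i0 => //.
- by rewrite -!scalar_mxM mulrC.
Qed.

Lemma line_KV (K : fieldType) (q : K) (Q : K * K) sg c0 n : q != 0 ->
  is_KV (fun i : 'I_n => (line_coef q Q sg c0 i)%:M : 'M[K]_1) q Q (line_shape sg c0 n).
Proof.
move=> q0; split; first exact: line_hecke.
  split=> // U _; have [->|U0] := eqVneq U 0; first by left.
  by right; rewrite /row_full eqn_leq rank_leq_row lt0n mxrank_eq0.
exists (fun=> [ffun k : 'I_n => ((line_node sg k).1, c0)]), 1%:M.
split; rewrite ?unitmx1 //.
- by move=> i j _; rewrite (ord1 i) (ord1 j).
- move=> u; rewrite standardE; split=> [Hu|[_ <-]].
    by exists 0; apply/ffunP => k; rewrite ffunE -ndE (line_std_unique Hu).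
  by apply: std_ext (line_std sg c0 n) => k kn; rewrite -[k]/(val (Ordinal kn)) ndE ffunE.
move=> r k; rewrite ffunE (jucys_murphyE (fun i => (line_coef q Q sg c0 i)%:M)).
have -> l : wprod (fun i => (line_coef q Q sg c0 i)%:M : 'M[K]_1) l =
    (\prod_(j <- l) line_coef q Q sg c0 j)%:M.
  elim: l => [|i l IH]; first by rewrite wprod_nil big_nil.
  by rewrite /wprod !big_cons -/(wprod _ _) IH -scalar_mxM.
have E : \prod_(j <- iota 1 k) line_coef q Q sg c0 j = (if sg then -1 else q) ^+ k.
  rewrite big_seq_cond (eq_bigr (fun=> if sg then -1 else q)) => [|[|j]]; last 2 first.
  - by rewrite mem_iota.
  - by [].
  by rewrite -big_seq_cond big_const_seq count_predT size_iota -iter_mulr_1.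
rewrite /jm_word big_cat big_cons /= (perm_big (iota 1 k)) ?perm_rev //= E.
rewrite mulrCA -exprMn -scalemxAr mul_mx_scalar scalerA.
rewrite /line_node; case: sg {E} => /=; congr (_ *: _); rewrite mulrCA; congr (_ * _).
  by rewrite mulrNN mulr1 expr1n mulr1 sub0r -exprnN.
by rewrite subr0 exprMn mulKf ?expf_neq0 // -exprnP.
Qed.

Lemma mull_row0 p : mull_row p.+1 0 = [::].
Proof. by rewrite /mull_row /= div0n mod0n subn0; elim: p. Qed.

(** * The concrete ring A and its specialization *)

Section Concrete.

Variable C : fieldType.

Definition iA (p : {poly C}) : genA C := polA (p%:P%:P).

Lemma iA_zmod : zmod_morphism iA.
Proof. by move=> x y; apply: val_inj; rewrite /= /fracK !polyCB tofracB. Qed.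

Lemma iA_monoid : monoid_morphism iA.
Proof.
split=> [|x y]; apply: val_inj; first by rewrite /= /fracK tofrac1.
by rewrite /= /fracK !polyCM tofracM.
Qed.

HB.instance Definition _ := GRing.isZmodMorphism.Build {poly C} (genA C) iA iA_zmod.
HB.instance Definition _ := GRing.isMonoidMorphism.Build {poly C} (genA C) iA iA_monoid.

Lemma iA_inj : injective iA.
Proof.
move=> x y /(congr1 val) /= /eqP; rewrite /fracK tofrac_eq => /eqP.
by move=> /polyC_inj/polyC_inj.
Qed.

Lemma qAi_laurent : (fracK (qP C))^-1 \in @laurent C.
Proof.
have E (F : fieldType) (x a : F) k : 1 = a / x ^+ k -> x^-1 = a / x ^+ k.+1.
  by move=> E; rewrite exprS invfM mulrCA -E mulr1.
have /laurentP[[k a] /eqP /E h] : 1 \in @laurent C := rpred1 _.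
by apply/laurentP; exists (k.+1, a); apply/eqP.
Qed.

Definition qAi : genA C := Sub (fracK (qP C))^-1 qAi_laurent.

Lemma qA_qAi : qA C * qAi = 1.
Proof. by apply: val_inj; rewrite /= divff // fracK_q_neq0. Qed.

Lemma generic_genK : generic_params (qK C) (QK C).
Proof. by split; [exact: qK_neq0|move=> c c' z w; exact: gen_inj]. Qed.

Variables (n e : nat) (eta : C) (s : int * int) (v : rat * rat).
Hypotheses (n0 : (0 < n)%N) (he : (2 <= e)%N) (heta : e.-primitive_root eta).
Hypotheses (hs : s.2 < s.1) (hv : v.1 < v.2).

Lemma line_label (sg c0 : bool) (b : nat) : (b <= n)%N -> ((0 < b)%N -> c0 = true) ->
  (b < e)%N ->
  (forall k, (k < b)%N -> ~ congr_mod e s.1 (s.2 + dsign sg * k%:Z)) ->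
  ((b < n)%N -> congr_mod e (component s c0 + dsign sg * b%:Z) s.1) ->
  b%:Z <= (height sg e)%:Z * (s.1 - s.2) ->
  theta_label n eta s v (line_shape sg c0 n) (label_shape sg (height sg e) b n).
Proof.
move=> bn hc0 hb hres hres' hgap.
have eta0 := eta_neq0 he heta.
have [tz tm] := theta_morphism (eta ^ s.1) (eta ^ s.2) eta0.
pose th : {rmorphism genA C -> C} := HB.pack (theta eta (eta ^ s.1) (eta ^ s.2))
  (GRing.isZmodMorphism.Build _ _ _ tz) (GRing.isMonoidMorphism.Build _ _ _ tm).
pose vA : {rmorphism genA C -> genK C} := \val.
have vA_inj : injective vA by exact: val_inj.
have [thq thQ1 thQ2] : [/\ th (qA C) = eta, th (QA C).1 = eta ^ s.1 & th (QA C).2 = eta ^ s.2].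
  exact: theta_gen.
have thQ c : th (component (QA C) c) = eta ^ component s c by case: c.
have thiA (p : {poly C}) : th (iA p) = p.[eta].
  by rewrite [LHS]theta_pol // /eval_pol !hornerC.
pose T (i : 'I_n) : 'M[genA C]_1 := (line_coef (qA C) (QA C) sg c0 i)%:M.
have specE : specialize eta s T = (fun i : 'I_n => (line_character eta s sg c0 i)%:M : 'M[C]_1).
  apply/funext => i; rewrite /specialize -/th (map_scalar_mx th) /line_coef /line_character.
  by case: (val i) => [|m]; rewrite ?thQ //; case: (sg); rewrite ?thq ?rmorphN1.
exists T; first split.
- exact: line_hecke.
- have -> : (fun i => map_mx val (T i)) =
      (fun i : 'I_n => (line_coef (qK C) (QK C) sg c0 i)%:M : 'M[genK C]_1).
    apply/funext => i; rewrite (map_scalar_mx vA); congr (_ %:M); rewrite /line_coef.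
    by case: (val i) => [|m]; [case: (c0)|case: (sg); rewrite ?rmorphN1].
  by apply: line_KV; exact: qK_neq0.
rewrite specE; split.
- by apply: label_is_bipart => //; apply: height_gt0.
- have [d [T' [h1 h2 h3]]] := label_multiplicity vA_inj generic_genK n0 iA_inj thiA (erefl _)
    qA_qAi he heta hs thQ bn hc0 hb hres hres' hgap hv.
  by exists d, T'.
- move=> mu k /and3P[mu1 mu2 _] [d [T' [[_ hKV] hm]]] k0.
  exact: (subquotient_dominated vA_inj generic_genK n0 thiA (erefl _) he heta hs thQ
    bn hc0 hb hres hres' hgap hv mu1 mu2 hKV hm k0).
Qed.

End Concrete.

Lemma modz_congr (e j : nat) (a : int) : (j < e)%N -> (j%:Z = a %[mod e%:Z])%Z ->
  congr_mod e a j%:Z.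
Proof.
move=> je; rewrite modz_small ?je //= => ->; exists (a %/ e%:Z)%Z.
by rewrite addrC -divz_eq.
Qed.

Lemma mull_row2 m : mull_row 2 m = mkpart [:: m].
Proof. by rewrite /mull_row /= modn1 divn1. Qed.

Lemma mkpart1 m : (0 < m)%N -> mkpart [:: m] = [:: m].
Proof. by rewrite /mkpart /= => ->. Qed.

(** * The choice of b *)

Section Cases.

Variables (C : fieldType) (n e : nat) (eta : C) (s : int * int) (v : rat * rat).
Hypotheses (n0 : (0 < n)%N) (he : (2 <= e)%N) (heta : e.-primitive_root eta).
Hypotheses (hs : s.2 < s.1) (hv : v.1 < v.2).

Lemma line_label_first (sg : bool) :
  theta_label n eta s v (line_shape sg false n) (label_shape sg (height sg e) 0 n).
Proof.
apply: line_label => //=.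
- by lia.
- by move=> _; exists 0; rewrite mul0r mulr0.
- have := height_gt0 sg he; nia.
Qed.

(** Going along the line from s_2, the residue of s_1 is first met at k = j, whence b = min (n, j).
    The gap condition uses s_1 > s_2: in the sign case j <= e - 1 = p, and otherwise s_1 - s_2 is
    positive and congruent to j < e, hence at least j. *)
Lemma line_label_second (sg : bool) (j : nat) : (j < e)%N ->
  congr_mod e (dsign sg * (s.1 - s.2)) j%:Z ->
  theta_label n eta s v (line_shape sg true n) (label_shape sg (height sg e) (minn n j) n).
Proof.
move=> je [z Hz]; apply: line_label => //=.
- by lia.
- by lia.
- move=> k kb [z' Hz']; have kj : (k < j)%N by lia.
  have [w Hw] : exists w, j%:Z - k%:Z = w * e%:Z.
    move: Hz Hz'; rewrite /dsign; case: (sg) => Hz Hz'.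
      by exists (- z' - z); lia.
    by exists (z' - z); lia.
  have : (w <= 0) || (1 <= w) by lia.
  by clear - Hw kj je; case/orP => hw; nia.
- move=> nj; have -> : minn n j = j by lia.
  move: Hz; rewrite /dsign; case: (sg) => Hz; first by exists z; lia.
  by exists (- z); lia.
- have bj : (minn n j <= j)%N by lia.
  move: (minn n j) bj => b bj; have g0 : 1 <= s.1 - s.2 by lia.
  move: (s.1 - s.2) g0 Hz => g g0; rewrite /dsign /height; case: (sg) => Hz.
    have : j%:Z <= (e.-1)%:Z by lia.
    by clear - bj g0; nia.
  have : (z <= -1) || (0 <= z) by lia.
  by clear - Hz bj g0 je; case/orP => hz; nia.
Qed.

End Cases.

Theorem mainTheorem7 (R : realType) (n e : nat) (eta : R[i])
    (s : int * int) (v : rat * rat)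
    (hn : (1 <= n)%N) (he : (2 <= e)%N)
    (heta : e.-primitive_root eta)
    (hs : s.2 < s.1)
    (hv : v.1 < v.2 /\ v.2 < v.1 + e%:R) :
  [/\ theta_label n eta s v ([:: n], [::]) ([:: n], [::]),
      forall j : nat, (j < e)%N -> (j%:Z = s.1 - s.2 %[mod e%:Z])%Z ->
        theta_label n eta s v ([::], [:: n])
          (if (n <= j)%N then ([::], [:: n])
           else (mkpart [:: (n - j)%N], mkpart [:: j])),
      theta_label n eta s v (nseq n 1%N, [::]) (mull_row e n, [::])
    & forall j : nat, (j < e)%N -> (j%:Z = s.2 - s.1 %[mod e%:Z])%Z ->
        theta_label n eta s v ([::], nseq n 1%N)
          (if (n <= j)%N then ([::], nseq n 1%N)
           else (mull_row e (n - j), nseq j 1%N))].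
Proof.
have [hv1 _] := hv; have eE : e.-1.+1 = e by lia.
split.
- have := line_label_first hn he heta hs hv1 false.
  rewrite -[line_shape _ _ _]/(mkpart [:: n], [::]).
  (* For p = 1 the columns have height one and form a single row. *)
  by rewrite -[label_shape _ _ _ _]/(mull_row 2 (n - 0), [::]) subn0 mull_row2 mkpart1.
- move=> j je /(modz_congr je) hj.
  have := line_label_second hn he heta hs hv1 (sg := false) je; rewrite mul1r => /(_ hj).
  rewrite -[line_shape _ _ _]/([::], mkpart [:: n]) /label_shape mull_row2 mkpart1 //.
  case: leqP => nj; last exact.
  by rewrite subnn [line _ _](mkpart1 hn).
- have := line_label_first hn he heta hs hv1 true.
  by rewrite -[label_shape _ _ _ _]/(mull_row e.-1.+1 (n - 0), [::]) subn0 eE.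
- move=> j je /(modz_congr je) hj.
  have := line_label_second hn he heta hs hv1 (sg := true) je; rewrite mulN1r opprB => /(_ hj).
  rewrite /label_shape; case: leqP => nj; last by rewrite [height _ _]/(e.-1) eE.
  by rewrite subnn mull_row0.
Qed.
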